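(* The following hold for the class $\mathcal{S}^*_{Ne}$: (i) $R_{\mathcal{S}^*_{Ne}}(\mathcal{T}_1)= 1/4$; (ii) $R_{\mathcal{S}^*_{Ne}}(\mathcal{T}_2)=(4-\sqrt{10})/3$ $(\approx 0.279241)$; (iii) $R_{\mathcal{S}^*_{Ne}}(\mathcal{T}_3)=2/\sqrt{77}$ $(\approx 0.227921)$.
   Context: Let $\mathbb{D}=\{z\in\mathbb{C}:|z|<1\}$ and let $\mathcal{A}$ be the class of analytic functions $f:\mathbb{D}\to\mathbb{C}$ with $f(0)=0$, $f'(0)=1$. For analytic $f,g$ on $\mathbb{D}$, $f\prec g$ ($f$ is subordinate to $g$) means $f=g\circ w$ for some analytic $w:\mathbb{D}\to\mathbb{D}$ with $w(0)=0$. Square roots are principal branches, and quotients such as $f/g$, $g/(zp)$, $zf'/f$ are understood with removable singularities at $0$ filled in. Define $\mathcal{T}_1$: all $f\in\mathcal{A}$ such that $f/g\prec e^z$ and $g/(zp)\prec e^z$ for some $g\in\mathcal{A}$ and some $p\prec\sqrt{1+z}$; $\mathcal{T}_2$: all $f\in\mathcal{A}$ such that $f/g\prec \sqrt{1+z}$ and $g/(zp)\prec \sqrt{1+z}$ for some $g\in\mathcal{A}$ and some $p\prec e^z$; $\mathcal{T}_3$: all $f\in\mathcal{A}$ such that $f/g\prec z+\sqrt{1+z^2}$ and $g/(zp)\prec z+\sqrt{1+z^2}$ for some $g\in\mathcal{A}$ and some $p\prec z+\sqrt{1+z^2}$. $\mathcal{S}^*_{Ne}$ is the class of $f\in\mathcal{A}$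 with $zf'(z)/f(z)\prec 1+z-\frac{z^3}{3}$. For classes $\mathcal{G},\mathcal{M}\subset\mathcal{A}$, the $\mathcal{G}$-radius $R_{\mathcal{G}}(\mathcal{M})$ is $\inf\{\rho_f: f\in\mathcal{M}\}$, where $\rho_f$ is the largest number in $(0,1]$ such that for every $0<r\le\rho_f$ the function $f$ has the property defining $\mathcal{G}$ in the disk $|z|<r$, i.e. $z\mapsto f(rz)/r$ belongs to $\mathcal{G}$. *)

(* Defs.v *)
From Stdlib Require Import Reals Lra.
From Coquelicot Require Import Coquelicot.
Open Scope R_scope.

Definition Cexp (z : C) : C :=
  (exp (Re z) * (cos (Im z), sin (Im z)))%C.

(* Half-angle form of the principal branch; see [Csqrt_principal]. *)
Definition Csqrt (z : C) : C :=
  (sqrt ((Cmod z + Re z) / 2),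
   (if Rlt_dec (Im z) 0 then -1 else 1) * sqrt ((Cmod z - Re z) / 2)).

Lemma Csqrt_principal (z : C) :
  (Csqrt z * Csqrt z)%C = z /\
  (0 < Re (Csqrt z) \/ Re (Csqrt z) = 0 /\ 0 <= Im (Csqrt z)).
Proof.
destruct z as [x y].
assert (Hm : Rabs x <= Cmod (x, y)) by exact (re_le_Cmod (x, y)).
assert (Hx := Rle_abs x); assert (Hx' := Rle_abs (- x)); rewrite Rabs_Ropp in Hx'.
assert (Hsq : Cmod (x, y) * Cmod (x, y) = x * x + y * y).
{ unfold Cmod; simpl; rewrite sqrt_sqrt; nra. }
assert (Hm0 := Cmod_ge_0 (x, y)).
unfold Csqrt, Re, Im; simpl fst; simpl snd.
set (m := Cmod (x, y)) in *.
set (a := sqrt ((m + x) / 2)); set (b := sqrt ((m - x) / 2)).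
assert (Ha : a * a = (m + x) / 2) by (apply sqrt_sqrt; lra).
assert (Hb : b * b = (m - x) / 2) by (apply sqrt_sqrt; lra).
assert (Ha0 : 0 <= a) by apply sqrt_pos.
assert (Hb0 : 0 <= b) by apply sqrt_pos.
assert (Hab : (2 * (a * b)) * (2 * (a * b)) = y * y).
{ replace ((2 * (a * b)) * (2 * (a * b))) with (4 * (a * a) * (b * b)) by ring.
  rewrite Ha, Hb; nra. }
assert (Hp : 0 <= a * b) by (apply Rmult_le_pos; assumption).
destruct (Rlt_dec y 0) as [Hy | Hy].
- assert (E : 2 * (a * b) = - y) by nra.
  split.
  + unfold Cmult; simpl; f_equal; nra.
  + left; destruct Ha0 as [Ha0 | Ha0]; [exact Ha0 | rewrite <- Ha0 in E; lra].
- assert (E : 2 * (a * b) = y) by nra.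
  split.
  + unfold Cmult; simpl; f_equal; nra.
  + destruct Ha0 as [Ha0 | Ha0]; [left; exact Ha0 | right; lra].
Qed.

(* Functions on the unit disk are represented by total functions C -> C, of
   which only the values on the disk are ever used. *)
Definition inD (z : C) : Prop := Cmod z < 1.

Definition analytic (f : C -> C) : Prop :=
  forall z : C, inD z -> ex_derive (K := C_AbsRing) (V := C_NormedModule) f z.

Definition classA (f : C -> C) : Prop :=
  analytic f /\ f 0%C = 0%C /\
  is_derive (K := C_AbsRing) (V := C_NormedModule) f (0%C : C) (1%C : C).

Definition subordinate (f g : C -> C) : Prop :=
  exists w : C -> C,
    analytic w /\ (forall z, inD z -> inD (w z)) /\ w 0%C = 0%C /\
    (forall z, inD z -> f z = g (w z)).

(* [C_lim] is a total operator; it is the limit whenever the limit exists,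
   which is the case for all quotients considered below.  Away from 0, Rocq's
   quotient is 0 where the denominator vanishes; none of the superordinate
   functions below takes the value 0 on the disk, so subordination of a
   quotient forces its denominator not to vanish on the punctured disk. *)
Definition fill0 (q : C -> C) (z : C) : C :=
  if Ceq_dec z 0%C then C_lim q 0%C else q z.

Definition ratio_class (phi psi : C -> C) (f : C -> C) : Prop :=
  classA f /\
  exists g p : C -> C,
    classA g /\ subordinate p psi /\
    subordinate (fill0 (fun z => f z / g z)%C) phi /\
    subordinate (fill0 (fun z => g z / (z * p z))%C) phi.

Definition sqrt1p (z : C) : C := Csqrt (1 + z)%C.

Definition crescent (z : C) : C := (z + Csqrt (1 + z * z))%C.

Definition T1 : (C -> C) -> Prop := ratio_class Cexp sqrt1p.
Definition T2 : (C -> C) -> Prop := ratio_class sqrt1p Cexp.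
Definition T3 : (C -> C) -> Prop := ratio_class crescent crescent.

Definition nephroid (z : C) : C := (1 + z - z ^ 3 / 3)%C.

Definition S_Ne (f : C -> C) : Prop :=
  classA f /\
  subordinate (fill0 (fun z => z * C_derive f z / f z)%C) nephroid.

Definition holds_up_to (G : (C -> C) -> Prop) (f : C -> C) (rho : R) : Prop :=
  0 < rho <= 1 /\
  forall r : R, 0 < r <= rho -> G (fun z => f (r * z) / r)%C.

Definition is_fun_radius (G : (C -> C) -> Prop) (f : C -> C) (rho : R) : Prop :=
  holds_up_to G f rho /\ forall s : R, holds_up_to G f s -> s <= rho.

(* The first clause says that rho_f is defined for every f in M, so that no
   member of M is silently dropped from the infimum. *)
Definition is_class_radius (G M : (C -> C) -> Prop) (rad : R) : Prop :=
  (forall f, M f -> exists rho : R, is_fun_radius G f rho) /\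
  is_glb_Rbar (fun rho => exists f, M f /\ is_fun_radius G f rho) (Finite rad).

(* Main.v *)
(* If f is in one of the classes T_i, then f = z Phi(w1) Phi(w2) Psi(w3) with Schwarz functions
   w1, w2, w3, so q = z f'/f is 1 plus a sum of terms z w' L(w), where L is the logarithmic
   derivative of the superordinate function.  The map N(w) = 1 + w - w^3/3 is injective on the
   disk with an analytic inverse, so starlikeness in |z| < r just means that q maps |z| < r
   into the nephroid N(D).  The nephroid contains the rectangle |Re (v - 1)| < 2/3,
   |Im (v - 1)| <= 1, and Schwarz-Pick estimates for z w' L(w) keep q inside it up to the
   claimed radius.  In the class T_3 it is essential to bound the real part: the modulus of
   z w' / sqrt (1 + w^2) can reach r / sqrt (1 - r^2), but its real part is at most
   r / sqrt (1 + r^2) for small r.  For w1 = w2 = w3 = z the value q(-r) is the cusp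
   1/3 = N(-1), which lies outside N(D); this gives sharpness.

   That z f'/f is differentiable at all needs the regularity of holomorphic functions:
   Goursat's theorem gives primitives, and for functions with continuous derivative Cauchy's
   formula follows by contracting the circle. *)
Require Import Defs.
From Stdlib Require Import Reals Lra Lia Psatz Classical_Prop IndefiniteDescription.
From Coquelicot Require Import Coquelicot.
Open Scope R_scope.

(** The radii are the roots in (0, 1) of 2r + r/(2(1-r)) = 2/3, r/(1-r) + r = 2/3 and 3r/sqrt(1+r^2)
    = 2/3. The left sides are the sums of three termwise bounds, all attained at once at z = -r when
    the Schwarz functions are the identity, so estimating the terms separately loses nothing. Only
    the real part has to be estimated sharply: over the abscissas of the cusps the boundary of the
    nephroid has height (4/3)(sqrt 3 / 2)^(3/2), about 1.07, so crude modulus bounds settle the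
    imaginary part. The bound |z w'| <= |z| is available for |z| <= sqrt 2 - 1, and all three radii
    are smaller than that.

    Differentiability is assumed pointwise only, whereas contracting a circle means differentiating
    under the integral sign and needs a continuous derivative. A primitive of f has one, and the
    formula for f is recovered from that of its primitive.

    Membership in N(D) is proved by solving N(w) = v explicitly through the triple-angle formula
    rather than by an argument on the boundary curve. *)

(** * The modulus of complex numbers *)

Lemma Cmod_sub_sym (a b : C) : Cmod (a - b) = Cmod (b - a).
Proof. rewrite <- Cmod_opp. f_equal. ring. Qed.

Lemma Cmod_le_add (a b : C) : Cmod a <= Cmod b + Cmod (a - b).
Proof.
replace a with (b + (a - b))%C at 1 by ring. apply Cmod_triangle.
Qed.

Lemma Cmod_sq (z : C) : Cmod z * Cmod z = Re z * Re z + Im z * Im z.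
Proof. assert (H := Cmod2_alt z). simpl in H. lra. Qed.

Lemma im_le_Cmod (z : C) : Rabs (Im z) <= Cmod z.
Proof. apply Rle_trans with (2 := Rmax_Cmod z). apply Rmax_r. Qed.

Lemma Cmod_le_Re_Im (z : C) : Cmod z <= Rabs (Re z) + Rabs (Im z).
Proof.
assert (H := Cmod_sq z). assert (H0 := Cmod_ge_0 z).
assert (H1 := Rabs_pos (Re z)). assert (H2 := Rabs_pos (Im z)).
assert (H3 : Rabs (Re z) * Rabs (Re z) = Re z * Re z)
  by (rewrite <- Rabs_mult; apply Rabs_pos_eq; nra).
assert (H4 : Rabs (Im z) * Rabs (Im z) = Im z * Im z)
  by (rewrite <- Rabs_mult; apply Rabs_pos_eq; nra).
nra.
Qed.

Lemma Cmod_lt_neq_0 (z : C) : 0 < Cmod z -> z <> 0%C.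
Proof. intros H. now apply Cmod_gt_0. Qed.

Lemma Csub_neq_0_mod (a b : C) : Cmod a < Cmod b -> (b - a)%C <> 0%C.
Proof.
intros H E.
assert (b = a) by (replace b with (b - a + a)%C by ring; rewrite E; ring).
subst; lra.
Qed.

(* [ring] and [field] need the carrier to be displayed as [C]. *)
Ltac to_C :=
  change (UniformSpace.sort C_UniformSpace) with C in *;
  match goal with |- @eq _ ?a ?b => change (@eq C a b) end.
Ltac cring := to_C; ring.

(** * Continuity *)

Lemma locally_Cmod (z : C) (P : C -> Prop) :
  locally z P <-> exists d : R, 0 < d /\ forall x, Cmod (x - z) < d -> P x.
Proof.
split.
- intros H. apply locally_C in H. destruct H as [d H].
  exists d. split. apply cond_pos. intros x Hx. apply H. exact Hx.
- intros [d [Hd H]]. apply locally_C. exists (mkposreal d Hd).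
  intros x Hx. apply H. exact Hx.
Qed.

Lemma cont_Cmod_iff {U : UniformSpace} (f : U -> C) (x : U) :
  continuous f x <->
  forall e : R, 0 < e -> locally x (fun y => Cmod (f y - f x) < e).
Proof.
split.
- intros H e He. apply (H (fun c => Cmod (c - f x) < e)).
  apply locally_Cmod. exists e. tauto.
- intros H P HP. apply locally_Cmod in HP. destruct HP as [d [Hd HP]].
  change (locally x (fun y => P (f y))).
  generalize (H d Hd). apply filter_imp. intros y. apply HP.
Qed.

Lemma cont_Cplus {U : UniformSpace} (f g : U -> C) (x : U) :
  continuous f x -> continuous g x -> continuous (fun y => f y + g y)%C x.
Proof. apply (continuous_plus (V := C_NormedModule)). Qed.

Lemma cont_Copp {U : UniformSpace} (f : U -> C) (x : U) :
  continuous f x -> continuous (fun y => - f y)%C x.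
Proof. apply (continuous_opp (V := C_NormedModule)). Qed.

Lemma cont_Cminus {U : UniformSpace} (f g : U -> C) (x : U) :
  continuous f x -> continuous g x -> continuous (fun y => f y - g y)%C x.
Proof. intros Hf Hg. apply cont_Cplus. exact Hf. now apply cont_Copp. Qed.

Lemma cont_pair {U : UniformSpace} (f g : U -> R) (x : U) :
  continuous f x -> continuous g x ->
  continuous (fun y => (f y, g y) : C) x.
Proof.
intros Hf Hg. apply cont_Cmod_iff. intros e He.
assert (He2 : 0 < e / 2) by lra.
assert (H1 := proj1 (filterlim_locally _ _) Hf (mkposreal _ He2)).
assert (H2 := proj1 (filterlim_locally _ _) Hg (mkposreal _ He2)).
generalize (filter_and _ _ H1 H2). apply filter_imp.
intros y [A B].
apply Rle_lt_trans with (1 := Cmod_le_Re_Im _).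
simpl. unfold ball, AbsRing_ball in A, B; simpl in A, B.
unfold AbsRing_ball, abs, minus, plus, opp in A, B; simpl in A, B.
lra.
Qed.

Lemma cont_Re {U : UniformSpace} (f : U -> C) (x : U) :
  continuous f x -> continuous (fun y => Re (f y)) x.
Proof.
intros H. apply (continuous_comp f Re). exact H. apply continuous_fst.
Qed.

Lemma cont_Im {U : UniformSpace} (f : U -> C) (x : U) :
  continuous f x -> continuous (fun y => Im (f y)) x.
Proof.
intros H. apply (continuous_comp f Im). exact H. apply continuous_snd.
Qed.

Lemma cont_Rmult {U : UniformSpace} (f g : U -> R) (x : U) :
  continuous f x -> continuous g x -> continuous (fun y => f y * g y) x.
Proof. apply (continuous_mult (K := R_AbsRing)). Qed.

Lemma cont_Rplus {U : UniformSpace} (f g : U -> R) (x : U) :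
  continuous f x -> continuous g x -> continuous (fun y => f y + g y) x.
Proof. apply (continuous_plus (V := R_NormedModule)). Qed.

Lemma cont_Ropp {U : UniformSpace} (f : U -> R) (x : U) :
  continuous f x -> continuous (fun y => - f y) x.
Proof. apply (continuous_opp (V := R_NormedModule)). Qed.

Lemma cont_Cmult {U : UniformSpace} (f g : U -> C) (x : U) :
  continuous f x -> continuous g x -> continuous (fun y => f y * g y)%C x.
Proof.
intros Hf Hg. unfold Cmult.
apply cont_pair; repeat first [apply cont_Rplus | apply cont_Ropp | apply cont_Rmult];
  first [now apply cont_Re | now apply cont_Im].
Qed.

Lemma cont_Cinv {U : UniformSpace} (f : U -> C) (x : U) :
  continuous f x -> f x <> 0%C -> continuous (fun y => / f y)%C x.
Proof.
intros Hf Hn. unfold Cinv.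
assert (Hq : continuous (fun y => / (fst (f y) ^ 2 + snd (f y) ^ 2)) x).
{ apply (continuous_comp (fun y => fst (f y) ^ 2 + snd (f y) ^ 2) Rinv);
    [ | apply continuous_Rinv].
  - simpl. repeat first [apply cont_Rplus | apply cont_Rmult];
      first [now apply cont_Re | now apply cont_Im | apply continuous_const].
  - intros E. apply Hn. apply Cmod_eq_0. unfold Cmod.
    rewrite E. apply sqrt_0. }
unfold Rdiv.
apply cont_pair; repeat first [exact Hq | apply cont_Ropp | apply cont_Rmult];
  first [now apply cont_Re | now apply cont_Im].
Qed.

Lemma cont_Cdiv {U : UniformSpace} (f g : U -> C) (x : U) :
  continuous f x -> continuous g x -> g x <> 0%C ->
  continuous (fun y => f y / g y)%C x.
Proof.
intros Hf Hg Hn. apply cont_Cmult. exact Hf. now apply cont_Cinv.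
Qed.

Lemma cont_RtoC {U : UniformSpace} (f : U -> R) (x : U) :
  continuous f x -> continuous (fun y => RtoC (f y)) x.
Proof.
intros Hf. apply cont_pair. exact Hf. apply continuous_const.
Qed.

(** * Complex derivatives *)

(* Carathéodory's form of [is_derive]: the slope is a continuous function.
   It turns the differentiation rules into algebraic identities. *)
Definition cder (f : C -> C) (z l : C) : Prop :=
  exists phi : C -> C, continuous phi z /\ phi z = l /\
    locally z (fun x => f x = f z + (x - z) * phi x)%C.

Lemma cder_is_derive (f : C -> C) (z l : C) :
  cder f z l <-> is_derive (K := C_AbsRing) (V := C_NormedModule) f z l.
Proof.
split.
- intros [phi [Hc [Hl H]]]. split. apply is_linear_scal_l.
  intros x Hx.
  assert (E : z = x)
    by exact (is_filter_lim_locally_unique (V := AbsRing_NormedModule C_AbsRing) _ _ Hx).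
  clear Hx. subst x.
  intros e.
  assert (Hc' := proj1 (cont_Cmod_iff phi z) Hc (pos e) (cond_pos e)).
  assert (G := filter_and _ _ H Hc'). apply locally_C in G.
  revert G. apply filter_imp. intros x [Ex Hx].
  change (Cmod (f x - f z - (x - z) * l) <= e * Cmod (x - z))%C.
  rewrite Ex, <- Hl.
  replace (f z + (x - z) * phi x - f z - (x - z) * phi z)%C
    with ((phi x - phi z) * (x - z))%C by ring.
  rewrite Cmod_mult. apply Rmult_le_compat_r. apply Cmod_ge_0. lra.
- intros [_ H]. specialize (H z (fun P HP => HP)).
  exists (fun x => if Ceq_dec x z then l else ((f x - f z) / (x - z))%C).
  repeat split.
  + apply cont_Cmod_iff. intros e He.
    assert (He2 : 0 < e / 2) by lra.
    specialize (H (mkposreal _ He2)). apply locally_C in H.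
    revert H. apply filter_imp. intros x Hx.
    change (Cmod (f x - f z - (x - z) * l)%C <= e / 2 * Cmod (x - z))%C in Hx.
    destruct (Ceq_dec z z) as [_ | n]; [ | now elim n].
    destruct (Ceq_dec x z) as [E | n].
    * replace (l - l)%C with (0 : C)%C by ring. rewrite Cmod_0. lra.
    * assert (Hn : (x - z)%C <> 0%C) by now apply Cminus_eq_contra.
      replace ((f x - f z) / (x - z) - l)%C
        with ((f x - f z - (x - z) * l) / (x - z))%C by now field.
      rewrite Cmod_div by exact Hn.
      assert (Hp : 0 < Cmod (x - z)) by now apply Cmod_gt_0.
      apply Rle_lt_trans with (e / 2); [ | lra].
      apply Rmult_le_reg_r with (1 := Hp).
      unfold Rdiv at 1. rewrite Rmult_assoc, Rinv_l by lra. lra.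
  + destruct (Ceq_dec z z) as [_ | n]; [reflexivity | now elim n].
  + apply filter_forall. intros x.
    destruct (Ceq_dec x z) as [E | n]; [subst; ring | field].
    now apply Cminus_eq_contra.
Qed.

Lemma cder_C_derive (f : C -> C) (z l : C) : cder f z l -> C_derive f z = l.
Proof. intros H. apply is_C_derive_unique. now apply cder_is_derive. Qed.

Lemma cder_unique (f : C -> C) (z l m : C) : cder f z l -> cder f z m -> l = m.
Proof. intros Hl Hm. rewrite <- (cder_C_derive _ _ _ Hl). now apply cder_C_derive. Qed.

Lemma analytic_cder (f : C -> C) (z : C) :
  analytic f -> inD z -> cder f z (C_derive f z).
Proof.
intros Hf Hz. destruct (Hf z Hz) as [l Hl].
rewrite (is_C_derive_unique _ _ _ Hl). now apply cder_is_derive.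
Qed.

Lemma cder_analytic (f g : C -> C) :
  (forall z, inD z -> cder f z (g z)) -> analytic f.
Proof.
intros H z Hz. exists (g z). apply cder_is_derive. now apply H.
Qed.

Lemma cder_cont (f : C -> C) (z l : C) : cder f z l -> continuous f z.
Proof.
intros [phi [Hc [_ H]]].
apply continuous_ext_loc with (g := fun x => (f z + (x - z) * phi x)%C).
- revert H. apply filter_imp. intros x E. now symmetry.
- apply cont_Cplus. apply continuous_const.
  apply cont_Cmult; [ | exact Hc].
  apply cont_Cminus. apply continuous_id. apply continuous_const.
Qed.

Lemma analytic_cont (f : C -> C) (z : C) :
  analytic f -> inD z -> continuous f z.
Proof. intros Hf Hz. apply cder_cont with (1 := analytic_cder f z Hf Hz). Qed.

Lemma cder_ext_loc (f g : C -> C) (z l : C) :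
  locally z (fun x => f x = g x) -> cder f z l -> cder g z l.
Proof.
intros E [phi [Hc [Hl H]]]. exists phi. repeat split; auto.
assert (E0 := locally_singleton _ _ E). simpl in E0.
generalize (filter_and _ _ E H). apply filter_imp.
intros x [A B]. rewrite <- A, <- E0. exact B.
Qed.

Lemma cder_ext (f g : C -> C) (z l : C) :
  (forall x, f x = g x) -> cder f z l -> cder g z l.
Proof. intros E. apply cder_ext_loc. now apply filter_forall. Qed.

Lemma cder_const (c z : C) : cder (fun _ => c) z 0%C.
Proof.
exists (fun _ => 0%C). repeat split. apply continuous_const.
apply filter_forall. intros x. cring.
Qed.

Lemma cder_id (z : C) : cder (fun x => x) z 1%C.
Proof.
exists (fun _ => 1%C). repeat split. apply continuous_const.
apply filter_forall. intros x. cring.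
Qed.

Lemma cder_plus (f g : C -> C) (z l m : C) :
  cder f z l -> cder g z m -> cder (fun x => f x + g x)%C z (l + m)%C.
Proof.
intros [p [Hp [<- Ep]]] [q [Hq [<- Eq]]].
exists (fun x => p x + q x)%C. repeat split. now apply cont_Cplus.
generalize (filter_and _ _ Ep Eq). apply filter_imp.
intros x [-> ->]. cring.
Qed.

Lemma cder_mult (f g : C -> C) (z l m : C) :
  cder f z l -> cder g z m ->
  cder (fun x => f x * g x)%C z (l * g z + f z * m)%C.
Proof.
intros Hf Hg. assert (Cg := cder_cont _ _ _ Hg).
destruct Hf as [p [Hp [<- Ep]]]. destruct Hg as [q [Hq [<- Eq]]].
exists (fun x => p x * g x + f z * q x)%C. repeat split.
- apply cont_Cplus; apply cont_Cmult; auto. apply continuous_const.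
- generalize (filter_and _ _ Ep Eq). apply filter_imp.
  intros x [-> ->]. cring.
Qed.

Lemma cder_scal (c : C) (f : C -> C) (z l : C) :
  cder f z l -> cder (fun x => c * f x)%C z (c * l)%C.
Proof.
intros H. replace (c * l)%C with (0 * f z + c * l)%C by ring.
apply (cder_mult (fun _ => c)). apply cder_const. exact H.
Qed.

Lemma cder_opp (f : C -> C) (z l : C) :
  cder f z l -> cder (fun x => - f x)%C z (- l)%C.
Proof.
intros H. replace (- l)%C with (-1 * l)%C by ring.
apply cder_ext with (fun x => -1 * f x)%C. intros; cring. now apply cder_scal.
Qed.

Lemma cder_minus (f g : C -> C) (z l m : C) :
  cder f z l -> cder g z m -> cder (fun x => f x - g x)%C z (l - m)%C.
Proof. intros Hf Hg. apply cder_plus. exact Hf. now apply cder_opp. Qed.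

Lemma cder_inv (f : C -> C) (z l : C) :
  cder f z l -> f z <> 0%C -> cder (fun x => / f x)%C z (- l / (f z * f z))%C.
Proof.
intros Hf Hn. assert (Cf := cder_cont _ _ _ Hf).
destruct Hf as [p [Hp [<- Ep]]].
exists (fun x => - p x / (f x * f z))%C. repeat split.
- apply cont_Cdiv.
  + now apply cont_Copp.
  + apply cont_Cmult; [exact Cf | apply continuous_const].
  + now apply Cmult_neq_0.
- assert (Hm : 0 < Cmod (f z)) by now apply Cmod_gt_0.
  assert (Hc := proj1 (cont_Cmod_iff f z) Cf _ Hm).
  generalize (filter_and _ _ Ep Hc). apply filter_imp.
  intros x [E Hx].
  assert (Hnx : f x <> 0%C).
  { intros E0. rewrite E0 in Hx. rewrite Cmod_sub_sym in Hx.
    replace (f z - 0)%C with (f z) in Hx by ring. lra. }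
  field_simplify_eq; [ | split; assumption].
  rewrite E. cring.
Qed.

Lemma cder_div (f g : C -> C) (z l m : C) :
  cder f z l -> cder g z m -> g z <> 0%C ->
  cder (fun x => f x / g x)%C z ((l * g z - f z * m) / (g z * g z))%C.
Proof.
intros Hf Hg Hn.
replace ((l * g z - f z * m) / (g z * g z))%C
  with (l * / g z + f z * (- m / (g z * g z)))%C by now field.
apply (cder_mult f (fun x => / g x)%C). exact Hf. now apply cder_inv.
Qed.

Lemma cder_comp (f g : C -> C) (z l m : C) :
  cder f (g z) l -> cder g z m -> cder (fun x => f (g x)) z (l * m)%C.
Proof.
intros Hf Hg. assert (Cg := cder_cont _ _ _ Hg).
destruct Hf as [p [Hp [<- Ep]]]. destruct Hg as [q [Hq [<- Eq]]].
exists (fun x => p (g x) * q x)%C. repeat split.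
- apply cont_Cmult; [ | exact Hq]. now apply (continuous_comp g p).
- assert (Ep' : locally z (fun x => f (g x) = f (g z) + (g x - g z) * p (g x))%C)
    by exact (Cg _ Ep).
  generalize (filter_and _ _ Ep' Eq). apply filter_imp.
  intros x [E1 E2]. rewrite E1. rewrite E2 at 1. cring.
Qed.

Lemma inD_locally (z : C) : inD z -> locally z inD.
Proof.
intros Hz. apply locally_Cmod. exists (1 - Cmod z). split.
- unfold inD in Hz. lra.
- intros x Hx. unfold inD. assert (H := Cmod_le_add x z). lra.
Qed.

Lemma analytic_plus (f g : C -> C) :
  analytic f -> analytic g -> analytic (fun x => f x + g x)%C.
Proof.
intros Hf Hg. eapply cder_analytic. intros z Hz.
apply cder_plus; now apply analytic_cder.
Qed.

Lemma analytic_mult (f g : C -> C) :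
  analytic f -> analytic g -> analytic (fun x => f x * g x)%C.
Proof.
intros Hf Hg.
apply cder_analytic with (fun z => C_derive f z * g z + f z * C_derive g z)%C.
intros z Hz. apply cder_mult; now apply analytic_cder.
Qed.

Lemma analytic_const (c : C) : analytic (fun _ => c).
Proof. apply cder_analytic with (fun _ => 0%C). intros z _. apply cder_const. Qed.

Lemma analytic_id : analytic (fun x => x).
Proof. apply cder_analytic with (fun _ => 1%C). intros z _. apply cder_id. Qed.

Lemma analytic_pow (f : C -> C) (n : nat) :
  analytic f -> analytic (fun x => f x ^ n)%C.
Proof.
intros Hf. induction n as [ | n IH].
- exact (analytic_const 1%C).
- now apply (analytic_mult f (fun x => f x ^ n)%C).
Qed.

Lemma analytic_comp (f g : C -> C) :
  analytic f -> analytic g -> (forall z, inD z -> inD (g z)) ->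
  analytic (fun x => f (g x)).
Proof.
intros Hf Hg HD.
apply cder_analytic with (fun z => C_derive f (g z) * C_derive g z)%C.
intros z Hz. apply cder_comp; apply analytic_cder; auto.
Qed.

Lemma analytic_inv (f : C -> C) :
  analytic f -> (forall z, inD z -> f z <> 0%C) -> analytic (fun x => / f x)%C.
Proof.
intros Hf HD.
apply cder_analytic with (fun z => - C_derive f z / (f z * f z))%C.
intros z Hz. apply cder_inv; auto. now apply analytic_cder.
Qed.

(** * Integrals of complex-valued functions of a real variable *)

(** Real and imaginary parts are integrated separately, so that the theorems on real integrals apply
    to each of them. Modulus bounds go through the vector-valued integral in [C_R_NormedModule],
    whose norm is [Cmod]. *)
Definition CInt (f : R -> C) (a b : R) : C :=
  (RInt (fun t => Re (f t)) a b, RInt (fun t => Im (f t)) a b).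

Definition cont_on (f : R -> C) (a b : R) : Prop :=
  forall t, a <= t <= b -> continuous f t.

Lemma ex_RInt_Re (f : R -> C) (a b : R) :
  a <= b -> cont_on f a b -> ex_RInt (fun t => Re (f t)) a b.
Proof.
intros Hab H. apply (ex_RInt_continuous (V := R_CompleteNormedModule)).
intros t Ht. rewrite Rmin_left, Rmax_right in Ht by lra. apply cont_Re. now apply H.
Qed.

Lemma ex_RInt_Im (f : R -> C) (a b : R) :
  a <= b -> cont_on f a b -> ex_RInt (fun t => Im (f t)) a b.
Proof.
intros Hab H. apply (ex_RInt_continuous (V := R_CompleteNormedModule)).
intros t Ht. rewrite Rmin_left, Rmax_right in Ht by lra. apply cont_Im. now apply H.
Qed.

Lemma is_RInt_CInt (f : R -> C) (a b : R) :
  a <= b -> cont_on f a b -> is_RInt (V := C_R_NormedModule) f a b (CInt f a b).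
Proof.
intros Hab H.
apply (is_RInt_fct_extend_pair (U := R_NormedModule) (V := R_NormedModule)).
- exact (RInt_correct (V := R_CompleteNormedModule) _ _ _ (ex_RInt_Re f a b Hab H)).
- exact (RInt_correct (V := R_CompleteNormedModule) _ _ _ (ex_RInt_Im f a b Hab H)).
Qed.

Lemma CInt_bound (f : R -> C) (a b M : R) :
  a <= b -> cont_on f a b -> (forall t, a <= t <= b -> Cmod (f t) <= M) ->
  Cmod (CInt f a b) <= (b - a) * M.
Proof.
intros Hab H HM. rewrite Cmod_norm.
apply (norm_RInt_le_const (V := C_R_NormedModule) f a b); auto.
- intros t Ht. specialize (HM t Ht). rewrite Cmod_norm in HM. exact HM.
- now apply is_RInt_CInt.
Qed.

Lemma CInt_ext (f g : R -> C) (a b : R) :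
  a <= b -> (forall t, a <= t <= b -> f t = g t) -> CInt f a b = CInt g a b.
Proof.
intros Hab H. unfold CInt. f_equal; apply RInt_ext; intros t Ht;
  rewrite Rmin_left, Rmax_right in Ht by lra; rewrite H by lra; reflexivity.
Qed.

Lemma CInt_plus (f g : R -> C) (a b : R) :
  a <= b -> cont_on f a b -> cont_on g a b ->
  CInt (fun t => f t + g t)%C a b = (CInt f a b + CInt g a b)%C.
Proof.
intros Hab Hf Hg. unfold CInt, Cplus; simpl. f_equal.
- apply (RInt_plus (V := R_CompleteNormedModule) (fun t => Re (f t)) (fun t => Re (g t)));
    now apply ex_RInt_Re.
- apply (RInt_plus (V := R_CompleteNormedModule) (fun t => Im (f t)) (fun t => Im (g t)));
    now apply ex_RInt_Im.
Qed.

Lemma CInt_mult (c : C) (f : R -> C) (a b : R) :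
  a <= b -> cont_on f a b ->
  CInt (fun t => c * f t)%C a b = (c * CInt f a b)%C.
Proof.
intros Hab Hf.
assert (K : forall (p q : R) (g h : R -> R), ex_RInt g a b -> ex_RInt h a b ->
  RInt (fun t => p * g t + q * h t) a b = p * RInt g a b + q * RInt h a b).
{ intros p q g h Hg Hh.
  assert (Hg' := ex_RInt_scal (V := R_NormedModule) g a b p Hg).
  assert (Hh' := ex_RInt_scal (V := R_NormedModule) h a b q Hh).
  assert (H1 := RInt_scal (V := R_CompleteNormedModule) g a b p Hg).
  assert (H2 := RInt_scal (V := R_CompleteNormedModule) h a b q Hh).
  assert (H3 := RInt_plus (V := R_CompleteNormedModule) _ _ a b Hg' Hh').
  exact (eq_trans H3 (f_equal2 Rplus H1 H2)). }
assert (E1 := ex_RInt_Re f a b Hab Hf). assert (E2 := ex_RInt_Im f a b Hab Hf).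
unfold CInt. apply injective_projections; simpl.
- rewrite (RInt_ext _ (fun t => Re c * Re (f t) + (- Im c) * Im (f t)))
    by (intros t _; change (@eq R (Re c * Re (f t) - Im c * Im (f t))
      (Re c * Re (f t) + - Im c * Im (f t))); ring).
  rewrite K by assumption. unfold Re, Im. ring.
- rewrite (RInt_ext _ (fun t => Re c * Im (f t) + Im c * Re (f t)))
    by (intros t _; reflexivity).
  rewrite K by assumption. reflexivity.
Qed.

Lemma CInt_minus (f g : R -> C) (a b : R) :
  a <= b -> cont_on f a b -> cont_on g a b ->
  CInt (fun t => f t - g t)%C a b = (CInt f a b - CInt g a b)%C.
Proof.
intros Hab Hf Hg.
rewrite (CInt_ext _ (fun t => f t + (-1) * g t)%C) by (auto; intros; ring).
rewrite CInt_plus, CInt_mult; auto.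
- ring.
- intros t Ht. apply cont_Cmult. apply continuous_const. now apply Hg.
Qed.

Lemma CInt_const (c : C) (a b : R) : CInt (fun _ => c) a b = (RtoC (b - a) * c)%C.
Proof.
unfold CInt. rewrite !(RInt_const (V := R_CompleteNormedModule)).
unfold scal, Cmult, RtoC; simpl. unfold mult; simpl. apply injective_projections; simpl.
- change (fst c) with (Re c). ring.
- change (snd c) with (Im c). ring.
Qed.

(** The slope form of the derivative for curves, parallel to [cder]; the chain rule between the two
    is again an algebraic identity. *)
Definition rder (c : R -> C) (t : R) (l : C) : Prop :=
  exists phi : R -> C, continuous phi t /\ phi t = l /\
    locally t (fun s => c s = c t + RtoC (s - t) * phi s)%C.

Lemma is_derive_slope (f phi : R -> R) (t : R) :
  continuous phi t -> locally t (fun s => f s = f t + (s - t) * phi s) ->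
  is_derive f t (phi t).
Proof.
intros Hc H. split. apply is_linear_scal_l.
intros x Hx.
assert (E : t = x)
  by exact (is_filter_lim_locally_unique (V := R_NormedModule) _ _ Hx).
clear Hx. subst x.
intros e.
assert (Hc' := proj1 (filterlim_locally _ _) Hc e).
generalize (filter_and _ _ H Hc'). apply filter_imp.
intros s [E Hs].
change (Rabs (f s - f t - (s - t) * phi t) <= e * Rabs (s - t)).
rewrite E.
replace (f t + (s - t) * phi s - f t - (s - t) * phi t)
  with ((phi s - phi t) * (s - t)) by ring.
rewrite Rabs_mult. apply Rmult_le_compat_r. apply Rabs_pos.
apply Rlt_le. exact Hs.
Qed.

Lemma rder_Re (c : R -> C) (t : R) (l : C) :
  rder c t l -> is_derive (fun s => Re (c s)) t (Re l).
Proof.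
intros [phi [Hc [<- H]]].
apply (is_derive_slope (fun s => Re (c s)) (fun s => Re (phi s))).
now apply cont_Re.
revert H. apply filter_imp. intros s E. rewrite E at 1. simpl. unfold Re, Im. ring.
Qed.

Lemma rder_Im (c : R -> C) (t : R) (l : C) :
  rder c t l -> is_derive (fun s => Im (c s)) t (Im l).
Proof.
intros [phi [Hc [<- H]]].
apply (is_derive_slope (fun s => Im (c s)) (fun s => Im (phi s))).
now apply cont_Im.
revert H. apply filter_imp. intros s E. rewrite E at 1. simpl. unfold Re, Im. ring.
Qed.

Lemma rder_cont (c : R -> C) (t : R) (l : C) : rder c t l -> continuous c t.
Proof.
intros [phi [Hc [_ H]]].
apply continuous_ext_loc with (fun s => c t + RtoC (s - t) * phi s)%C.
- revert H. apply filter_imp. intros s E. now symmetry.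
- apply cont_Cplus. apply continuous_const.
  apply cont_Cmult; [ | exact Hc].
  apply cont_RtoC. apply cont_Rplus. apply continuous_id. apply continuous_const.
Qed.

Lemma rder_comp (f : C -> C) (c : R -> C) (t : R) (l m : C) :
  cder f (c t) l -> rder c t m -> rder (fun s => f (c s)) t (l * m)%C.
Proof.
intros Hf Hc. assert (Cc := rder_cont _ _ _ Hc).
destruct Hf as [p [Hp [<- Ep]]]. destruct Hc as [q [Hq [<- Eq]]].
exists (fun s => p (c s) * q s)%C. repeat split.
- apply cont_Cmult; [ | exact Hq]. now apply (continuous_comp c p).
- assert (Ep' : locally t (fun s => f (c s) = f (c t) + (c s - c t) * p (c s))%C)
    by exact (Cc _ Ep).
  generalize (filter_and _ _ Ep' Eq). apply filter_imp.
  intros s [E1 E2]. rewrite E1. rewrite E2 at 1. ring.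
Qed.

Lemma rder_const (c : C) (t : R) : rder (fun _ => c) t 0%C.
Proof.
exists (fun _ => 0%C). repeat split. apply continuous_const.
apply filter_forall. intros s. ring.
Qed.

Lemma rder_plus (f g : R -> C) (t : R) (l m : C) :
  rder f t l -> rder g t m -> rder (fun s => f s + g s)%C t (l + m)%C.
Proof.
intros [p [Hp [<- Ep]]] [q [Hq [<- Eq]]].
exists (fun s => p s + q s)%C. repeat split. now apply cont_Cplus.
generalize (filter_and _ _ Ep Eq). apply filter_imp.
intros s [-> ->]. ring.
Qed.

Lemma rder_mult (f g : R -> C) (t : R) (l m : C) :
  rder f t l -> rder g t m ->
  rder (fun s => f s * g s)%C t (l * g t + f t * m)%C.
Proof.
intros Hf Hg. assert (Cg := rder_cont _ _ _ Hg).
destruct Hf as [p [Hp [<- Ep]]]. destruct Hg as [q [Hq [<- Eq]]].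
exists (fun s => p s * g s + f t * q s)%C. repeat split.
- apply cont_Cplus; apply cont_Cmult; auto. apply continuous_const.
- generalize (filter_and _ _ Ep Eq). apply filter_imp.
  intros s [-> ->]. ring.
Qed.

Lemma rder_affine (a b : C) (t : R) : rder (fun s => a + RtoC s * b)%C t b.
Proof.
exists (fun _ => b). repeat split. apply continuous_const.
apply filter_forall. intros s. rewrite RtoC_minus. ring.
Qed.

Lemma CInt_FTC (F f : R -> C) (a b : R) :
  a <= b -> (forall t, a <= t <= b -> rder F t (f t)) -> cont_on f a b ->
  CInt f a b = (F b - F a)%C.
Proof.
intros Hab HF Hf.
unfold CInt, Cminus, Cplus, Copp; simpl. f_equal;
  apply is_RInt_unique.
- apply (is_RInt_derive (V := R_CompleteNormedModule) (fun t => Re (F t)));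
  intros t Ht; rewrite Rmin_left, Rmax_right in Ht by lra.
  + now apply rder_Re, HF.
  + now apply cont_Re, Hf.
- apply (is_RInt_derive (V := R_CompleteNormedModule) (fun t => Im (F t)));
  intros t Ht; rewrite Rmin_left, Rmax_right in Ht by lra.
  + now apply rder_Im, HF.
  + now apply cont_Im, Hf.
Qed.

Lemma CInt_reverse (g : R -> C) :
  cont_on g 0 1 -> CInt (fun t => g (1 - t)) 0 1 = CInt g 0 1.
Proof.
assert (K : forall h : R -> R, ex_RInt h 0 1 -> RInt (fun t => h (1 - t)) 0 1 = RInt h 0 1).
{ intros h Hh.
  assert (H := RInt_comp_lin (V := R_CompleteNormedModule) h (-1) 1 0 1).
  replace (-1 * 0 + 1) with 1 in H by ring. replace (-1 * 1 + 1) with 0 in H by ring.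
  specialize (H (ex_RInt_swap _ _ _ Hh)).
  rewrite <- (opp_RInt_swap (V := R_CompleteNormedModule) h 0 1 Hh) in H.
  assert (H2 : ex_RInt (fun t => h (1 - t)) 0 1).
  { apply ex_RInt_ext with (fun y => opp (scal (-1) (h (-1 * y + 1)))).
    - intros t _. unfold opp, scal; simpl. unfold mult; simpl.
      replace (-1 * t + 1) with (1 - t) by ring. ring.
    - apply (ex_RInt_opp (V := R_NormedModule)).
      apply (ex_RInt_comp_lin (V := R_NormedModule) h (-1) 1 0 1).
      replace (-1 * 0 + 1) with 1 by ring. replace (-1 * 1 + 1) with 0 by ring.
      now apply ex_RInt_swap. }
  assert (S := RInt_scal (V := R_CompleteNormedModule) _ 0 1 (-1) H2).
  assert (X := RInt_ext (V := R_CompleteNormedModule)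
    (fun y => scal (-1) (h (1 - y))) (fun y => scal (-1) (h (-1 * y + 1))) 0 1).
  assert (T := eq_trans (eq_sym S) (eq_trans (X ltac:(intros t _; cbv beta; replace (-1 * t + 1) with (1 - t) by ring; reflexivity)) H)).
  change (-1 * RInt (fun t => h (1 - t)) 0 1 = - RInt h 0 1) in T. lra. }
intros Hg. unfold CInt. f_equal.
- apply (K (fun t => Re (g t))). apply ex_RInt_Re; [lra | exact Hg].
- apply (K (fun t => Im (g t))). apply ex_RInt_Im; [lra | exact Hg].
Qed.

Lemma CInt_halves (g : R -> C) :
  cont_on g 0 1 ->
  CInt g 0 1 = (/ 2 * (CInt (fun t => g (t / 2)%R) 0 1
                       + CInt (fun t => g ((t + 1) / 2)%R) 0 1))%C.
Proof.
assert (K : forall h : R -> R, ex_RInt h 0 1 ->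
  RInt h 0 1 = / 2 * (RInt (fun t => h (t / 2)) 0 1 + RInt (fun t => h ((t + 1) / 2)) 0 1)).
{ intros h Hh.
  assert (X1 : ex_RInt h 0 (1 / 2))
    by (apply (ex_RInt_Chasles_1 (V := R_CompleteNormedModule)) with 1; [lra | exact Hh]).
  assert (X2 : ex_RInt h (1 / 2) 1)
    by (apply (ex_RInt_Chasles_2 (V := R_CompleteNormedModule)) with 0; [lra | exact Hh]).
  assert (H := RInt_Chasles (V := R_CompleteNormedModule) h 0 (1 / 2) 1 X1 X2).
  rewrite <- H. unfold plus; simpl.
  assert (A : RInt h 0 (1 / 2) = / 2 * RInt (fun t => h (t / 2)) 0 1).
  { assert (L := RInt_comp_lin (V := R_CompleteNormedModule) h (/ 2) 0 0 1).
    assert (L' := ex_RInt_comp_lin (V := R_NormedModule) h (/ 2) 0 0 1).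
    replace (/ 2 * 0 + 0) with 0 in L, L' by ring.
    replace (/ 2 * 1 + 0) with (1 / 2) in L, L' by field.
    rewrite <- (L X1).
    refine (eq_trans _ (RInt_scal (V := R_CompleteNormedModule) (fun t => h (t / 2)) 0 1 (/ 2) _)).
    - apply RInt_ext. intros t _. replace (/ 2 * t + 0) with (t / 2) by field. reflexivity.
    - apply ex_RInt_ext with (fun y => scal 2 (scal (/ 2) (h (/ 2 * y + 0)))).
      + intros t _. unfold scal; simpl. unfold mult; simpl.
        replace (/ 2 * t + 0) with (t / 2) by field. field.
      + apply (ex_RInt_scal (V := R_NormedModule)). exact (L' X1). }
  assert (B : RInt h (1 / 2) 1 = / 2 * RInt (fun t => h ((t + 1) / 2)) 0 1).
  { assert (L := RInt_comp_lin (V := R_CompleteNormedModule) h (/ 2) (/ 2) 0 1).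
    assert (L' := ex_RInt_comp_lin (V := R_NormedModule) h (/ 2) (/ 2) 0 1).
    replace (/ 2 * 0 + / 2) with (1 / 2) in L, L' by field.
    replace (/ 2 * 1 + / 2) with 1 in L, L' by field.
    rewrite <- (L X2).
    refine (eq_trans _ (RInt_scal (V := R_CompleteNormedModule) (fun t => h ((t + 1) / 2)) 0 1 (/ 2) _)).
    - apply RInt_ext. intros t _. replace (/ 2 * t + / 2) with ((t + 1) / 2) by field. reflexivity.
    - apply ex_RInt_ext with (fun y => scal 2 (scal (/ 2) (h (/ 2 * y + / 2)))).
      + intros t _. unfold scal; simpl. unfold mult; simpl.
        replace (/ 2 * t + / 2) with ((t + 1) / 2) by field. field.
      + apply (ex_RInt_scal (V := R_NormedModule)). exact (L' X2). }
  rewrite A, B. ring. }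
intros Hg. unfold CInt.
rewrite (K (fun t => Re (g t))) by (apply ex_RInt_Re; [lra | exact Hg]).
rewrite (K (fun t => Im (g t))) by (apply ex_RInt_Im; [lra | exact Hg]).
assert (E : (/ 2)%C = RtoC (/ 2)) by (symmetry; apply RtoC_inv; lra).
rewrite E. unfold Cplus, Cmult, RtoC; simpl. f_equal; ring.
Qed.

(** * Goursat's theorem on triangles and primitives *)

(** The line integral of f over [a, b]. The factor b - a stands outside, so that the remaining
    [CInt] is the mean of f over the segment and can serve as a slope in [cder_of_seg]. *)
Definition seg (f : C -> C) (a b : C) : C :=
  ((b - a) * CInt (fun t => f (a + RtoC t * (b - a))) 0 1)%C.

Definition seg_cont (f : C -> C) (a b : C) : Prop :=
  forall t, 0 <= t <= 1 -> continuous f (a + RtoC t * (b - a))%C.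

Lemma seg_cont_on (f : C -> C) (a b : C) :
  seg_cont f a b -> cont_on (fun t => f (a + RtoC t * (b - a)))%C 0 1.
Proof.
intros H t Ht. apply (continuous_comp (fun t => a + RtoC t * (b - a))%C f).
- exact (rder_cont _ _ _ (rder_affine a (b - a)%C t)).
- now apply H.
Qed.

Lemma Cmod_convex (a b : C) (t M : R) :
  0 <= t <= 1 -> Cmod a <= M -> Cmod b <= M ->
  Cmod (a + RtoC t * (b - a)) <= M.
Proof.
intros Ht Ha Hb.
replace (a + RtoC t * (b - a))%C with (RtoC (1 - t) * a + RtoC t * b)%C
  by (rewrite RtoC_minus; ring).
apply Rle_trans with (1 := Cmod_triangle _ _).
rewrite !Cmod_mult, !Cmod_R, !Rabs_pos_eq by lra. nra.
Qed.

Lemma inD_convex (a b : C) (t : R) :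
  0 <= t <= 1 -> inD a -> inD b -> inD (a + RtoC t * (b - a))%C.
Proof.
unfold inD. intros Ht Ha Hb.
apply Rle_lt_trans with (Rmax (Cmod a) (Cmod b)).
- apply Cmod_convex. exact Ht. apply Rmax_l. apply Rmax_r.
- now apply Rmax_lub_lt.
Qed.

Lemma analytic_seg_cont (f : C -> C) (a b : C) :
  analytic f -> inD a -> inD b -> seg_cont f a b.
Proof. intros Hf Ha Hb t Ht. apply analytic_cont; auto. now apply inD_convex. Qed.

Lemma seg_bound (f : C -> C) (a b : C) (M : R) :
  seg_cont f a b ->
  (forall t, 0 <= t <= 1 -> Cmod (f (a + RtoC t * (b - a))%C) <= M) ->
  Cmod (seg f a b) <= Cmod (b - a) * M.
Proof.
intros Hc HM. unfold seg. rewrite Cmod_mult.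
apply Rmult_le_compat_l. apply Cmod_ge_0.
replace M with ((1 - 0) * M) by ring.
apply CInt_bound; [lra | now apply seg_cont_on | exact HM].
Qed.

Lemma seg_FTC (F f : C -> C) (a b : C) :
  (forall t, 0 <= t <= 1 ->
    cder F (a + RtoC t * (b - a))%C (f (a + RtoC t * (b - a))%C)) ->
  seg_cont f a b -> seg f a b = (F b - F a)%C.
Proof.
intros HF Hf. unfold seg.
rewrite <- CInt_mult by (lra || now apply seg_cont_on).
rewrite (CInt_FTC (fun t => F (a + RtoC t * (b - a))%C)); try lra.
- f_equal; [ | f_equal]; f_equal; ring.
- intros t Ht.
  replace ((b - a) * f (a + RtoC t * (b - a)))%C
    with (f (a + RtoC t * (b - a)) * (b - a))%C by ring.
  apply (rder_comp F (fun t => a + RtoC t * (b - a))%C). now apply HF.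
  apply rder_affine.
- intros t Ht. apply cont_Cmult. apply continuous_const.
  now apply (seg_cont_on f a b Hf).
Qed.

Lemma seg_swap (f : C -> C) (a b : C) :
  seg_cont f a b -> seg f b a = (- seg f a b)%C.
Proof.
intros Hf. unfold seg.
rewrite <- (CInt_reverse (fun t => f (a + RtoC t * (b - a))%C)) by now apply seg_cont_on.
rewrite (CInt_ext (fun t => f (a + RtoC (1 - t) * (b - a))%C)
  (fun t => f (b + RtoC t * (a - b))%C)).
- ring.
- lra.
- intros t _. f_equal. rewrite RtoC_minus. ring.
Qed.

Lemma seg_midpoint (f : C -> C) (a b : C) :
  seg_cont f a b ->
  seg f a b = (seg f a ((a + b) / 2) + seg f ((a + b) / 2) b)%C.
Proof.
intros Hf. unfold seg.
rewrite (CInt_halves (fun t => f (a + RtoC t * (b - a))%C)) by now apply seg_cont_on.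
rewrite (CInt_ext (fun t => f (a + RtoC (t / 2) * (b - a))%C)
  (fun t => f (a + RtoC t * ((a + b) / 2 - a))%C)); [ | lra | ].
2: { intros t _. f_equal. rewrite RtoC_div by lra. field. }
rewrite (CInt_ext (fun t => f (a + RtoC ((t + 1) / 2) * (b - a))%C)
  (fun t => f ((a + b) / 2 + RtoC t * (b - (a + b) / 2))%C)); [ | lra | ].
2: { intros t _. f_equal. rewrite RtoC_div, RtoC_plus by lra. field. }
field.
Qed.

Lemma seg_minus (f g : C -> C) (a b : C) :
  seg_cont f a b -> seg_cont g a b ->
  seg (fun z => f z - g z)%C a b = (seg f a b - seg g a b)%C.
Proof.
intros Hf Hg. unfold seg.
rewrite (CInt_minus (fun t => f (a + RtoC t * (b - a))%C)
  (fun t => g (a + RtoC t * (b - a))%C)).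
- ring.
- lra.
- now apply seg_cont_on.
- now apply seg_cont_on.
Qed.

Definition tri (f : C -> C) (a b c : C) : C := (seg f a b + seg f b c + seg f c a)%C.

Definition mid (a b : C) : C := ((a + b) / 2)%C.

Lemma two_neq_0 : RtoC 2 <> 0%C.
Proof. intros E. apply RtoC_inj in E. lra. Qed.

Lemma Cmod_half (z : C) : Cmod (z / 2) = Cmod z / 2.
Proof.
rewrite Cmod_div by apply two_neq_0. rewrite Cmod_R. rewrite Rabs_pos_eq. reflexivity. lra.
Qed.

Lemma mid_as_affine (a b : C) : mid a b = (a + RtoC (1 / 2) * (b - a))%C.
Proof.
unfold mid. rewrite RtoC_div by lra. field.
Qed.

(** The sides of the medial triangle are traversed twice in opposite directions and cancel; the
    remaining half sides add up to the three sides. *)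
Lemma tri_subdivide (f : C -> C) (a b c : C) :
  analytic f -> inD a -> inD b -> inD c ->
  tri f a b c =
  (tri f a (mid a b) (mid c a) + tri f (mid a b) b (mid b c) +
   tri f (mid c a) (mid b c) c + tri f (mid a b) (mid b c) (mid c a))%C.
Proof.
intros Hf Ha Hb Hc.
assert (Hm : forall x y, inD x -> inD y -> inD (mid x y)).
{ intros x y Hx Hy. rewrite mid_as_affine. apply inD_convex; auto; lra. }
assert (Hs : forall x y, inD x -> inD y -> seg_cont f x y)
  by (intros; now apply analytic_seg_cont).
unfold tri.
rewrite (seg_midpoint f a b), (seg_midpoint f b c), (seg_midpoint f c a) by auto.
fold (mid a b) (mid b c) (mid c a).
rewrite (seg_swap f (mid a b) (mid c a)), (seg_swap f (mid b c) (mid a b)),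
  (seg_swap f (mid c a) (mid b c)) by auto.
ring.
Qed.

Definition C3 : Type := (C * C * C)%type.

Definition triI (f : C -> C) (T : C3) : C := tri f (fst (fst T)) (snd (fst T)) (snd T).

Definition in_disk (M : R) (T : C3) : Prop :=
  Cmod (fst (fst T)) <= M /\ Cmod (snd (fst T)) <= M /\ Cmod (snd T) <= M.

Definition sides_le (d : R) (T : C3) : Prop :=
  Cmod (snd (fst T) - fst (fst T)) <= d /\ Cmod (snd T - snd (fst T)) <= d /\
  Cmod (fst (fst T) - snd T) <= d.

(** One of the four parts carries at least a quarter of the integral. The size d is quantified after
    T', so that T' is chosen from T alone; the bound on the displacement of the first vertex makes
    these vertices converge under iteration. *)
Lemma goursat_step (f : C -> C) (M : R) (T : C3) :
  analytic f -> M < 1 -> in_disk M T ->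
  exists T' : C3, in_disk M T' /\
    Cmod (triI f T) <= 4 * Cmod (triI f T') /\
    forall d, sides_le d T ->
      sides_le (d / 2) T' /\ Cmod (fst (fst T') - fst (fst T)) <= d / 2.
Proof.
intros Hf HM. destruct T as [[a b] c]. intros [Ha [Hb Hc]]. simpl in Ha, Hb, Hc.
assert (Hm : forall x y, Cmod x <= M -> Cmod y <= M -> Cmod (mid x y) <= M).
{ intros x y Hx Hy. rewrite mid_as_affine. apply Cmod_convex; auto; lra. }
assert (E := tri_subdivide f a b c Hf (Rle_lt_trans _ _ _ Ha HM)
  (Rle_lt_trans _ _ _ Hb HM) (Rle_lt_trans _ _ _ Hc HM)).
(* Every side of a part is plus or minus half of a side u of the old triangle. *)
assert (B : forall (x y u : C) (d : R), Cmod u <= d ->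
   (x - y = u / 2 \/ x - y = - u / 2)%C -> Cmod (x - y) <= d / 2).
{ intros x y u d Hu [-> | ->]; rewrite Cmod_half, ?Cmod_opp; lra. }
assert (Z : forall x y (d : R), 0 <= d -> x = y -> Cmod (x - y) <= d / 2).
{ intros x y d Hd ->. replace (y - y)%C with (0 : C)%C by ring. rewrite Cmod_0. lra. }
set (I1 := tri f a (mid a b) (mid c a)) in E.
set (I2 := tri f (mid a b) b (mid b c)) in E.
set (I3 := tri f (mid c a) (mid b c) c) in E.
set (I4 := tri f (mid a b) (mid b c) (mid c a)) in E.
assert (Tr : Cmod (tri f a b c) <= Cmod I1 + Cmod I2 + Cmod I3 + Cmod I4).
{ rewrite E.
  assert (A1 := Cmod_triangle (I1 + I2 + I3) I4).
  assert (A2 := Cmod_triangle (I1 + I2) I3).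
  assert (A3 := Cmod_triangle I1 I2). lra. }
set (q := Cmod (tri f a b c)) in Tr.
assert (S : q <= 4 * Cmod I1 \/ q <= 4 * Cmod I2 \/ q <= 4 * Cmod I3 \/ q <= 4 * Cmod I4).
{ destruct (Rle_dec q (4 * Cmod I1)); [tauto | ].
  destruct (Rle_dec q (4 * Cmod I2)); [tauto | ].
  destruct (Rle_dec q (4 * Cmod I3)); [tauto | ].
  right; right; right. lra. }
destruct S as [S | [S | [S | S]]].
- exists (a, mid a b, mid c a). repeat split; simpl; auto;
  destruct H as [U [V W]]; simpl in U, V, W; assert (D0 := Rle_trans _ _ _ (Cmod_ge_0 _) U).
  + apply (B _ _ _ _ U). left. unfold mid. field.
  + apply (B _ _ _ _ V). left. unfold mid. field.
  + apply (B _ _ _ _ W). left. unfold mid. field.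
  + now apply Z.
- exists (mid a b, b, mid b c). repeat split; simpl; auto;
  destruct H as [U [V W]]; simpl in U, V, W; assert (D0 := Rle_trans _ _ _ (Cmod_ge_0 _) U).
  + apply (B _ _ _ _ U). left. unfold mid. field.
  + apply (B _ _ _ _ V). left. unfold mid. field.
  + apply (B _ _ _ _ W). left. unfold mid. field.
  + apply (B _ _ _ _ U). left. unfold mid. field.
- exists (mid c a, mid b c, c). repeat split; simpl; auto;
  destruct H as [U [V W]]; simpl in U, V, W; assert (D0 := Rle_trans _ _ _ (Cmod_ge_0 _) U).
  + apply (B _ _ _ _ U). left. unfold mid. field.
  + apply (B _ _ _ _ V). left. unfold mid. field.
  + apply (B _ _ _ _ W). left. unfold mid. field.
  + apply (B _ _ _ _ W). right. unfold mid. field.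
- exists (mid a b, mid b c, mid c a). repeat split; simpl; auto;
  destruct H as [U [V W]]; simpl in U, V, W; assert (D0 := Rle_trans _ _ _ (Cmod_ge_0 _) U).
  + apply (B _ _ _ _ W). right. unfold mid. field.
  + apply (B _ _ _ _ U). right. unfold mid. field.
  + apply (B _ _ _ _ V). right. unfold mid. field.
  + apply (B _ _ _ _ U). left. unfold mid. field.
Qed.

(** The tail of the series of increments from n on is d / 2^n, so the intervals of radius d / 2^n
    around u n are nested; l is the supremum of their left ends. *)
Lemma geometric_limit (u : nat -> R) (d : R) :
  (forall n, Rabs (u (S n) - u n) <= d / 2 ^ S n) ->
  exists l, forall n, Rabs (u n - l) <= d / 2 ^ n.
Proof.
intros H.
assert (P2 : forall n, 0 < 2 ^ n) by (intros; apply pow_lt; lra).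
assert (St : forall n, d / 2 ^ n = d / 2 ^ S n + d / 2 ^ S n).
{ intros n. simpl. specialize (P2 n). field. lra. }
assert (Lo : forall n k, u n - d / 2 ^ n <= u (n + k)%nat - d / 2 ^ (n + k)).
{ intros n k. induction k as [ | k IH].
  - rewrite Nat.add_0_r. lra.
  - rewrite <- plus_n_Sm. specialize (H (n + k)%nat). specialize (St (n + k)%nat).
    apply Rabs_le_between in H. lra. }
assert (Up : forall n k, u (n + k)%nat + d / 2 ^ (n + k) <= u n + d / 2 ^ n).
{ intros n k. induction k as [ | k IH].
  - rewrite Nat.add_0_r. lra.
  - rewrite <- plus_n_Sm. specialize (H (n + k)%nat). specialize (St (n + k)%nat).
    apply Rabs_le_between in H. lra. }
assert (D0 : forall n, 0 <= d / 2 ^ n).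
{ intros n. assert (X := Rle_trans _ _ _ (Rabs_pos _) (H 0%nat)). simpl in X.
  apply Rdiv_le_0_compat. lra. apply P2. }
assert (Lu : forall n m, u n - d / 2 ^ n <= u m + d / 2 ^ m).
{ intros n m. destruct (Nat.le_ge_cases n m) as [L | L].
  - specialize (Lo n (m - n)%nat). replace (n + (m - n))%nat with m in Lo by lia.
    specialize (D0 m). lra.
  - specialize (Up m (n - m)%nat). replace (m + (n - m))%nat with n in Up by lia.
    specialize (D0 n). lra. }
destruct (completeness (fun x => exists n, x = u n - d / 2 ^ n)) as [l [Hl1 Hl2]].
- exists (u 0%nat + d / 2 ^ 0). intros x [n ->]. apply Lu.
- exists (u 0%nat - d / 2 ^ 0). now exists 0%nat.
- exists l. intros n. apply Rabs_le_between'. split.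
  + assert (u n - d / 2 ^ n <= l) by (apply Hl1; now exists n).
    assert (l <= u n + d / 2 ^ n) by (apply Hl2; intros x [m ->]; apply Lu). lra.
  + assert (u n - d / 2 ^ n <= l) by (apply Hl1; now exists n). lra.
Qed.

Lemma half_pow_small (x e : R) : 0 < e -> exists n : nat, x / 2 ^ n < e.
Proof.
intros He.
destruct (Rle_dec x 0) as [Hx | Hx].
- exists 0%nat. simpl. lra.
- assert (H2 : Rabs (1 / 2) < 1) by (rewrite Rabs_pos_eq; lra).
  destruct (pow_lt_1_zero (1 / 2) H2 (e / x)) as [N HN].
  { apply Rdiv_lt_0_compat; lra. }
  exists N. specialize (HN N (le_n N)).
  assert (P2 : 0 < 2 ^ N) by (apply pow_lt; lra).
  assert (E : (1 / 2) ^ N = / 2 ^ N)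
    by (unfold Rdiv; rewrite Rmult_1_l, pow_inv; reflexivity).
  rewrite E, Rabs_pos_eq in HN by (apply Rlt_le, Rinv_0_lt_compat; lra).
  unfold Rdiv. apply Rmult_lt_compat_l with (r := x) in HN; [ | lra].
  replace (x * (e / x)) with e in HN by (field; lra). exact HN.
Qed.

(* Near a point of differentiability f is affine up to o(size), affine functions
   integrate to 0, so the integral is o(size^2). *)
Lemma tri_small (f : C -> C) (p : C) (e : R) :
  analytic f -> inD p -> 0 < e ->
  exists d, 0 < d /\ forall (T : C3) (s : R), in_disk 1 T -> 0 <= s ->
    inD (fst (fst T)) -> inD (snd (fst T)) -> inD (snd T) ->
    sides_le s T -> Cmod (fst (fst T) - p) <= 2 * s -> 3 * s < d ->
    Cmod (triI f T) <= 9 * e * (s * s).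
Proof.
intros Hf Hp He.
assert (Hd := analytic_cder f p Hf Hp). set (l := C_derive f p) in Hd.
destruct Hd as [phi [Hphi [El Ephi]]].
assert (Hphi' := proj1 (cont_Cmod_iff phi p) Hphi e He).
destruct (proj1 (locally_Cmod p _) (filter_and _ _ Ephi Hphi')) as [d [Hd H]].
exists d. split; [exact Hd | ].
intros [[a b] c] s _ Hs Ha Hb Hc [S1 [S2 S3]] Sp Hsd. simpl in *.
set (g := fun z => (f p + (z - p) * l)%C).
set (G := fun z => (f p * z + / 2 * l * ((z - p) * (z - p)))%C).
assert (HG : forall z, cder G z (g z)).
{ intros z. unfold G, g.
  replace (f p + (z - p) * l)%C with
    (f p * 1 + / 2 * l * ((1 - 0) * (z - p) + (z - p) * (1 - 0)))%C
    by field.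
  apply cder_plus.
  - apply cder_scal, cder_id.
  - apply cder_scal. apply (cder_mult (fun z => z - p)%C (fun z => z - p)%C);
    apply cder_minus; (apply cder_id || apply cder_const). }
assert (Cg : forall x y, seg_cont g x y).
{ intros x y t _. unfold g. apply cont_Cplus. apply continuous_const.
  apply cont_Cmult; [apply cont_Cminus; [apply continuous_id | ] | ]; apply continuous_const. }
assert (Sg : forall x y, seg g x y = (G y - G x)%C).
{ intros x y. apply seg_FTC; auto. }
(* The first vertex is within 2 s of p and the sides have length at most s, so the whole boundary is
   within 3 s of p. There f differs from the affine g by at most e times 3 s; three sides of length
   at most s give the factor 9. *)
assert (Bd : forall x y, inD x -> inD y -> Cmod (x - p) <= 3 * s -> Cmod (y - p) <= 3 * s ->
  Cmod (y - x) <= s ->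
  Cmod (seg f x y - seg g x y) <= 3 * e * (s * s)).
{ intros x y Dx Dy Hx Hy Hxy.
  assert (Cf : seg_cont f x y) by now apply analytic_seg_cont.
  rewrite <- seg_minus by auto.
  apply Rle_trans with (Cmod (y - x) * (e * (3 * s))).
  - apply seg_bound.
    + intros t Ht. apply cont_Cminus. now apply Cf. now apply (Cg x y).
    + intros t Ht. set (z := (x + RtoC t * (y - x))%C).
      assert (Hz : Cmod (z - p) <= 3 * s).
      { replace (z - p)%C with ((x - p) + RtoC t * ((y - p) - (x - p)))%C
          by (unfold z; ring). now apply Cmod_convex. }
      destruct (H z) as [Ez Hz2]. lra.
      unfold g. rewrite Ez, <- El.
      replace (f p + (z - p) * phi z - (f p + (z - p) * phi p))%C
        with ((phi z - phi p) * (z - p))%C by ring.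
      rewrite Cmod_mult. apply Rmult_le_compat; auto using Cmod_ge_0. lra.
  - assert (0 <= e * (3 * s)) by nra. nra. }
assert (Hb' : Cmod (b - p) <= 3 * s).
{ replace (b - p)%C with ((b - a) + (a - p))%C by ring.
  assert (X := Cmod_triangle (b - a) (a - p)). lra. }
assert (Hc' : Cmod (c - p) <= 3 * s).
{ replace (c - p)%C with ((a - p) + - (a - c))%C by ring.
  assert (X := Cmod_triangle (a - p) (- (a - c))). rewrite Cmod_opp in X. lra. }
unfold triI, tri; simpl.
replace (seg f a b + seg f b c + seg f c a)%C with
  ((seg f a b - seg g a b) + (seg f b c - seg g b c) + (seg f c a - seg g c a))%C
  by (rewrite !Sg; ring).
assert (A1 := Cmod_triangle ((seg f a b - seg g a b) + (seg f b c - seg g b c))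
   (seg f c a - seg g c a)).
assert (A2 := Cmod_triangle (seg f a b - seg g a b) (seg f b c - seg g b c)).
assert (B1 := Bd a b Ha Hb ltac:(lra) Hb' S1).
assert (B2 := Bd b c Hb Hc Hb' Hc' S2).
assert (B3 := Bd c a Hc Ha Hc' ltac:(lra) S3).
lra.
Qed.

Theorem goursat (f : C -> C) (a b c : C) :
  analytic f -> inD a -> inD b -> inD c -> tri f a b c = 0%C.
Proof.
intros Hf Ha Hb Hc. apply Cmod_eq_0.
set (M := Rmax (Cmod a) (Rmax (Cmod b) (Cmod c))).
assert (HM : M < 1) by (repeat apply Rmax_lub_lt; assumption).
assert (HT0 : in_disk M (a, b, c)).
{ repeat split; simpl; unfold M.
  - apply Rmax_l.
  - eapply Rle_trans; [apply Rmax_l | apply Rmax_r].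
  - eapply Rle_trans; [apply Rmax_r | apply Rmax_r]. }
set (d0 := Cmod (b - a) + Cmod (c - b) + Cmod (a - c)).
assert (Hd0 : 0 <= d0).
{ unfold d0. assert (X := Cmod_ge_0 (b - a)). assert (Y := Cmod_ge_0 (c - b)).
  assert (Z := Cmod_ge_0 (a - c)). lra. }
assert (Hs0 : sides_le d0 (a, b, c)).
{ unfold d0. assert (X := Cmod_ge_0 (b - a)). assert (Y := Cmod_ge_0 (c - b)).
  assert (Z := Cmod_ge_0 (a - c)). repeat split; simpl; lra. }
assert (Seq : exists T : nat -> C3, T 0%nat = (a, b, c) /\ forall n,
  in_disk M (T n) /\ Cmod (triI f (T n)) <= 4 * Cmod (triI f (T (S n))) /\
  forall d, sides_le d (T n) ->
    sides_le (d / 2) (T (S n)) /\ Cmod (fst (fst (T (S n))) - fst (fst (T n))) <= d / 2).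
(* Choice is applied on the subset type, so that the selected step can be iterated without losing
   [in_disk]. *)
{ assert (W : forall X : {T : C3 | in_disk M T}, exists Y : {T : C3 | in_disk M T},
    Cmod (triI f (proj1_sig X)) <= 4 * Cmod (triI f (proj1_sig Y)) /\
    forall d, sides_le d (proj1_sig X) -> sides_le (d / 2) (proj1_sig Y) /\
      Cmod (fst (fst (proj1_sig Y)) - fst (fst (proj1_sig X))) <= d / 2).
  { intros [T HT]. destruct (goursat_step f M T Hf HM HT) as [T' [HT' H']].
    exists (exist _ T' HT'). exact H'. }
  apply functional_choice in W. destruct W as [F HF].
  exists (fun n => proj1_sig (Nat.iter n F (exist _ (a, b, c) HT0))). split. reflexivity.
  intros n. split. apply proj2_sig. apply HF. }
destruct Seq as [T [T0 HT]].
assert (P2 : forall n, 0 < 2 ^ n) by (intros; apply pow_lt; lra).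
assert (Hsd : forall n, sides_le (d0 / 2 ^ n) (T n)).
{ induction n as [ | n IH].
  - rewrite T0. simpl. replace (d0 / 1) with d0 by field. exact Hs0.
  - destruct (HT n) as [_ [_ H]]. apply H in IH. destruct IH as [IH _].
    replace (d0 / 2 ^ S n) with (d0 / 2 ^ n / 2). exact IH.
    simpl. specialize (P2 n). field. lra. }
assert (Hstep : forall n, Cmod (fst (fst (T (S n))) - fst (fst (T n))) <= d0 / 2 ^ S n).
{ intros n. destruct (HT n) as [_ [_ H]]. destruct (H _ (Hsd n)) as [_ H2].
  replace (d0 / 2 ^ S n) with (d0 / 2 ^ n / 2). exact H2.
  simpl. specialize (P2 n). field. lra. }
destruct (geometric_limit (fun n => Re (fst (fst (T n)))) d0) as [x Hx].
{ intros n. apply Rle_trans with (2 := Hstep n).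
  exact (re_le_Cmod (fst (fst (T (S n))) - fst (fst (T n)))). }
destruct (geometric_limit (fun n => Im (fst (fst (T n)))) d0) as [y Hy].
{ intros n. apply Rle_trans with (2 := Hstep n).
  exact (im_le_Cmod (fst (fst (T (S n))) - fst (fst (T n)))). }
set (p := (x, y) : C).
(* The factor 2 comes from adding the errors of the two coordinates; it is the 2 in the hypothesis
   of [tri_small]. *)
assert (Hp : forall n, Cmod (fst (fst (T n)) - p) <= 2 * (d0 / 2 ^ n)).
{ intros n. apply Rle_trans with (1 := Cmod_le_Re_Im _).
  specialize (Hx n). specialize (Hy n). unfold p.
  change (Rabs (Re (fst (fst (T n))) - x) + Rabs (Im (fst (fst (T n))) - y)
    <= 2 * (d0 / 2 ^ n)). lra. }
assert (Dp : inD p).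
{ unfold inD. destruct (Rlt_dec (Cmod p) 1) as [L | L]; [exact L | exfalso].
  destruct (half_pow_small (2 * d0) (1 - M)) as [n Hn]. lra.
  destruct (HT n) as [[A _] _]. specialize (Hp n).
  assert (X := Cmod_le_add p (fst (fst (T n)))). rewrite Cmod_sub_sym in X.
  unfold Rdiv in *. lra. }
assert (HI : forall n, Cmod (triI f (a, b, c)) <= 2 ^ n * 2 ^ n * Cmod (triI f (T n))).
{ induction n as [ | n IH].
  - rewrite T0. simpl. lra.
  - destruct (HT n) as [_ [H _]].
    apply Rle_trans with (1 := IH). simpl.
    replace (2 * 2 ^ n * (2 * 2 ^ n) * Cmod (triI f (T (S n))))
      with (2 ^ n * 2 ^ n * (4 * Cmod (triI f (T (S n))))) by ring.
    apply Rmult_le_compat_l; [specialize (P2 n); nra | exact H]. }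
change (tri f a b c) with (triI f (a, b, c)).
apply Rle_antisym; [ | apply Cmod_ge_0].
apply le_epsilon. intros e He. rewrite Rplus_0_l.
(* The growth 4^n cancels against the squared size (d0 / 2^n)^2, which leaves 9 e' d0^2 <= e. The
   summand 1 covers d0 = 0. *)
set (e' := e / (9 * (d0 * d0 + 1))).
assert (He' : 0 < e') by (apply Rdiv_lt_0_compat; nra).
destruct (tri_small f p e' Hf Dp He') as [d [Hd H]].
destruct (half_pow_small (3 * d0) d Hd) as [n Hn].
assert (D : forall z, Cmod z <= M -> inD z) by (unfold inD; intros; lra).
destruct (HT n) as [[A1 [A2 A3]] _].
assert (K := H (T n) (d0 / 2 ^ n)).
assert (K' : Cmod (triI f (T n)) <= 9 * e' * (d0 / 2 ^ n * (d0 / 2 ^ n))).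
{ apply K; auto.
  - repeat split; lra.
  - apply Rdiv_le_0_compat; auto.
  - unfold Rdiv in *. lra. }
apply Rle_trans with (1 := HI n).
apply Rle_trans with (2 ^ n * 2 ^ n * (9 * e' * (d0 / 2 ^ n * (d0 / 2 ^ n)))).
- apply Rmult_le_compat_l; [specialize (P2 n); nra | exact K'].
- replace (2 ^ n * 2 ^ n * (9 * e' * (d0 / 2 ^ n * (d0 / 2 ^ n))))
    with (9 * e' * (d0 * d0)) by (specialize (P2 n); field; lra).
  replace e with (9 * e' * (d0 * d0 + 1)) by (unfold e'; field; nra).
  nra.
Qed.

(** The mean of f over [z, x] is the slope of F between z and x, and it tends to f z by
    continuity. *)
Lemma cder_of_seg (F f : C -> C) (z : C) :
  locally z (fun x => continuous f x) ->
  locally z (fun x => F x = F z + seg f z x)%C -> cder F z (f z).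
Proof.
intros Hf HF.
assert (E : CInt (fun t => f (z + RtoC t * (z - z))%C) 0 1 = f z).
{ rewrite (CInt_ext _ (fun _ => f z)); [ | lra | ].
  - rewrite CInt_const, Rminus_0_r. ring.
  - intros t _. f_equal. ring. }
exists (fun x => CInt (fun t => f (z + RtoC t * (x - z))%C) 0 1).
split; [ | split; [exact E | exact HF]].
apply cont_Cmod_iff. intros e He. rewrite E.
assert (Hc := proj1 (cont_Cmod_iff f z) (locally_singleton _ _ Hf) (e / 2) ltac:(lra)).
destruct (proj1 (locally_Cmod z _) (filter_and _ _ Hc Hf)) as [d [Hd H]].
apply locally_Cmod. exists d. split; [exact Hd | ]. intros x Hx.
assert (Hseg : forall t, 0 <= t <= 1 -> Cmod (z + RtoC t * (x - z) - z) < d).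
{ intros t Ht. replace (z + RtoC t * (x - z) - z)%C with (RtoC t * (x - z))%C by ring.
  rewrite Cmod_mult, Cmod_R, Rabs_pos_eq by lra.
  assert (Y := Cmod_ge_0 (x - z)). nra. }
assert (Cs : cont_on (fun t => f (z + RtoC t * (x - z))%C) 0 1).
{ apply seg_cont_on. intros t Ht. apply H. now apply Hseg. }
replace (f z) with (CInt (fun _ : R => f z) 0 1)
  by (rewrite CInt_const, Rminus_0_r; ring).
rewrite <- CInt_minus; [ | lra | exact Cs | intros t _; apply continuous_const].
apply Rle_lt_trans with ((1 - 0) * (e / 2)); [ | lra].
apply CInt_bound; [lra | | ].
- intros t Ht. apply cont_Cminus. now apply Cs. apply continuous_const.
- intros t Ht. apply Rlt_le. apply H. now apply Hseg.
Qed.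

Theorem analytic_primitive (f : C -> C) :
  analytic f -> exists F : C -> C, forall z, inD z -> cder F z (f z).
Proof.
intros Hf. exists (seg f 0). intros z Hz.
assert (H0 : inD 0) by (unfold inD; rewrite Cmod_0; lra).
apply cder_of_seg; generalize (inD_locally z Hz); apply filter_imp; intros x Hx.
- now apply analytic_cont.
(* The integral around the triangle 0, z, x vanishes, so the integrals from 0 to x and from 0 to z
   differ by the one from z to x. *)
- assert (G := goursat f 0 z x Hf H0 Hz Hx). unfold tri in G.
  rewrite (seg_swap f 0 x) in G by now apply analytic_seg_cont.
  rewrite <- (Cplus_0_r (seg f 0 x)).
  rewrite <- G at 2. ring.
Qed.

(** * Cauchy's integral formula on circles centred at 0 *)

Lemma derive_slope (f : R -> R) (t l : R) :
  is_derive f t l -> exists phi : R -> R, continuous phi t /\ phi t = l /\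
    forall s, f s = f t + (s - t) * phi s.
Proof.
intros [_ H]. specialize (H t (fun P HP => HP)).
exists (fun s => if Req_EM_T s t then l else (f s - f t) / (s - t)).
repeat split.
- apply filterlim_locally. intros e.
  assert (He2 : 0 < e / 2) by (assert (X := cond_pos e); lra).
  specialize (H (mkposreal _ He2)). revert H. apply filter_imp. intros s Hs.
  change (Rabs (f s - f t - (s - t) * l) <= e / 2 * Rabs (s - t)) in Hs.
  change (Rabs ((if Req_EM_T s t then l else (f s - f t) / (s - t))
    - (if Req_EM_T t t then l else (f t - f t) / (t - t))) < e).
  assert (He := cond_pos e).
  destruct (Req_EM_T t t) as [_ | n]; [ | now elim n].
  destruct (Req_EM_T s t) as [E | n].
  + rewrite Rminus_diag. rewrite Rabs_R0. exact He.
  + replace ((f s - f t) / (s - t) - l) with ((f s - f t - (s - t) * l) / (s - t))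
      by (field; lra).
    unfold Rdiv. rewrite Rabs_mult, Rabs_inv.
    assert (Hp : 0 < Rabs (s - t)) by (apply Rabs_pos_lt; lra).
    apply Rle_lt_trans with (e / 2); [ | lra].
    apply Rmult_le_reg_r with (1 := Hp).
    rewrite Rmult_assoc, Rinv_l by lra. lra.
- destruct (Req_EM_T t t) as [_ | n]; [reflexivity | now elim n].
- intros s. destruct (Req_EM_T s t) as [E | n]; [subst; ring | field; lra].
Qed.

Lemma rder_pair (u v : R -> R) (t du dv : R) :
  is_derive u t du -> is_derive v t dv -> rder (fun s => (u s, v s)) t (du, dv).
Proof.
intros Hu Hv.
destruct (derive_slope _ _ _ Hu) as [p [Hp [<- Ep]]].
destruct (derive_slope _ _ _ Hv) as [q [Hq [<- Eq]]].
exists (fun s => (p s, q s)). repeat split. now apply cont_pair.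
apply filter_forall. intros s. rewrite (Ep s) at 1. rewrite (Eq s) at 1.
unfold Cplus, Cmult, RtoC; simpl. f_equal; ring.
Qed.

Definition circ (r t : R) : C := (r * cos t, r * sin t).

Lemma Cmod_circ (r t : R) : 0 <= r -> Cmod (circ r t) = r.
Proof.
intros Hr. unfold Cmod, circ; simpl.
replace (r * cos t * (r * cos t * 1) + r * sin t * (r * sin t * 1))
  with (r * r * ((sin t)² + (cos t)²)) by (unfold Rsqr; ring).
rewrite sin2_cos2, Rmult_1_r. now apply sqrt_square.
Qed.

Lemma circ_rder (r t : R) : rder (circ r) t (Ci * circ r t)%C.
Proof.
replace (Ci * circ r t)%C with ((r * - sin t, r * cos t) : C).
- apply (rder_pair (fun s => r * cos s) (fun s => r * sin s)); auto_derive; auto; ring.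
- unfold Ci, circ, Cmult; simpl. f_equal; ring.
Qed.

Lemma circ_cont (r t : R) : continuous (circ r) t.
Proof. exact (rder_cont _ _ _ (circ_rder r t)). Qed.

Lemma circ_period (r : R) : circ r (2 * PI) = circ r 0.
Proof. unfold circ. now rewrite cos_2PI, sin_2PI, cos_0, sin_0. Qed.

Lemma circ_minus_lower (r t : R) (z : C) :
  Cmod z < r -> r - Cmod z <= Cmod (circ r t - z).
Proof.
intros Hz. assert (H0 := Cmod_ge_0 z).
assert (H := Cmod_le_add (circ r t) z). rewrite Cmod_circ in H by lra. lra.
Qed.

Lemma circ_minus_neq_0 (r t : R) (z : C) : Cmod z < r -> (circ r t - z)%C <> 0%C.
Proof.
intros Hz. apply Cmod_lt_neq_0. assert (H := circ_minus_lower r t z Hz). lra.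
Qed.

(** The Cauchy transform of a density h on the circle, without the factor 1/(2 pi i); in Cauchy's
    formula h includes the speed [Ci * circ r t]. With h arbitrary, the slopes of such transforms
    are again transforms, of densities divided by [circ r t - z]. *)
Definition K1 (r : R) (h : R -> C) (z : C) : C :=
  CInt (fun t => h t * / (circ r t - z))%C 0 (2 * PI).

Definition K2 (r : R) (h : R -> C) (z : C) : C :=
  CInt (fun t => h t * (/ (circ r t - z) * / (circ r t - z)))%C 0 (2 * PI).

Lemma two_PI_ge_0 : 0 <= 2 * PI.
Proof. assert (H := PI_RGT_0). lra. Qed.

Lemma inv_circ_cont (r t : R) (z : C) :
  Cmod z < r -> continuous (fun t => / (circ r t - z))%C t.
Proof.
intros Hz. apply cont_Cinv.
- apply cont_Cminus. apply circ_cont. apply continuous_const.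
- now apply circ_minus_neq_0.
Qed.

Lemma K1_integrand_cont (r : R) (h : R -> C) (z : C) (a b : R) :
  (forall t, continuous h t) -> Cmod z < r ->
  cont_on (fun t => h t * / (circ r t - z))%C a b.
Proof. intros Hh Hz t _. apply cont_Cmult. apply Hh. now apply inv_circ_cont. Qed.

Lemma K2_integrand_cont (r : R) (h : R -> C) (z : C) (a b : R) :
  (forall t, continuous h t) -> Cmod z < r ->
  cont_on (fun t => h t * (/ (circ r t - z) * / (circ r t - z)))%C a b.
Proof.
intros Hh Hz t _. apply cont_Cmult. apply Hh.
apply cont_Cmult; now apply inv_circ_cont.
Qed.

(** The resolvent identity A - B = (x - z) A B for A = 1/(c - x) and B = 1/(c - z), integrated
    against h. It is exact, so it displays the slope of [K1]. *)
Lemma K1_diff (r : R) (h : R -> C) (x z : C) :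
  (forall t, continuous h t) -> Cmod x < r -> Cmod z < r ->
  K1 r h x = (K1 r h z + (x - z) * K1 r (fun t => h t * / (circ r t - z)) x)%C.
Proof.
intros Hh Hx Hz. assert (HP := two_PI_ge_0). unfold K1.
assert (Cz : forall t, continuous (fun t => h t * / (circ r t - z))%C t).
{ intros t. apply cont_Cmult. apply Hh. now apply inv_circ_cont. }
assert (C1 : cont_on (fun t => h t * / (circ r t - z) * / (circ r t - x))%C 0 (2 * PI)).
{ intros t _. apply cont_Cmult. apply Cz. now apply inv_circ_cont. }
rewrite <- CInt_mult by auto. rewrite <- CInt_plus; auto.
- apply CInt_ext; [exact HP | ]. intros t _. field.
  split; now apply circ_minus_neq_0.
- now apply K1_integrand_cont.
- intros t Ht. apply cont_Cmult. apply continuous_const. now apply C1.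
Qed.

(** With A and B the resolvents at x and z, A^2 - B^2 = (A - B)(A + B) = (x - z)(A^2 B + A B^2). *)
Lemma K2_diff (r : R) (h : R -> C) (x z : C) :
  (forall t, continuous h t) -> Cmod x < r -> Cmod z < r ->
  K2 r h x = (K2 r h z + (x - z) *
    (K2 r (fun t => h t * / (circ r t - z)) x +
     K1 r (fun t => h t * (/ (circ r t - z) * / (circ r t - z))) x))%C.
Proof.
intros Hh Hx Hz. assert (HP := two_PI_ge_0). unfold K1, K2.
assert (I : forall w t, Cmod w < r -> continuous (fun t => / (circ r t - w))%C t)
  by (intros; now apply inv_circ_cont).
assert (A1 : cont_on (fun t => h t * / (circ r t - z) *
  (/ (circ r t - x) * / (circ r t - x)))%C 0 (2 * PI)).
{ apply (K2_integrand_cont r (fun t => h t * / (circ r t - z))%C); [ | exact Hx].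
  intros t. apply cont_Cmult. apply Hh. now apply I. }
assert (A2 : cont_on (fun t => h t * (/ (circ r t - z) * / (circ r t - z)) *
  / (circ r t - x))%C 0 (2 * PI)).
{ apply (K1_integrand_cont r (fun t => h t * (/ (circ r t - z) * / (circ r t - z)))%C);
    [ | exact Hx].
  intros t. apply cont_Cmult. apply Hh. apply cont_Cmult; now apply I. }
rewrite <- CInt_plus by auto. rewrite <- CInt_mult; [ | exact HP | ].
2: { intros t Ht. apply cont_Cplus. now apply A1. now apply A2. }
rewrite <- CInt_plus; [ | exact HP | | ].
- apply CInt_ext; [exact HP | ]. intros t _. field.
  split; now apply circ_minus_neq_0.
- now apply K2_integrand_cont.
- intros t Ht. apply cont_Cmult. apply continuous_const.
  apply cont_Cplus. now apply A1. now apply A2.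
Qed.

Lemma cont_bounded (h : R -> C) (a b : R) :
  (forall t, continuous h t) -> exists M, 0 <= M /\ forall t, a <= t <= b -> Cmod (h t) <= M.
Proof.
intros Hh.
destruct (bounded_continuity (V := C_R_NormedModule) h a b) as [M HM].
- intros t _. apply Hh.
- exists (Rmax 0 M). split. apply Rmax_l. intros t Ht.
  apply Rle_trans with (2 := Rmax_r 0 M). rewrite Cmod_norm.
  apply Rlt_le. now apply HM.
Qed.

Lemma K_bounded (r : R) (h : R -> C) (z : C) :
  (forall t, continuous h t) -> Cmod z < r ->
  exists B d, 0 < d /\ forall x, Cmod (x - z) < d ->
    Cmod x < r /\ Cmod (K1 r h x) <= B /\ Cmod (K2 r h x) <= B.
Proof.
intros Hh Hz. assert (HP := two_PI_ge_0).
destruct (cont_bounded h 0 (2 * PI) Hh) as [M [HM0 HM]].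
set (d := (r - Cmod z) / 2). assert (Hd : 0 < d) by (unfold d; lra).
assert (Hid : 0 < / d) by now apply Rinv_0_lt_compat.
exists (Rmax ((2 * PI - 0) * (M * / d)) ((2 * PI - 0) * (M * (/ d * / d)))), d.
split; [exact Hd | ]. intros x Hx.
assert (Hxr : Cmod x < r).
{ assert (X := Cmod_le_add x z). unfold d in Hx. lra. }
assert (L : forall t, Cmod (/ (circ r t - x)) <= / d).
{ intros t. rewrite Cmod_inv by now apply circ_minus_neq_0.
  apply Rinv_le_contravar; [exact Hd | ].
  assert (X := circ_minus_lower r t x Hxr). assert (Y := Cmod_le_add x z).
  unfold d in *. lra. }
split; [exact Hxr | split].
- apply Rle_trans with (2 := Rmax_l _ _). apply CInt_bound; auto.
  + now apply K1_integrand_cont.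
  + intros t Ht. rewrite Cmod_mult. apply Rmult_le_compat; auto using Cmod_ge_0.
- apply Rle_trans with (2 := Rmax_r _ _). apply CInt_bound; auto.
  + now apply K2_integrand_cont.
  + intros t Ht. rewrite !Cmod_mult.
    apply Rmult_le_compat; auto using Cmod_ge_0.
    * apply Rmult_le_pos; apply Cmod_ge_0.
    * apply Rmult_le_compat; auto using Cmod_ge_0.
Qed.

Lemma cont_of_bounded_slope (F G : C -> C) (z : C) (B d : R) :
  0 < d ->
  (forall x, Cmod (x - z) < d -> F x = F z + (x - z) * G x /\ Cmod (G x) <= B)%C ->
  continuous F z.
Proof.
intros Hd H. apply cont_Cmod_iff. intros e He.
assert (HB : 0 < Rmax B 1) by (apply Rlt_le_trans with (2 := Rmax_r _ _); lra).
apply locally_Cmod. exists (Rmin d (e / Rmax B 1)). split.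
- apply Rmin_glb_lt; [exact Hd | now apply Rdiv_lt_0_compat].
- intros x Hx.
  assert (Hx1 := Rlt_le_trans _ _ _ Hx (Rmin_l _ _)).
  assert (Hx2 := Rlt_le_trans _ _ _ Hx (Rmin_r _ _)).
  destruct (H x Hx1) as [E HG]. rewrite E.
  replace (F z + (x - z) * G x - F z)%C with ((x - z) * G x)%C by ring.
  rewrite Cmod_mult.
  apply Rle_lt_trans with (Cmod (x - z) * Rmax B 1).
  + apply Rmult_le_compat_l. apply Cmod_ge_0.
    apply Rle_trans with (1 := HG). apply Rmax_l.
  + apply Rlt_div_r in Hx2; [exact Hx2 | exact HB].
Qed.

Lemma K1_cont (r : R) (h : R -> C) (z : C) :
  (forall t, continuous h t) -> Cmod z < r -> continuous (K1 r h) z.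
Proof.
intros Hh Hz.
assert (Hk : forall t, continuous (fun t => h t * / (circ r t - z))%C t)
  by (intros t; now apply (K1_integrand_cont r h z t t Hh Hz t)).
destruct (K_bounded r _ z Hk Hz) as [B [d [Hd H]]].
apply cont_of_bounded_slope with (K1 r (fun t => h t * / (circ r t - z))%C) B d.
exact Hd. intros x Hx. destruct (H x Hx) as [Hxr [H1 _]]. split; [ | exact H1].
now apply K1_diff.
Qed.

Lemma K2_cont (r : R) (h : R -> C) (z : C) :
  (forall t, continuous h t) -> Cmod z < r -> continuous (K2 r h) z.
Proof.
intros Hh Hz.
assert (Hk : forall t, continuous (fun t => h t * / (circ r t - z))%C t)
  by (intros t; now apply (K1_integrand_cont r h z t t Hh Hz t)).
assert (Hk2 : forall t, continuous (fun t => h t * (/ (circ r t - z) * / (circ r t - z)))%C t)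
  by (intros t; now apply (K2_integrand_cont r h z t t Hh Hz t)).
destruct (K_bounded r _ z Hk Hz) as [B [d [Hd H]]].
destruct (K_bounded r _ z Hk2 Hz) as [B' [d' [Hd' H']]].
apply cont_of_bounded_slope with
  (fun x => K2 r (fun t => h t * / (circ r t - z)) x +
     K1 r (fun t => h t * (/ (circ r t - z) * / (circ r t - z))) x)%C (B + B') (Rmin d d').
now apply Rmin_glb_lt. intros x Hx.
destruct (H x) as [Hxr [_ H1]]. apply Rlt_le_trans with (1 := Hx). apply Rmin_l.
destruct (H' x) as [_ [H2 _]]. apply Rlt_le_trans with (1 := Hx). apply Rmin_r.
split. now apply K2_diff.
eapply Rle_trans. apply Cmod_triangle. apply Rplus_le_compat; assumption.
Qed.

Lemma Cmod_lt_locally (z : C) (r : R) : Cmod z < r -> locally z (fun x => Cmod x < r).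
Proof.
intros Hz. apply locally_Cmod. exists (r - Cmod z). split; [lra | ].
intros x Hx. assert (X := Cmod_le_add x z). lra.
Qed.

Lemma K1_cder (r : R) (h : R -> C) (z : C) :
  (forall t, continuous h t) -> Cmod z < r -> cder (K1 r h) z (K2 r h z).
Proof.
intros Hh Hz. exists (K1 r (fun t => h t * / (circ r t - z))%C). repeat split.
- apply K1_cont; [ | exact Hz]. intros t. now apply (K1_integrand_cont r h z t t Hh Hz t).
- apply CInt_ext; [apply two_PI_ge_0 | ]. intros t _. ring.
- generalize (Cmod_lt_locally z r Hz). apply filter_imp. intros x Hx. now apply K1_diff.
Qed.

(** This is what makes derivatives differentiable: by Cauchy's formula f' is a constant times a
    [K2]. Only the existence of the limit matters, so its value is left to unification. *)
Lemma K2_ex_cder (r : R) (h : R -> C) (z : C) :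
  (forall t, continuous h t) -> Cmod z < r -> exists l, cder (K2 r h) z l.
Proof.
intros Hh Hz.
assert (Hk : forall t, continuous (fun t => h t * / (circ r t - z))%C t)
  by (intros t; now apply (K1_integrand_cont r h z t t Hh Hz t)).
assert (Hk2 : forall t, continuous (fun t => h t * (/ (circ r t - z) * / (circ r t - z)))%C t)
  by (intros t; now apply (K2_integrand_cont r h z t t Hh Hz t)).
eexists.
exists (fun x => K2 r (fun t => h t * / (circ r t - z)) x +
     K1 r (fun t => h t * (/ (circ r t - z) * / (circ r t - z))) x)%C. repeat split.
- apply cont_Cplus. now apply K2_cont. now apply K1_cont.
- generalize (Cmod_lt_locally z r Hz). apply filter_imp. intros x Hx. now apply K2_diff.
Qed.

Lemma CInt_circ_deriv (F f : C -> C) (r : R) :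
  (forall t, cder F (circ r t) (f (circ r t))) ->
  (forall t, continuous (fun t => f (circ r t)) t) ->
  CInt (fun t => f (circ r t) * (Ci * circ r t))%C 0 (2 * PI) = 0%C.
Proof.
intros HF Hf. rewrite (CInt_FTC (fun t => F (circ r t))).
- rewrite circ_period. ring.
- apply two_PI_ge_0.
- intros t _. apply rder_comp. apply HF. apply circ_rder.
- intros t _. apply cont_Cmult. apply Hf. apply cont_Cmult. apply continuous_const.
  apply circ_cont.
Qed.

Lemma circ_speed_cont (r t : R) : continuous (fun t => Ci * circ r t)%C t.
Proof. apply cont_Cmult. apply continuous_const. apply circ_cont. Qed.

(** The derivative in z integrates 1/(w - z)^2, which has the primitive -1/(w - z), around a closed
    curve and hence vanishes. So the integral is the same as at z = 0, where the integrand is the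
    constant i. *)
Lemma winding_number (r : R) (z : C) :
  Cmod z < r -> K1 r (fun t => Ci * circ r t)%C z = (RtoC (2 * PI) * Ci)%C.
Proof.
intros Hz. assert (Hr : 0 < r) by (assert (X := Cmod_ge_0 z); lra).
assert (H0 : Cmod 0 < r) by (rewrite Cmod_0; exact Hr).
assert (D : forall x, Cmod x < r -> cder (K1 r (fun t => Ci * circ r t)%C) x 0%C).
{ intros x Hx.
  assert (E : K2 r (fun t => Ci * circ r t)%C x = 0%C).
  { unfold K2.
    rewrite <- (CInt_circ_deriv (fun w => - / (w - x))%C
       (fun w => / (w - x) * / (w - x))%C r).
    - apply CInt_ext; [apply two_PI_ge_0 | ]. intros t _. ring.
    - intros t.
      replace (/ (circ r t - x) * / (circ r t - x))%C with
        (- (- (1 - 0) / ((circ r t - x) * (circ r t - x))))%C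
        by (field; now apply circ_minus_neq_0).
      apply cder_opp. apply (cder_inv (fun w => w - x)%C).
      + apply cder_minus. apply cder_id. apply cder_const.
      + now apply circ_minus_neq_0.
    - intros t. apply cont_Cmult; now apply inv_circ_cont. }
  rewrite <- E. apply K1_cder; auto. intros t. apply circ_speed_cont. }
assert (S : seg (fun _ => 0%C) 0 z =
  (K1 r (fun t => Ci * circ r t) z - K1 r (fun t => Ci * circ r t) 0)%C).
{ apply seg_FTC.
  - intros t Ht. apply D. apply Rle_lt_trans with (Rmax (Cmod 0) (Cmod z)).
    + apply Cmod_convex. exact Ht. apply Rmax_l. apply Rmax_r.
    + now apply Rmax_lub_lt.
  - intros t _. apply continuous_const. }
assert (S0 : seg (fun _ => 0%C) 0 z = 0%C).
{ unfold seg. rewrite CInt_const. ring. }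
rewrite S0 in S.
assert (V0 : K1 r (fun t => Ci * circ r t)%C 0 = (RtoC (2 * PI) * Ci)%C).
{ unfold K1. rewrite (CInt_ext _ (fun _ => Ci)).
  - rewrite CInt_const. now rewrite Rminus_0_r.
  - apply two_PI_ge_0.
  - intros t _. assert (N := circ_minus_neq_0 r t 0 H0).
    replace (circ r t) with (circ r t - 0)%C at 1 by ring. field.
    replace (circ r t - 0)%C with (circ r t) in N by ring. exact N. }
rewrite <- V0. apply Ceq_minus. now symmetry.
Qed.

(** Differentiation under the integral sign. The margin d makes 0 and 1 interior points of the
    parameter range, so that two-sided derivatives are available there. *)
Lemma RInt_param_const (f f' : R -> R -> R) (a b d : R) :
  0 < d ->
  (forall u t, - d < u < 1 + d -> is_derive (fun u => f u t) u (f' u t)) ->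
  (forall u t, 0 <= u <= 1 -> continuous (fun p : R * R => f' (fst p) (snd p)) (u, t)) ->
  (forall u t, - d < u < 1 + d -> continuous (f u) t) ->
  (forall u, 0 <= u <= 1 -> RInt (f' u) a b = 0) ->
  RInt (f 0) a b = RInt (f 1) a b.
Proof.
intros Hd HD HC Hf HI.
assert (Loc : forall u, 0 <= u <= 1 -> locally u (fun v => - d < v < 1 + d)).
{ intros u Hu. exists (mkposreal d Hd). intros v Hv.
  unfold ball in Hv; simpl in Hv; unfold AbsRing_ball, abs, minus, plus, opp in Hv;
  simpl in Hv. apply Rabs_lt_between in Hv. lra. }
apply (eq_is_derive (V := R_NormedModule) (fun u => RInt (f u) a b) 0 1); [ | lra].
intros u Hu.
assert (L := Loc u Hu).
replace (zero : R_NormedModule) with (RInt (fun t => Derive (fun u => f u t) u) a b).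
- apply is_derive_RInt_param.
  + revert L. apply filter_imp. intros v Hv t _. exists (f' v t). now apply HD.
  + intros t _.
    apply continuity_2d_pt_ext_loc with f'.
    * apply locally_2d_locally.
      assert (L' : locally (u, t) (fun p : R * R => - d < fst p < 1 + d)).
      { exact (continuous_fst (U := R_UniformSpace) (V := R_UniformSpace) u t _ L). }
      revert L'. apply filter_imp. intros [v s] Hv. simpl in *.
      symmetry. apply is_derive_unique. now apply HD.
    * apply continuity_2d_pt_filterlim. now apply HC.
  + revert L. apply filter_imp. intros v Hv.
    apply (ex_RInt_continuous (V := R_CompleteNormedModule)). intros t _. now apply Hf.
- transitivity (RInt (f' u) a b); [ | exact (HI u Hu)].
  apply RInt_ext. intros t _.
  apply is_derive_unique. apply HD. lra.
Qed.

Lemma CInt_param_const (f f' : R -> R -> C) (a b d : R) :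
  0 < d ->
  (forall u t, - d < u < 1 + d -> rder (fun u => f u t) u (f' u t)) ->
  (forall u t, 0 <= u <= 1 -> continuous (fun p : R * R => f' (fst p) (snd p)) (u, t)) ->
  (forall u t, - d < u < 1 + d -> continuous (f u) t) ->
  (forall u, 0 <= u <= 1 -> CInt (f' u) a b = 0%C) ->
  CInt (f 0) a b = CInt (f 1) a b.
Proof.
intros Hd HD HC Hf HI. unfold CInt. f_equal.
- apply (RInt_param_const (fun u t => Re (f u t)) (fun u t => Re (f' u t)) a b d Hd).
  + intros u t Hu. now apply rder_Re, HD.
  + intros u t Hu. apply (cont_Re (fun p : R * R => f' (fst p) (snd p))). now apply HC.
  + intros u t Hu. now apply cont_Re, Hf.
  + intros u Hu. exact (f_equal Re (HI u Hu)).
- apply (RInt_param_const (fun u t => Im (f u t)) (fun u t => Im (f' u t)) a b d Hd).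
  + intros u t Hu. now apply rder_Im, HD.
  + intros u t Hu. apply (cont_Im (fun p : R * R => f' (fst p) (snd p))). now apply HC.
  + intros u t Hu. now apply cont_Im, Hf.
  + intros u Hu. exact (f_equal Im (HI u Hu)).
Qed.

(* The circle is contracted to z along segments; F being C^1, the integral
   does not change. *)
Lemma cauchy_formula_C1 (F f : C -> C) (r : R) (z : C) :
  (forall x, inD x -> cder F x (f x)) -> (forall x, inD x -> continuous f x) ->
  r < 1 -> Cmod z < r ->
  K1 r (fun t => F (circ r t) * (Ci * circ r t))%C z = (F z * (RtoC (2 * PI) * Ci))%C.
Proof.
intros HF Hf Hr1 Hz. assert (HP := two_PI_ge_0).
assert (Hz0 := Cmod_ge_0 z).
assert (Hr : 0 < r) by lra.
set (p := fun (u t : R) => (z + RtoC u * (circ r t - z))%C).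
(* With this margin |p u t| < (1 + 2 d) r = 1 - (1 - r)^2 < 1, so the homotopy stays in the unit
   disk on the enlarged parameter range. *)
set (d := (1 - r) / 2). assert (Hd : 0 < d) by (unfold d; lra).
assert (HpD : forall u t, - d < u < 1 + d -> inD (p u t)).
{ intros u t Hu. unfold p, inD.
  replace (z + RtoC u * (circ r t - z))%C with (RtoC (1 - u) * z + RtoC u * circ r t)%C
    by (rewrite RtoC_minus; ring).
  apply Rle_lt_trans with (1 := Cmod_triangle _ _).
  rewrite !Cmod_mult, !Cmod_R, Cmod_circ by lra.
  unfold d in *.
  destruct (Rle_dec 0 u); destruct (Rle_dec u 1);
    unfold Rabs; destruct (Rcase_abs (1 - u)); destruct (Rcase_abs u); try lra; nra. }
assert (Cp : forall u t, continuous (fun q : R * R => p (fst q) (snd q)) (u, t)).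
{ intros u t. unfold p. apply cont_Cplus. apply continuous_const. apply cont_Cmult.
  - apply cont_RtoC. apply continuous_fst.
  - apply cont_Cminus; [ | apply continuous_const].
    apply (continuous_comp (fun q : R * R => snd q) (circ r)).
    apply continuous_snd. apply circ_cont. }
assert (Cpt : forall u t, continuous (p u) t).
{ intros u t. unfold p. apply cont_Cplus. apply continuous_const. apply cont_Cmult.
  apply continuous_const. apply cont_Cminus. apply circ_cont. apply continuous_const. }
assert (Rp : forall u t, rder (fun u => p u t) u (circ r t - z)%C)
  by (intros; apply rder_affine).
assert (Rpt : forall u t, rder (p u) t (RtoC u * (Ci * circ r t))%C).
{ intros u t.
  replace (RtoC u * (Ci * circ r t))%C
    with (0 + (0 * (circ r t - z) + RtoC u * (Ci * circ r t + 0)))%C by ring.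
  unfold p. apply rder_plus. apply rder_const.
  apply (rder_mult (fun _ => RtoC u) (fun t => circ r t - z)%C). apply rder_const.
  apply (rder_plus (circ r) (fun _ => - z)%C). apply circ_rder. apply rder_const. }
assert (Cf : forall u t, - d < u < 1 + d -> continuous (fun t => f (p u t)) t).
{ intros u t Hu. apply (continuous_comp (p u) f). apply Cpt. apply Hf. now apply HpD. }
assert (Main := CInt_param_const
  (fun u t => F (p u t) * (Ci * circ r t * / (circ r t - z)))%C
  (fun u t => f (p u t) * (Ci * circ r t))%C 0 (2 * PI) d Hd).
assert (Ck : forall t, continuous (fun t => Ci * circ r t * / (circ r t - z))%C t).
{ intros t. apply cont_Cmult. apply circ_speed_cont. now apply inv_circ_cont. }
assert (E : CInt (fun t => F (p 0 t) * (Ci * circ r t * / (circ r t - z)))%C 0 (2 * PI) =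
  CInt (fun t => F (p 1 t) * (Ci * circ r t * / (circ r t - z)))%C 0 (2 * PI)).
{ apply Main.
  - intros u t Hu.
    (* Differentiating F (p u t) in u produces the factor [circ r t - z], which cancels the Cauchy
       kernel. *)
    replace (f (p u t) * (Ci * circ r t))%C with
      ((f (p u t) * (circ r t - z)) * (Ci * circ r t * / (circ r t - z)) + F (p u t) * 0)%C
      by (field; now apply circ_minus_neq_0).
    apply (rder_mult (fun u => F (p u t)) (fun _ => Ci * circ r t * / (circ r t - z))%C).
    + apply (rder_comp F (fun u => p u t)). apply HF. now apply HpD. apply Rp.
    + apply rder_const.
  - intros u t Hu. apply cont_Cmult.
    + apply (continuous_comp (fun q : R * R => p (fst q) (snd q)) f). apply Cp.
      apply Hf. simpl. apply HpD. lra.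
    + apply (continuous_comp (fun q : R * R => snd q) (fun t => Ci * circ r t)%C).
      apply continuous_snd. apply circ_speed_cont.
  - intros u t Hu. apply cont_Cmult; [ | apply Ck].
    apply (continuous_comp (p u) F). apply Cpt.
    apply cder_cont with (f (p u t)). apply HF. now apply HpD.
  - intros u Hu.
    (* For u <> 0 the integrand times u is the t-derivative of the periodic function F (p u t). At u
       = 0 it is f z times the speed of the circle, whose integral vanishes separately. *)
    destruct (Req_dec u 0) as [-> | Hu0].
    + rewrite (CInt_ext _ (fun t => f z * (Ci * circ r t))%C); [ | exact HP | ].
      * rewrite CInt_mult; [ | exact HP | intros t _; apply circ_speed_cont].
        assert (X := CInt_circ_deriv (fun w => w) (fun _ => 1%C) r).
        rewrite (CInt_ext _ (fun t => 1 * (Ci * circ r t))%C) by (auto; intros; ring).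
        rewrite X. ring.
        intros t. apply cder_id. intros t. apply continuous_const.
      * intros t _. unfold p. do 2 f_equal. ring.
    + assert (Hun : RtoC u <> 0%C) by (intros E; apply RtoC_inj in E; lra).
      replace (CInt (fun t => f (p u t) * (Ci * circ r t))%C 0 (2 * PI))
        with (/ RtoC u * (RtoC u * CInt (fun t => f (p u t) * (Ci * circ r t))%C 0 (2 * PI)))%C
        by now field.
      rewrite <- (CInt_mult (RtoC u)); [ | exact HP | ].
      * rewrite (CInt_FTC (fun t => F (p u t))); [ | exact HP | | ].
        -- unfold p. rewrite circ_period. ring.
        -- intros t _.
           replace (RtoC u * (f (p u t) * (Ci * circ r t)))%C
             with (f (p u t) * (RtoC u * (Ci * circ r t)))%C by ring.
           apply rder_comp. apply HF. apply HpD. lra. apply Rpt.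
        -- intros t _. apply cont_Cmult. apply continuous_const.
           apply cont_Cmult. apply Cf. lra. apply circ_speed_cont.
      * intros t _. apply cont_Cmult. apply Cf. lra. apply circ_speed_cont. }
transitivity (CInt (fun t => F (p 1 t) * (Ci * circ r t * / (circ r t - z)))%C 0 (2 * PI)).
- unfold K1. apply CInt_ext; [exact HP | ]. intros t _.
  replace (p 1 t) with (circ r t) by (unfold p; ring). ring.
- rewrite <- E, <- (winding_number r z Hz). unfold K1.
  rewrite <- CInt_mult; [ | exact HP | intros t _; apply Ck].
  apply CInt_ext; [exact HP | ]. intros t _.
  replace (p 0 t) with z by (unfold p; ring). ring.
Qed.

Lemma two_PI_i_neq_0 : (RtoC (2 * PI) * Ci)%C <> 0%C.
Proof.
apply Cmult_neq_0; [ | apply Ci_nz].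
intros E. apply RtoC_inj in E. assert (X := PI_RGT_0). lra.
Qed.

Lemma circ_inD (r t : R) : 0 <= r < 1 -> inD (circ r t).
Proof. intros Hr. unfold inD. rewrite Cmod_circ by lra. lra. Qed.

(** Cauchy's formula holds for a primitive F, since its derivative f is continuous. Differentiating
    it in z expresses f z through F with the squared kernel, and integration by parts around the
    circle (the total derivative of F w / (w - z) integrates to 0) moves the derivative from the
    kernel to F. *)
Theorem cauchy_formula (f : C -> C) (r : R) (z : C) :
  analytic f -> r < 1 -> Cmod z < r ->
  K1 r (fun t => f (circ r t) * (Ci * circ r t))%C z = (f z * (RtoC (2 * PI) * Ci))%C.
Proof.
intros Hf Hr1 Hz. assert (HP := two_PI_ge_0).
assert (Hz0 := Cmod_ge_0 z).
destruct (analytic_primitive f Hf) as [F HF].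
assert (Hcf : forall x, inD x -> continuous f x) by (intros; now apply analytic_cont).
assert (CF : forall t, continuous (fun t => F (circ r t) * (Ci * circ r t))%C t).
{ intros t. apply cont_Cmult; [ | apply circ_speed_cont].
  apply (continuous_comp (circ r) F). apply circ_cont.
  apply cder_cont with (f (circ r t)). apply HF. apply circ_inD. lra. }
assert (Cfr : forall t, continuous (fun t => f (circ r t)) t).
{ intros t. apply (continuous_comp (circ r) f). apply circ_cont. apply Hcf.
  apply circ_inD. lra. }
assert (D1 := K1_cder r _ z CF Hz).
assert (D2 : cder (K1 r (fun t => F (circ r t) * (Ci * circ r t))%C) z
  (f z * (RtoC (2 * PI) * Ci))%C).
{ apply cder_ext_loc with (fun x => F x * (RtoC (2 * PI) * Ci))%C.
  - generalize (Cmod_lt_locally z r Hz). apply filter_imp. intros x Hx.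
    symmetry. now apply cauchy_formula_C1 with f.
  - replace (f z * (RtoC (2 * PI) * Ci))%C
      with (f z * (RtoC (2 * PI) * Ci) + F z * 0)%C by ring.
    apply (cder_mult F (fun _ => RtoC (2 * PI) * Ci)%C).
    + apply HF. unfold inD. lra.
    + apply cder_const. }
rewrite <- (cder_unique _ _ _ _ D1 D2).
assert (E : CInt (fun t => (f (circ r t) * / (circ r t - z)
    - F (circ r t) * (/ (circ r t - z) * / (circ r t - z))) * (Ci * circ r t))%C
    0 (2 * PI) = 0%C).
{ apply (CInt_circ_deriv (fun w => F w * / (w - z))%C
    (fun w => f w * / (w - z) - F w * (/ (w - z) * / (w - z)))%C).
  - intros t.
    replace (f (circ r t) * / (circ r t - z)
      - F (circ r t) * (/ (circ r t - z) * / (circ r t - z)))%C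
      with (f (circ r t) * / (circ r t - z)
        + F (circ r t) * (- (1 - 0) / ((circ r t - z) * (circ r t - z))))%C
      by (field; now apply circ_minus_neq_0).
    apply (cder_mult F (fun w => / (w - z))%C). apply HF. apply circ_inD. lra.
    apply (cder_inv (fun w => w - z)%C).
    apply cder_minus. apply cder_id. apply cder_const. now apply circ_minus_neq_0.
  - intros t. apply cont_Cminus; apply cont_Cmult;
      [apply Cfr | now apply inv_circ_cont | | apply cont_Cmult; now apply inv_circ_cont].
    apply (continuous_comp (circ r) F). apply circ_cont.
    apply cder_cont with (f (circ r t)). apply HF. apply circ_inD. lra. }
assert (E1 : K1 r (fun t => f (circ r t) * (Ci * circ r t))%C z =
  (K2 r (fun t => F (circ r t) * (Ci * circ r t)) z + 0)%C).
{ rewrite <- E. unfold K1, K2. rewrite <- CInt_plus.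
  - apply CInt_ext; [exact HP | ]. intros t _. ring.
  - exact HP.
  - now apply K2_integrand_cont.
  - intros t _. apply cont_Cmult; [ | apply circ_speed_cont].
    apply cont_Cminus; apply cont_Cmult;
      [apply Cfr | now apply inv_circ_cont | | apply cont_Cmult; now apply inv_circ_cont].
    apply (continuous_comp (circ r) F). apply circ_cont.
    apply cder_cont with (f (circ r t)). apply HF. apply circ_inD. lra. }
rewrite E1. apply Cplus_0_r.
Qed.

Lemma circ_density_cont (f : C -> C) (r t : R) :
  analytic f -> 0 <= r < 1 ->
  continuous (fun t => f (circ r t) * (Ci * circ r t))%C t.
Proof.
intros Hf Hr. apply cont_Cmult; [ | apply circ_speed_cont].
apply (continuous_comp (circ r) f). apply circ_cont.
apply analytic_cont. exact Hf. now apply circ_inD.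
Qed.

Lemma cauchy_derivative (f : C -> C) (r : R) (z : C) :
  analytic f -> r < 1 -> Cmod z < r ->
  C_derive f z =
  (/ (RtoC (2 * PI) * Ci) * K2 r (fun t => f (circ r t) * (Ci * circ r t)) z)%C.
Proof.
intros Hf Hr Hz. assert (H0 := Cmod_ge_0 z).
apply cder_C_derive.
apply cder_ext_loc with (fun x => / (RtoC (2 * PI) * Ci) *
  K1 r (fun t => f (circ r t) * (Ci * circ r t)) x)%C.
- generalize (Cmod_lt_locally z r Hz). apply filter_imp. intros x Hx.
  rewrite cauchy_formula by assumption. to_C. field. split.
  apply Ci_nz. intros E. apply RtoC_inj in E. assert (X := PI_RGT_0). lra.
- apply cder_scal. apply K1_cder; [ | exact Hz].
  intros t. apply circ_density_cont; [exact Hf | lra].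
Qed.

Theorem analytic_C_derive (f : C -> C) : analytic f -> analytic (C_derive f).
Proof.
intros Hf z Hz. unfold inD in Hz. assert (H0 := Cmod_ge_0 z).
set (r := (1 + Cmod z) / 2).
assert (Hr : r < 1) by (unfold r; lra). assert (Hzr : Cmod z < r) by (unfold r; lra).
destruct (K2_ex_cder r (fun t => f (circ r t) * (Ci * circ r t))%C z) as [l Hl].
- intros t. apply circ_density_cont; [exact Hf | lra].
- exact Hzr.
- exists (/ (RtoC (2 * PI) * Ci) * l)%C. apply cder_is_derive.
  apply cder_ext_loc with (fun x => / (RtoC (2 * PI) * Ci) *
    K2 r (fun t => f (circ r t) * (Ci * circ r t)) x)%C.
  + generalize (Cmod_lt_locally z r Hzr). apply filter_imp. intros x Hx.
    symmetry. now apply cauchy_derivative.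
  + now apply cder_scal.
Qed.

(** * Divided differences of analytic functions *)

Definition dslope (f : C -> C) (a z : C) : C :=
  if Ceq_dec z a then C_derive f a else ((f z - f a) / (z - a))%C.

Lemma dslope_eq (f : C -> C) (a z : C) : (f z = f a + (z - a) * dslope f a z)%C.
Proof.
unfold dslope. destruct (Ceq_dec z a) as [E | n].
- subst. ring.
- field. now apply Cminus_eq_contra.
Qed.

Lemma dslope_diag (f : C -> C) (a : C) : dslope f a a = C_derive f a.
Proof. unfold dslope. destruct (Ceq_dec a a) as [_ | n]; [reflexivity | now elim n]. Qed.

(** Up to the factor 2 pi i the divided difference is the Cauchy transform of the density of f
    divided by [circ r t - a]: away from a this is the resolvent identity, at a it is the formula
    for the derivative. So the singularity at a is removable with no separate argument. *)
Lemma analytic_dslope (f : C -> C) (a : C) : analytic f -> inD a -> analytic (dslope f a).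
Proof.
intros Hf Ha z Hz. unfold inD in Ha, Hz. assert (H0 := Cmod_ge_0 z).
set (r := (1 + Rmax (Cmod a) (Cmod z)) / 2).
assert (M1 := Rmax_l (Cmod a) (Cmod z)). assert (M2 := Rmax_r (Cmod a) (Cmod z)).
assert (M3 : Rmax (Cmod a) (Cmod z) < 1) by now apply Rmax_lub_lt.
assert (Hr : r < 1) by (unfold r; lra).
assert (Har : Cmod a < r) by (unfold r; lra).
assert (Hzr : Cmod z < r) by (unfold r; lra).
set (h := fun t => (f (circ r t) * (Ci * circ r t))%C).
assert (Hh : forall t, continuous h t)
  by (intros t; apply circ_density_cont; [exact Hf | lra]).
assert (Hk : forall t, continuous (fun t => h t * / (circ r t - a))%C t)
  by (intros t; now apply (K1_integrand_cont r h a t t Hh Har t)).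
set (c := (RtoC (2 * PI) * Ci)%C).
assert (Hc : c <> 0%C) by apply two_PI_i_neq_0.
exists (/ c * K2 r (fun t => h t * / (circ r t - a)) z)%C.
apply cder_is_derive.
apply cder_ext_loc with (fun x => / c * K1 r (fun t => h t * / (circ r t - a)) x)%C.
- generalize (Cmod_lt_locally z r Hzr). apply filter_imp. intros x Hx.
  unfold dslope. destruct (Ceq_dec x a) as [E | n].
  + subst x. rewrite (cauchy_derivative f r a Hf Hr Har). fold h c. f_equal.
    apply CInt_ext. apply two_PI_ge_0. intros t _. ring.
  + assert (D := K1_diff r h x a Hh Hx Har).
    assert (Ex := cauchy_formula f r x Hf Hr Hx). fold h c in Ex.
    assert (Ea := cauchy_formula f r a Hf Hr Har). fold h c in Ea.
    rewrite Ex, Ea in D.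
    assert (Hn : (x - a)%C <> 0%C) by now apply Cminus_eq_contra.
    set (k := K1 r (fun t => h t * / (circ r t - a))%C x) in *.
    assert (Hf' : f x = (f a + (x - a) * k / c)%C).
    { replace (f x) with (f x * c / c)%C by (field; exact Hc). rewrite D. field. exact Hc. }
    rewrite Hf'. to_C. field. now split.
- apply cder_scal. now apply K1_cder.
Qed.

(** * The maximum principle and the Schwarz-Pick inequality *)

Lemma pow_bound_le_1 (x B : R) : (forall n : nat, x ^ n <= B) -> x <= 1.
Proof.
intros H. destruct (Rle_dec x 1) as [L | L]; [exact L | exfalso].
destruct (Pow_x_infinity x) with (b := B + 1) as [N HN].
- rewrite Rabs_pos_eq; lra.
- specialize (HN N (le_n N)). specialize (H N).
  rewrite Rabs_pos_eq in HN by (apply pow_le; lra). lra.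
Qed.

(* Landau's trick: Cauchy's formula for the powers of g bounds |g z|^n by a
   constant independent of n times M^n. *)
Lemma maximum_principle (g : C -> C) (r M : R) (z : C) :
  analytic g -> r < 1 -> Cmod z < r ->
  (forall x, Cmod x = r -> Cmod (g x) <= M) -> Cmod (g z) <= M.
Proof.
intros Hg Hr Hz HM. assert (H0 := Cmod_ge_0 z).
assert (HP := PI_RGT_0).
assert (HM0 : 0 <= M).
{ apply Rle_trans with (2 := HM (circ r 0) (Cmod_circ r 0 ltac:(lra))). apply Cmod_ge_0. }
assert (Pw : forall n : nat, Cmod (g z) ^ n <= M ^ n * (r / (r - Cmod z))).
{ intros n.
  assert (E := cauchy_formula (fun x => g x ^ n)%C r z (analytic_pow g n Hg) Hr Hz).
  apply (f_equal Cmod) in E. rewrite !Cmod_mult, Cmod_R, Cmod_Ci, Cmod_pow in E.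
  rewrite Rabs_pos_eq in E by lra. simpl in E.
  assert (B : Cmod (K1 r (fun t => g (circ r t) ^ n * (Ci * circ r t))%C z) <=
    (2 * PI - 0) * (M ^ n * (r / (r - Cmod z)))).
  { apply CInt_bound; [lra | | ].
    - apply K1_integrand_cont; [ | exact Hz]. intros t.
      apply (circ_density_cont (fun x => g x ^ n)%C). now apply analytic_pow. lra.
    - intros t _. rewrite !Cmod_mult, Cmod_pow, Cmod_Ci, Cmod_circ by lra.
      rewrite Cmod_inv by now apply circ_minus_neq_0.
      rewrite Rmult_assoc. apply Rmult_le_compat.
      + apply pow_le, Cmod_ge_0.
      + assert (X := circ_minus_lower r t z Hz).
        apply Rmult_le_pos. lra. apply Rlt_le, Rinv_0_lt_compat. lra.
      + apply pow_incr. split. apply Cmod_ge_0. apply HM. apply Cmod_circ. lra.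
      + unfold Rdiv. rewrite Rmult_1_l. apply Rmult_le_compat_l. lra.
        apply Rinv_le_contravar. lra. now apply circ_minus_lower. }
  rewrite E in B. apply Rmult_le_reg_r with (2 * PI). lra. lra. }
destruct (Req_dec M 0) as [E | n].
- specialize (Pw 1%nat). rewrite E in Pw |- *. simpl in Pw. lra.
- assert (X : Cmod (g z) / M <= 1).
  { apply (pow_bound_le_1 _ (r / (r - Cmod z))). intros k.
    unfold Rdiv at 1. rewrite Rpow_mult_distr, pow_inv.
    assert (Hp : 0 < M ^ k) by (apply pow_lt; lra).
    apply Rmult_le_reg_r with (1 := Hp).
    rewrite Rmult_assoc, Rinv_l by lra. specialize (Pw k). lra. }
  apply Rle_div_l in X; lra.
Qed.

Lemma schwarz_lemma (w : C -> C) (z : C) :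
  analytic w -> (forall x, inD x -> Cmod (w x) <= 1) -> w 0%C = 0%C -> inD z ->
  Cmod (dslope w 0 z) <= 1.
Proof.
intros Hw H1 H0 Hz. unfold inD in Hz. assert (Hz0 := Cmod_ge_0 z).
assert (D0 : inD 0) by (unfold inD; rewrite Cmod_0; lra).
apply le_epsilon. intros e He.
(* On |x| = r the divided difference w x / x has modulus at most 1 / r, which is at most 1 + e for
   this r. *)
set (r := Rmax ((1 + Cmod z) / 2) (/ (1 + e))).
assert (I : / (1 + e) < 1) by (rewrite <- Rinv_1; apply Rinv_lt_contravar; lra).
assert (I0 : 0 < / (1 + e)) by (apply Rinv_0_lt_compat; lra).
assert (R1 := Rmax_l ((1 + Cmod z) / 2) (/ (1 + e))).
assert (R2 := Rmax_r ((1 + Cmod z) / 2) (/ (1 + e))). fold r in R1, R2.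
assert (Hr : r < 1) by (apply Rmax_lub_lt; lra).
apply (maximum_principle (dslope w 0) r); [now apply analytic_dslope | exact Hr | lra | ].
intros x Hx.
assert (E := dslope_eq w 0 x). rewrite H0 in E.
apply (f_equal Cmod) in E.
replace (0 + (x - 0) * dslope w 0 x)%C with (x * dslope w 0 x)%C in E by ring.
rewrite Cmod_mult, Hx in E.
assert (B : Cmod (w x) <= 1) by (apply H1; unfold inD; lra).
rewrite E in B.
apply Rmult_le_reg_l with r. lra.
apply Rle_trans with (1 := B).
apply Rle_trans with (/ (1 + e) * (1 + e)). rewrite Rinv_l; lra.
apply Rmult_le_compat_r; lra.
Qed.

Lemma schwarz_mod (w : C -> C) (z : C) :
  analytic w -> (forall x, inD x -> Cmod (w x) <= 1) -> w 0%C = 0%C -> inD z ->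
  Cmod (w z) <= Cmod z.
Proof.
intros Hw H1 H0 Hz. assert (S := schwarz_lemma w z Hw H1 H0 Hz).
rewrite (dslope_eq w 0 z), H0.
replace (0 + (z - 0) * dslope w 0 z)%C with (z * dslope w 0 z)%C by ring.
rewrite Cmod_mult. assert (X := Cmod_ge_0 z). nra.
Qed.

Lemma Cmod_sq_mult_conj (a z : C) :
  Cmod (1 - Cconj a * z) * Cmod (1 - Cconj a * z) =
  Cmod (z - a) * Cmod (z - a) + (1 - Cmod a * Cmod a) * (1 - Cmod z * Cmod z).
Proof.
rewrite !Cmod_sq. destruct a as [p q]; destruct z as [x y]; simpl. ring.
Qed.

Lemma blaschke_le (a z : C) : Cmod a <= 1 -> Cmod z <= 1 ->
  Cmod (z - a) <= Cmod (1 - Cconj a * z).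
Proof.
intros Ha Hz. assert (E := Cmod_sq_mult_conj a z).
assert (H1 := Cmod_ge_0 a). assert (H2 := Cmod_ge_0 z).
assert (H3 := Cmod_ge_0 (z - a)). assert (H4 := Cmod_ge_0 (1 - Cconj a * z)).
assert (0 <= (1 - Cmod a * Cmod a) * (1 - Cmod z * Cmod z)) by (apply Rmult_le_pos; nra).
nra.
Qed.

Lemma one_sub_conj_neq_0 (a z : C) : Cmod a < 1 -> Cmod z <= 1 ->
  (1 - Cconj a * z)%C <> 0%C.
Proof.
intros Ha Hz. apply Csub_neq_0_mod.
rewrite Cmod_mult, Cmod_conj, Cmod_1.
assert (H1 := Cmod_ge_0 a). assert (H2 := Cmod_ge_0 z). nra.
Qed.

(** The function G is the Blaschke quotient of w x with respect to w a, divided by that of x with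
    respect to a. Its modulus is at most 1 + e on circles close to the unit circle, hence at most 1
    at a, where G is w'(a) (1 - |a|^2) / (1 - |w a|^2). The bound s < 1 keeps the denominators away
    from 0. *)
Lemma schwarz_pick_strict (w : C -> C) (a : C) (s : R) :
  analytic w -> s < 1 -> (forall x, inD x -> Cmod (w x) <= s) -> inD a ->
  Cmod (C_derive w a) * (1 - Cmod a * Cmod a) <= 1 - Cmod (w a) * Cmod (w a).
Proof.
intros Hw Hs Hws Ha. unfold inD in Ha. assert (Ha0 := Cmod_ge_0 a).
assert (Hwa := Hws a Ha). assert (Hwa0 := Cmod_ge_0 (w a)).
assert (Hden : forall x, inD x -> (1 - Cconj (w a) * w x)%C <> 0%C).
{ intros x Hx. apply one_sub_conj_neq_0. lra. specialize (Hws x Hx). lra. }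
set (G := fun x => (dslope w a x * (1 + - Cconj a * x) * / (1 + - Cconj (w a) * w x))%C).
assert (HG : analytic G).
{ unfold G. apply analytic_mult; [apply analytic_mult | apply analytic_inv].
  - now apply analytic_dslope.
  - apply (analytic_plus (fun _ => 1%C)). apply analytic_const.
    apply (analytic_mult (fun _ => - Cconj a)%C). apply analytic_const. apply analytic_id.
  - apply (analytic_plus (fun _ => 1%C)). apply analytic_const.
    apply (analytic_mult (fun _ => - Cconj (w a))%C w). apply analytic_const. exact Hw.
  - intros x Hx E. apply (Hden x Hx). rewrite <- E. ring. }
assert (HGa : Cmod (G a) <= 1).
{ apply le_epsilon. intros e He.
  set (d := (1 - Cmod a) / 2). assert (Hd : 0 < d) by (unfold d; lra).
  assert (Hd2 : 0 < d * d) by nra.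
  (* The first entry gives |x - a| >= d on |x| = r. The second gives |1 - conj a x|^2 <= |x - a|^2 +
     2 (1 - r) <= |x - a|^2 + d^2 e, which is at most |x - a|^2 (1 + e). *)
  set (r := Rmax ((1 + Cmod a) / 2) (1 - d * d * e / 2)).
  assert (Q : 0 < d * d * e) by nra.
  assert (R1 := Rmax_l ((1 + Cmod a) / 2) (1 - d * d * e / 2)).
  assert (R2 := Rmax_r ((1 + Cmod a) / 2) (1 - d * d * e / 2)). fold r in R1, R2.
  assert (Hr : r < 1) by (apply Rmax_lub_lt; lra).
  apply (maximum_principle G r); [exact HG | exact Hr | lra | ].
  intros x Hx.
  assert (Hxa : d <= Cmod (x - a)).
  { assert (X := Cmod_le_add x a). unfold d. lra. }
  assert (Dx : inD x) by (unfold inD; lra).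
  unfold G.
  replace (1 + - Cconj a * x)%C with (1 - Cconj a * x)%C by ring.
  replace (1 + - Cconj (w a) * w x)%C with (1 - Cconj (w a) * w x)%C by ring.
  rewrite !Cmod_mult, Cmod_inv by now apply Hden.
  assert (E' : Cmod (w x - w a) = Cmod (x - a) * Cmod (dslope w a x)).
  { rewrite <- Cmod_mult. f_equal. rewrite (dslope_eq w a x) at 1. ring. }
  assert (B := blaschke_le (w a) (w x) ltac:(lra) ltac:(specialize (Hws x Dx); lra)).
  rewrite E' in B.
  assert (P : 0 < Cmod (1 - Cconj (w a) * w x)) by (apply Cmod_gt_0, Hden, Dx).
  set (N := Cmod (1 - Cconj (w a) * w x)) in *.
  assert (S := Cmod_sq_mult_conj a x). rewrite Hx in S.
  set (A := Cmod (1 - Cconj a * x)) in *.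
  set (b := Cmod (x - a)) in *.
  set (D := Cmod (dslope w a x)) in *.
  assert (HA0 : 0 <= A) by apply Cmod_ge_0.
  assert (HD0 : 0 <= D) by apply Cmod_ge_0.
  assert (HA : A <= b * (1 + e)).
  { assert (U1 : 0 <= 1 - Cmod a * Cmod a <= 1) by nra.
    assert (U2 : 0 <= 1 - r * r <= 2 * (1 - r)) by nra.
    assert ((1 - Cmod a * Cmod a) * (1 - r * r) <= 2 * (1 - r)) by nra.
    assert (2 * (1 - r) <= d * d * e) by lra.
    assert (d * d <= b * b) by nra.
    assert (A * A <= b * b * (1 + e)) by nra.
    assert (b * b * (1 + e) <= (b * (1 + e)) * (b * (1 + e))) by nra.
    assert (0 <= b * (1 + e)) by nra. nra. }
  apply Rmult_le_reg_r with (1 := P).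
  rewrite Rmult_assoc, Rinv_l by lra.
  apply Rle_trans with (D * (b * (1 + e))).
  - rewrite Rmult_1_r. now apply Rmult_le_compat_l.
  - nra. }
unfold G in HGa. rewrite dslope_diag in HGa.
replace (1 + - Cconj a * a)%C with (RtoC (1 - Cmod a * Cmod a)) in HGa.
2: { rewrite Cmod_sq. destruct a as [x y]. unfold RtoC, Cplus, Cmult, Copp, Cconj; simpl.
     f_equal; ring. }
replace (1 + - Cconj (w a) * w a)%C with (RtoC (1 - Cmod (w a) * Cmod (w a))) in HGa.
2: { rewrite Cmod_sq. destruct (w a) as [x y].
     unfold RtoC, Cplus, Cmult, Copp, Cconj; simpl. f_equal; ring. }
assert (P : 0 < 1 - Cmod (w a) * Cmod (w a)) by nra.
rewrite !Cmod_mult, Cmod_inv, !Cmod_R, !Rabs_pos_eq in HGa; try nra.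
- apply Rmult_le_compat_r with (r := 1 - Cmod (w a) * Cmod (w a)) in HGa; [ | lra].
  rewrite Rmult_assoc, Rinv_l in HGa by lra. lra.
- intros E. apply RtoC_inj in E. lra.
Qed.

Theorem schwarz_pick (w : C -> C) (a : C) :
  analytic w -> (forall x, inD x -> Cmod (w x) <= 1) -> inD a ->
  Cmod (C_derive w a) * (1 - Cmod a * Cmod a) <= 1 - Cmod (w a) * Cmod (w a).
Proof.
intros Hw H1 Ha. apply Rnot_lt_le. intros L.
set (X := Cmod (C_derive w a) * (1 - Cmod a * Cmod a)) in *.
set (Y := Cmod (w a) * Cmod (w a)) in *.
assert (HY : 0 <= Y) by (unfold Y; assert (Q := Cmod_ge_0 (w a)); nra).
assert (HX : 0 <= X).
{ unfold X, inD in *. assert (Q := Cmod_ge_0 a).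
  apply Rmult_le_pos. apply Cmod_ge_0. nra. }
assert (S : forall s, 0 <= s < 1 -> s * X <= 1 - s * s * Y).
{ intros s Hs.
  assert (P := schwarz_pick_strict (fun x => s * w x)%C a s).
  assert (E : C_derive (fun x => s * w x)%C a = (s * C_derive w a)%C)
    by (apply cder_C_derive, cder_scal, analytic_cder; auto).
  rewrite E, !Cmod_mult, Cmod_R, Rabs_pos_eq in P by lra.
  unfold X, Y. replace (s * (Cmod (C_derive w a) * (1 - Cmod a * Cmod a)))
    with (s * Cmod (C_derive w a) * (1 - Cmod a * Cmod a)) by ring.
  replace (s * s * (Cmod (w a) * Cmod (w a))) with (s * Cmod (w a) * (s * Cmod (w a))) by ring.
  apply P; auto; try lra.
  - apply (analytic_mult (fun _ => RtoC s)). apply analytic_const. exact Hw.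
  - intros x Hx. rewrite Cmod_mult, Cmod_R, Rabs_pos_eq by lra.
    specialize (H1 x Hx). nra. }
assert (HXY : 0 < X + Y) by lra.
set (k := X - (1 - Y)). assert (Hk : 0 < k) by (unfold k; lra).
(* The strict version is applied to s w and s would tend to 1. At s = 1 - t it reads k <= t (X + 2
   Y) - t^2 Y, which already fails for this t. *)
set (t := Rmin 1 (k / (2 * (X + 2 * Y + 1)))).
assert (Q : 0 < k / (2 * (X + 2 * Y + 1))) by (apply Rdiv_lt_0_compat; lra).
assert (T0 : 0 < t) by (apply Rmin_glb_lt; lra).
assert (T1 := Rmin_l 1 (k / (2 * (X + 2 * Y + 1)))). fold t in T1.
assert (T2 := Rmin_r 1 (k / (2 * (X + 2 * Y + 1)))). fold t in T2.
apply Rle_div_r in T2; [ | lra].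
assert (S' := S (1 - t) ltac:(lra)). unfold k in T2. nra.
Qed.

(** * The nephroid *)

Lemma inD_0 : inD 0.
Proof. unfold inD. rewrite Cmod_0. lra. Qed.

Lemma nephroid_0 : nephroid 0 = 1%C.
Proof. unfold nephroid. field. Qed.

Definition nslope (a b : C) : C := (1 - (a * a + a * b + b * b) / 3)%C.

Lemma nephroid_minus (a b : C) : (nephroid a - nephroid b = (a - b) * nslope a b)%C.
Proof. unfold nephroid, nslope. field. Qed.

Lemma nslope_lower (a b : C) :
  1 - (Cmod a * Cmod a + Cmod a * Cmod b + Cmod b * Cmod b) / 3 <= Cmod (nslope a b).
Proof.
assert (H := Cmod_le_add 1 (nslope a b)). rewrite Cmod_1 in H.
replace (1 - nslope a b)%C with ((a * a + a * b + b * b) / RtoC 3)%C in H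
  by (unfold nslope; ring).
assert (H3 : RtoC 3 <> 0%C) by (intros E; apply RtoC_inj in E; lra).
rewrite Cmod_div, Cmod_R, (Rabs_pos_eq 3) in H by (lra || exact H3).
assert (T1 := Cmod_triangle (a * a + a * b) (b * b)).
assert (T2 := Cmod_triangle (a * a) (a * b)).
rewrite (Cmod_mult b b) in T1. rewrite !Cmod_mult in T2. lra.
Qed.

Lemma nslope_pos (a b : C) : Cmod a <= 1 -> Cmod b < 1 -> 0 < Cmod (nslope a b).
Proof.
intros Ha Hb. apply Rlt_le_trans with (2 := nslope_lower a b).
assert (H1 := Cmod_ge_0 a). assert (H2 := Cmod_ge_0 b). nra.
Qed.

(** The second factor of N a - N b cannot vanish, because |a^2 + a b + b^2| < 3. One point may lie
    on the unit circle, so that [third_not_nephroid] can use the cusp parameter -1. *)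
Lemma nephroid_inj (a b : C) :
  Cmod a <= 1 -> Cmod b < 1 -> nephroid a = nephroid b -> a = b.
Proof.
intros Ha Hb E. assert (P := nslope_pos a b Ha Hb). apply Cmod_lt_neq_0 in P.
assert (M := nephroid_minus a b). rewrite E in M.
apply Ceq_minus. replace (a - b)%C with ((a - b) * nslope a b / nslope a b)%C by now field.
rewrite <- M. field. exact P.
Qed.

Lemma third_not_nephroid (w : C) : inD w -> nephroid w <> RtoC (1 / 3).
Proof.
intros Hw E. assert (N : nephroid (- (1)) = RtoC (1 / 3)).
{ unfold nephroid. rewrite RtoC_div by lra. field. }
rewrite <- E in N. apply nephroid_inj in N; [ | rewrite Cmod_m1; lra | exact Hw].
unfold inD in Hw. rewrite <- N, Cmod_m1 in Hw. lra.
Qed.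

(* The inverse of the nephroid map is Lipschitz because
   N(a) - N(b) = (a - b) (1 - (a^2 + ab + b^2) / 3); this makes it analytic
   without an inverse function theorem. *)
Lemma subordinate_nephroid (q : C -> C) :
  analytic q -> q 0%C = 1%C ->
  (forall z, inD z -> exists w, inD w /\ q z = nephroid w) -> subordinate q nephroid.
Proof.
intros Hq H0 H.
destruct (functional_choice (fun z w => inD z -> inD w /\ q z = nephroid w)) as [w Hw].
{ intros z. destruct (Rlt_dec (Cmod z) 1) as [L | L].
  - destruct (H z L) as [v Hv]. now exists v.
  - exists 0%C. intros Hz. elim L. exact Hz. }
exists w. assert (Hd := inD_0).
assert (HwD : forall z, inD z -> inD (w z)) by (intros z Hz; now apply Hw).
assert (HwE : forall z, inD z -> q z = nephroid (w z)) by (intros z Hz; now apply Hw).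
split; [ | split; [exact HwD | split; [ | exact HwE]]].
- apply cder_analytic with (fun z => C_derive q z / nslope (w z) (w z))%C.
  intros z Hz.
  assert (Hs : forall x, inD x -> nslope (w x) (w z) <> 0%C).
  { intros x Hx. apply Cmod_lt_neq_0. apply nslope_pos.
    apply Rlt_le. now apply HwD. now apply HwD. }
  assert (HE : forall x, inD x -> (w x - w z = (q x - q z) / nslope (w x) (w z))%C).
  { intros x Hx. rewrite (HwE x Hx), (HwE z Hz), nephroid_minus. field. now apply Hs. }
  (* A lower bound for [nslope (w x) (w z)] that is uniform in x, from |w x| < 1; it makes w
     continuous at z before anything else is known about w. *)
  set (c := 1 - (1 + Cmod (w z) + Cmod (w z) * Cmod (w z)) / 3).
  assert (Hwz := HwD z Hz). unfold inD in Hwz. assert (Hwz0 := Cmod_ge_0 (w z)).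
  assert (Hc : 0 < c) by (unfold c; nra).
  assert (Hl : forall x, inD x -> c <= Cmod (nslope (w x) (w z))).
  { intros x Hx. apply Rle_trans with (2 := nslope_lower (w x) (w z)).
    assert (X := HwD x Hx). unfold inD in X. assert (Y := Cmod_ge_0 (w x)).
    unfold c. nra. }
  assert (Cq := analytic_cont q z Hq Hz).
  assert (Cw : continuous w z).
  { apply cont_Cmod_iff. intros e He.
    assert (Q := proj1 (cont_Cmod_iff q z) Cq (e * c) ltac:(nra)).
    generalize (filter_and _ _ Q (inD_locally z Hz)). apply filter_imp.
    intros x [Q1 Hx]. rewrite HE by exact Hx.
    rewrite Cmod_div by now apply Hs.
    specialize (Hl x Hx).
    apply Rlt_div_l. lra. apply Rlt_le_trans with (1 := Q1).
    apply Rmult_le_compat_l; lra. }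
  destruct (analytic_cder q z Hq Hz) as [phi [Cphi [<- Ephi]]].
  exists (fun x => phi x / nslope (w x) (w z))%C. repeat split.
  + apply cont_Cdiv; [exact Cphi | | now apply Hs].
    unfold nslope. apply cont_Cminus. apply continuous_const.
    unfold Cdiv. apply cont_Cmult; [ | apply continuous_const].
    apply cont_Cplus; [apply cont_Cplus | ]; apply cont_Cmult;
      first [exact Cw | apply continuous_const].
  + generalize (filter_and _ _ Ephi (inD_locally z Hz)). apply filter_imp.
    intros x [E Hx]. assert (HEx := HE x Hx). rewrite E in HEx.
    transitivity (w z + (w x - w z))%C; [cring | ]. rewrite HEx.
    to_C. field. now apply Hs.
- symmetry. apply nephroid_inj. rewrite Cmod_0; lra. now apply HwD.
  rewrite <- HwE by exact Hd. now rewrite nephroid_0.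
Qed.

(** The cubic is the triple-angle formula of sin for e = -1 and of sinh for e = 1, so s is the sine
    or hyperbolic sine of a third of the angle. *)
Lemma ivt_cubic (e y L : R) :
  0 < L -> Rabs y <= 3 * L + 4 * e * (L * (L * L)) ->
  exists s, Rabs s <= L /\ 3 * s + 4 * e * (s * (s * s)) = y.
Proof.
intros HL Hy. apply Rabs_le_between in Hy.
destruct (IVT_gen (fun s => 3 * s + 4 * e * (s * (s * s))) (- L) L y) as [s [Hs E]].
- intros x. apply continuity_pt_filterlim.
  apply (ex_derive_continuous (fun s => 3 * s + 4 * e * (s * (s * s))) x).
  auto_derive. auto.
- rewrite Rmin_left, Rmax_right by nra. split; nra.
- exists s. split; [ | exact E]. rewrite Rmin_left, Rmax_right in Hs by lra.
  apply Rabs_le_between. exact Hs.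
Qed.

(* Elliptic coordinates: (a, b) = (sin X cosh Y, cos X sinh Y), with
   k = sinh^2 Y the nonnegative root of k^2 + (1 - a^2 - b^2) k = b^2. *)
Lemma elliptic_coordinates (a b : R) :
  a * a < 1 -> exists S Y : R, S * S < 1 /\
    a = S * sqrt (1 + Y * Y) /\ b = sqrt (1 - S * S) * Y.
Proof.
intros Ha.
set (m := 1 - a * a - b * b).
set (D := sqrt (m * m + 4 * (b * b))).
assert (HD : D * D = m * m + 4 * (b * b)) by (apply sqrt_sqrt; nra).
assert (HD0 : 0 <= D) by apply sqrt_pos.
set (k := (D - m) / 2).
assert (Hk : k * k + m * k = b * b) by (unfold k; nra).
assert (Hk0 : 0 <= k) by (unfold k; nra).
assert (R1 : 0 < sqrt (1 + k)) by (apply sqrt_lt_R0; lra).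
assert (R2 : sqrt (1 + k) * sqrt (1 + k) = 1 + k) by (apply sqrt_sqrt; lra).
set (S := a / sqrt (1 + k)).
assert (HS : S * S = a * a / (1 + k)).
{ transitivity (a * a / (sqrt (1 + k) * sqrt (1 + k))).
  unfold S. field. lra. now rewrite R2. }
assert (HS1 : S * S < 1) by (rewrite HS; apply Rlt_div_l; lra).
assert (R3 : 0 < sqrt (1 - S * S)) by (apply sqrt_lt_R0; lra).
assert (R4 : sqrt (1 - S * S) * sqrt (1 - S * S) = 1 - S * S) by (apply sqrt_sqrt; lra).
exists S, (b / sqrt (1 - S * S)).
assert (HY : b / sqrt (1 - S * S) * (b / sqrt (1 - S * S)) = k).
{ transitivity (b * b / (sqrt (1 - S * S) * sqrt (1 - S * S))).
  field. lra. rewrite R4.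
  rewrite <- Hk. apply Rmult_eq_reg_r with (1 - S * S); [ | lra].
  unfold Rdiv at 1. rewrite Rmult_assoc, Rinv_l by lra.
  rewrite HS. unfold m in Hk |- *.
  field_simplify_eq; [ | lra]. nra. }
rewrite HY. repeat split.
- exact HS1.
- unfold S. field. lra.
- field. lra.
Qed.

(* With w = 2 sin B one has w - w^3/3 = (2/3) sin 3B; the points S, Y below are
   sin and sinh of the real and imaginary parts of 3B, and s, t those of B. *)
Lemma nephroid_covers (a b : R) :
  Rabs a < 2 / 3 -> Rabs b <= 1 ->
  exists w, inD w /\ nephroid w = (1 + (a, b))%C.
Proof.
intros Ha Hb.
assert (Ha2 : (3 / 2 * a) * (3 / 2 * a) < 1).
{ apply Rabs_lt_between in Ha. nra. }
assert (Hb2 : (3 / 2 * b) * (3 / 2 * b) <= 9 / 4).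
{ apply Rabs_le_between in Hb. nra. }
destruct (elliptic_coordinates (3 / 2 * a) (3 / 2 * b) Ha2) as [S [Y [HS [Ea Eb]]]].
(* A third of an angle in [-pi/2, pi/2] has sine in [-1/2, 1/2], and 3 s - 4 s^3 takes the values -1
   and 1 at the ends. *)
destruct (ivt_cubic (-1) S (1 / 2)) as [s [Hs Es]]. lra.
{ apply Rabs_le_between. nra. }
destruct (ivt_cubic 1 Y (1 + Rabs Y)) as [t [_ Et]].
{ assert (X := Rabs_pos Y). lra. }
{ assert (X := Rabs_pos Y). assert (0 <= (1 + Rabs Y) * ((1 + Rabs Y) * (1 + Rabs Y))).
  { repeat apply Rmult_le_pos; lra. } lra. }
apply Rabs_le_between in Hs.
assert (Hs2 : s * s <= 1 / 4) by nra.
set (P := sqrt (1 + t * t)). set (Q := sqrt (1 - s * s)).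
assert (HP : P * P = 1 + t * t) by (apply sqrt_sqrt; nra).
assert (HQ : Q * Q = 1 - s * s) by (apply sqrt_sqrt; nra).
assert (HP0 : 0 <= P) by apply sqrt_pos. assert (HQ0 : 0 <= Q) by apply sqrt_pos.
(* This is cosh 3y = cosh y (1 + 4 sinh^2 y); the identity after it is cos 3x = cos x (1 - 4 sin^2
   x), where |s| <= 1/2 fixes the sign. *)
assert (EP : sqrt (1 + Y * Y) = P * (1 + 4 * (t * t))).
{ apply sqrt_lem_1. nra. apply Rmult_le_pos; [exact HP0 | nra].
  replace (P * (1 + 4 * (t * t)) * (P * (1 + 4 * (t * t))))
    with (P * P * ((1 + 4 * (t * t)) * (1 + 4 * (t * t)))) by ring.
  rewrite HP, <- Et. ring. }
assert (EQ : sqrt (1 - S * S) = Q * (1 - 4 * (s * s))).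
{ apply sqrt_lem_1. nra. apply Rmult_le_pos; [exact HQ0 | nra].
  replace (Q * (1 - 4 * (s * s)) * (Q * (1 - 4 * (s * s))))
    with (Q * Q * ((1 - 4 * (s * s)) * (1 - 4 * (s * s)))) by ring.
  rewrite HQ, <- Es. ring. }
rewrite EP in Ea. rewrite EQ in Eb.
exists ((2 * (s * P), 2 * (t * Q)) : C). split.
(* The left side is |w|^2, since |sin (x + iy)|^2 = sin^2 x + sinh^2 y. *)
- assert (Hlt : 4 * (s * s + t * t) < 1).
  { destruct (Rlt_dec (4 * (s * s + t * t)) 1) as [L | L]; [exact L | exfalso].
    set (x := s * s) in *. set (y := t * t) in *.
    assert (Hx0 : 0 <= x) by (unfold x; nra).
    (* Keeping s and lowering y to 1/4 - x moves w onto the unit circle, and c is then cos^2 of its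
       argument. At that boundary point the squares of 3a/2 and 3b/2 are c (3 - 2c)^2 and 4 (1 -
       c)^3. Both squares increase with y, so these values are lower bounds. *)
    set (c := 4 * x * (5 / 4 - x)).
    assert (Hy : 1 / 4 - x <= y) by lra.
    assert (A2 : 3 / 2 * a * (3 / 2 * a) =
      x * ((3 - 4 * x) * (3 - 4 * x)) * ((1 + y) * ((1 + 4 * y) * (1 + 4 * y)))).
    { rewrite Ea, <- Es, <- HP. unfold x. ring. }
    assert (B2 : 3 / 2 * b * (3 / 2 * b) =
      (1 - x) * ((1 - 4 * x) * (1 - 4 * x)) * (y * ((3 + 4 * y) * (3 + 4 * y)))).
    { rewrite Eb, <- Et, <- HQ. unfold x, y. ring. }
    assert (A3 : c * ((3 - 2 * c) * (3 - 2 * c)) <= 3 / 2 * a * (3 / 2 * a)).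
    { rewrite A2.
      replace (c * ((3 - 2 * c) * (3 - 2 * c))) with
        (x * ((3 - 4 * x) * (3 - 4 * x)) *
         ((1 + (1 / 4 - x)) * ((1 + 4 * (1 / 4 - x)) * (1 + 4 * (1 / 4 - x)))))
        by (unfold c; field).
      apply Rmult_le_compat_l. nra.
      apply Rmult_le_compat; nra. }
    assert (B3 : 4 * ((1 - c) * ((1 - c) * (1 - c))) <= 3 / 2 * b * (3 / 2 * b)).
    { rewrite B2.
      replace (4 * ((1 - c) * ((1 - c) * (1 - c)))) with
        ((1 - x) * ((1 - 4 * x) * (1 - 4 * x)) *
         ((1 / 4 - x) * ((3 + 4 * (1 / 4 - x)) * (3 + 4 * (1 / 4 - x)))))
        by (unfold c; field).
      apply Rmult_le_compat_l. apply Rmult_le_pos; [lra | apply Rle_0_sqr].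
      apply Rmult_le_compat; nra. }
    assert (Hc : 0 <= c <= 1) by (unfold c; nra).
    (* For c <= 1/6 the bound 4 (1 - c)^3 exceeds 9/4. For c in [1/6, 1] one has c (3 - 2c)^2 - 1 =
       (1 - c)(-(4c^2 - 8c + 1)) >= 0. Any threshold between 1 - sqrt 3 / 2, about 0.134, and 0.174
       would serve. *)
    destruct (Rle_dec c (1 / 6)) as [C6 | C6].
    - assert (125 / 216 <= (1 - c) * ((1 - c) * (1 - c))).
      { assert (25 / 36 <= (1 - c) * (1 - c)) by nra. nra. }
      lra.
    - assert (1 <= c * ((3 - 2 * c) * (3 - 2 * c))).
      { assert (0 <= (c - 1 / 6) * (1 - c)) by (apply Rmult_le_pos; lra).
        assert (0 <= (1 - c) * (- (4 * c * c - 8 * c + 1))) by (apply Rmult_le_pos; nra).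
        nra. }
      lra. }
  unfold inD. assert (M := Cmod_sq (2 * (s * P), 2 * (t * Q))).
  simpl in M. assert (M0 := Cmod_ge_0 (2 * (s * P), 2 * (t * Q))).
  replace (2 * (s * P) * (2 * (s * P)) + 2 * (t * Q) * (2 * (t * Q)))
    with (4 * (s * s * (P * P) + t * t * (Q * Q))) in M by ring.
  rewrite HP, HQ in M. nra.
- set (w := (2 * (s * P), 2 * (t * Q)) : C).
  assert (E : (w - w * w * w / 3)%C = (a, b)).
  { assert (a = 2 / 3 * (S * (P * (1 + 4 * (t * t))))) as -> by lra.
    assert (b = 2 / 3 * (Q * (1 - 4 * (s * s)) * Y)) as -> by lra.
    replace (w * w * w / 3)%C with (RtoC (/ 3) * (w * w * w))%C
      by (rewrite RtoC_inv by lra; field).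
    rewrite <- Es, <- Et. unfold w, Cminus, Cplus, Copp, Cmult, RtoC; simpl. f_equal.
    - field_simplify.
      replace (P ^ 3) with (P * (P * P)) by ring. replace (Q ^ 2) with (Q * Q) by ring.
      rewrite HP, HQ. field.
    - field_simplify.
      replace (Q ^ 3) with (Q * (Q * Q)) by ring. replace (P ^ 2) with (P * P) by ring.
      rewrite HP, HQ. field. }
  rewrite <- E. unfold nephroid. field.
Qed.

(** * Logarithmic derivatives of the superordinate functions *)

Lemma Csqrt_sq (z : C) : (Csqrt z * Csqrt z)%C = z.
Proof. apply Csqrt_principal. Qed.

Lemma Csqrt_Re_pos (z : C) : 0 < Re z -> 0 < Re (Csqrt z).
Proof.
intros Hz. destruct (Csqrt_principal z) as [E [H | [H _]]]; [exact H | ].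
assert (E' := f_equal Re E). rewrite re_mult, H in E'. nra.
Qed.

Lemma Csqrt_1 : Csqrt 1 = 1%C.
Proof.
assert (H := Csqrt_Re_pos 1 ltac:(simpl; lra)). assert (E := Csqrt_sq 1).
assert (F : ((Csqrt 1 - 1) * (Csqrt 1 + 1))%C = 0%C).
{ replace ((Csqrt 1 - 1) * (Csqrt 1 + 1))%C with (Csqrt 1 * Csqrt 1 - 1)%C by ring.
  rewrite E. ring. }
assert (N : (Csqrt 1 + 1)%C <> 0%C).
{ intros Z. apply (f_equal Re) in Z. rewrite re_plus, !re_RtoC in Z. lra. }
apply Ceq_minus.
replace (Csqrt 1 - 1)%C with ((Csqrt 1 - 1) * (Csqrt 1 + 1) / (Csqrt 1 + 1))%C
  by now field.
rewrite F. now field.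
Qed.

Lemma Re_pos_neq_0 (z : C) : 0 < Re z -> z <> 0%C.
Proof. intros H E. rewrite E in H. simpl in H. lra. Qed.

(** Factoring x - z as a difference of squares gives the slope 1 / (Csqrt x + Csqrt z), whose
    denominator has positive real part. The right half-plane is enough, since only 1 + z and 1 + z^2
    with |z| < 1 occur under the root. *)
Lemma Csqrt_cder (z : C) : 0 < Re z -> cder Csqrt z (/ (2 * Csqrt z))%C.
Proof.
intros Hz.
assert (HS := Csqrt_Re_pos z Hz).
assert (Loc : locally z (fun x => 0 < Re x)).
{ apply locally_Cmod. exists (Re z). split; [exact Hz | ]. intros x Hx.
  assert (B := re_le_Cmod (x - z)). apply Rabs_le_between in B.
  change (Re (x - z)) with (Re x - Re z) in B. lra. }
assert (Hsum : forall x, 0 < Re x -> (Csqrt x + Csqrt z)%C <> 0%C).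
{ intros x Hx. apply Re_pos_neq_0. rewrite re_plus. assert (X := Csqrt_Re_pos x Hx). lra. }
assert (E : forall x, 0 < Re x ->
  Csqrt x = (Csqrt z + (x - z) * / (Csqrt x + Csqrt z))%C).
{ intros x Hx.
  replace (x - z)%C with ((Csqrt x - Csqrt z) * (Csqrt x + Csqrt z))%C.
  - field. now apply Hsum.
  - transitivity (Csqrt x * Csqrt x - Csqrt z * Csqrt z)%C. ring. now rewrite !Csqrt_sq. }
assert (Cs : continuous Csqrt z).
{ apply cont_Cmod_iff. intros e He.
  assert (L : locally z (fun x => Cmod (x - z) < e * Re (Csqrt z))).
  { apply locally_Cmod. exists (e * Re (Csqrt z)). split; [nra | tauto]. }
  generalize (filter_and _ _ Loc L). apply filter_imp. intros x [Hx Hx2].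
  replace (Csqrt x - Csqrt z)%C with ((x - z) * / (Csqrt x + Csqrt z))%C
    by (rewrite (E x Hx) at 2; ring).
  rewrite Cmod_mult, Cmod_inv by now apply Hsum.
  assert (B : Re (Csqrt z) <= Cmod (Csqrt x + Csqrt z)).
  { apply Rle_trans with (Re (Csqrt x + Csqrt z)).
    - rewrite re_plus. assert (X := Csqrt_Re_pos x Hx). lra.
    - apply Rle_trans with (2 := re_le_Cmod _). apply Rle_abs. }
  change (Cmod (x - z) / Cmod (Csqrt x + Csqrt z) < e).
  apply Rlt_div_l. lra. apply Rlt_le_trans with (1 := Hx2).
  apply Rmult_le_compat_l; lra. }
exists (fun x => / (Csqrt x + Csqrt z))%C. split; [ | split].
- apply cont_Cinv; [ | now apply Hsum]. apply cont_Cplus. exact Cs. apply continuous_const.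
- f_equal. ring.
- revert Loc. apply filter_imp. exact E.
Qed.

Lemma Cexp_0 : Cexp 0 = 1%C.
Proof.
unfold Cexp. simpl. rewrite exp_0, cos_0, sin_0.
unfold Cmult, RtoC; simpl. f_equal; ring.
Qed.

Lemma Cexp_neq_0 (z : C) : Cexp z <> 0%C.
Proof.
apply Cmult_neq_0.
- intros E. apply RtoC_inj in E. assert (X := exp_pos (Re z)). lra.
- intros E. injection E. intros E1 E2. assert (X := sin2_cos2 (Im z)).
  rewrite E1, E2 in X. unfold Rsqr in X. lra.
Qed.

Lemma Cexp_rder (a b : C) (t : R) :
  rder (fun s => Cexp (a + RtoC s * b)) t (b * Cexp (a + RtoC t * b))%C.
Proof.
destruct a as [p q]; destruct b as [x y].
set (u := fun s => exp (p + s * x) * cos (q + s * y)).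
set (v := fun s => exp (p + s * x) * sin (q + s * y)).
assert (E : forall s, Cexp ((p, q) + RtoC s * (x, y)) = (u s, v s)).
{ intros s. unfold Cexp, u, v. simpl.
  replace (p + (s * x - 0 * y)) with (p + s * x) by ring.
  replace (q + (s * y + 0 * x)) with (q + s * y) by ring.
  unfold Cmult, RtoC; simpl. f_equal; ring. }
assert (D : rder (fun s => (u s, v s)) t ((x, y) * (u t, v t))%C).
{ unfold Cmult; simpl. apply rder_pair; unfold u, v; auto_derive; auto; ring. }
rewrite E. destruct D as [phi [Hc [Hl H]]]. exists phi. split; [exact Hc | ].
split; [exact Hl | ]. revert H. apply filter_imp. intros s Hs. now rewrite !E.
Qed.

Lemma Cexp_cont (z : C) : continuous Cexp z.
Proof.
unfold Cexp. apply cont_Cmult.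
- apply cont_RtoC. apply (continuous_comp Re exp). apply continuous_fst.
  apply (ex_derive_continuous exp). auto_derive. auto.
- apply cont_pair.
  + apply (continuous_comp Im cos). apply continuous_snd.
    apply (ex_derive_continuous cos). auto_derive. auto.
  + apply (continuous_comp Im sin). apply continuous_snd.
    apply (ex_derive_continuous sin). auto_derive. auto.
Qed.

(** Real derivatives along lines show that increments of [Cexp] are its own integrals over segments;
    with continuity this yields the complex derivative, without the Cauchy-Riemann equations. *)
Lemma Cexp_cder (z : C) : cder Cexp z (Cexp z).
Proof.
apply cder_of_seg.
- apply filter_forall. intros x. apply Cexp_cont.
- apply filter_forall. intros x.
  assert (Cs : cont_on (fun t => Cexp (z + RtoC t * (x - z))%C) 0 1).
  { apply seg_cont_on. intros t _. apply Cexp_cont. }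
  unfold seg. rewrite <- CInt_mult by (lra || exact Cs).
  rewrite (CInt_FTC (fun t => Cexp (z + RtoC t * (x - z))%C)).
  + replace (z + RtoC 1 * (x - z))%C with (x : C) by cring.
    replace (z + RtoC 0 * (x - z))%C with z by cring. cring.
  + lra.
  + intros t _. apply Cexp_rder.
  + intros t Ht. apply cont_Cmult. apply continuous_const. now apply Cs.
Qed.

Definition log_deriv (Phi L : C -> C) : Prop :=
  Phi 0%C = 1%C /\ analytic L /\
  forall z, inD z -> Phi z <> 0%C /\ cder Phi z (Phi z * L z)%C.

Lemma log_deriv_Cexp : log_deriv Cexp (fun _ => 1%C).
Proof.
split; [apply Cexp_0 | split; [apply analytic_const | ]]. intros z _.
split. apply Cexp_neq_0. rewrite Cmult_1_r. apply Cexp_cder.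
Qed.

Lemma Re_one_plus_pos (z : C) : inD z -> 0 < Re (1 + z).
Proof.
unfold inD. intros Hz. assert (B := re_le_Cmod z). apply Rabs_le_between in B.
rewrite re_plus, re_RtoC. lra.
Qed.

Lemma inD_sq (z : C) : inD z -> inD (z * z)%C.
Proof.
unfold inD. intros Hz. rewrite Cmod_mult. assert (X := Cmod_ge_0 z). nra.
Qed.

Lemma log_deriv_sqrt1p : log_deriv sqrt1p (fun z => / (2 * (1 + z)))%C.
Proof.
assert (Hn : forall z, inD z -> (1 + z)%C <> 0%C)
  by (intros z Hz; now apply Re_pos_neq_0, Re_one_plus_pos).
split; [ | split].
- unfold sqrt1p. rewrite Cplus_0_r. apply Csqrt_1.
- apply (analytic_inv (fun z => 2 * (1 + z))%C).
  + apply (analytic_mult (fun _ => RtoC 2)). apply analytic_const.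
    apply (analytic_plus (fun _ => 1%C)). apply analytic_const. apply analytic_id.
  + intros z Hz. apply Cmult_neq_0. apply two_neq_0. now apply Hn.
- intros z Hz. assert (P := Re_one_plus_pos z Hz).
  assert (N := Re_pos_neq_0 _ (Csqrt_Re_pos _ P)). unfold sqrt1p. split; [exact N | ].
  replace (Csqrt (1 + z) * / (2 * (1 + z)))%C with (/ (2 * Csqrt (1 + z)) * (0 + 1))%C.
  + apply (cder_comp Csqrt (fun z => 1 + z)%C). now apply Csqrt_cder.
    apply cder_plus. apply cder_const. apply cder_id.
  + rewrite <- (Csqrt_sq (1 + z)) at 3. field. exact N.
Qed.

Lemma log_deriv_crescent : log_deriv crescent (fun z => / Csqrt (1 + z * z))%C.
Proof.
assert (P : forall z, inD z -> 0 < Re (1 + z * z))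
  by (intros z Hz; now apply Re_one_plus_pos, inD_sq).
assert (N : forall z, inD z -> Csqrt (1 + z * z)%C <> 0%C)
  by (intros z Hz; now apply Re_pos_neq_0, Csqrt_Re_pos, P).
assert (D : forall z, inD z ->
  cder (fun z => Csqrt (1 + z * z)) z (/ (2 * Csqrt (1 + z * z)) * (0 + (1 * z + z * 1)))%C).
{ intros z Hz. apply (cder_comp Csqrt (fun z => 1 + z * z)%C).
  - now apply Csqrt_cder, P.
  - apply (cder_plus (fun _ => 1%C) (fun z => z * z)%C). apply cder_const.
    apply (cder_mult (fun z => z) (fun z => z)); apply cder_id. }
split; [ | split].
- unfold crescent. replace (1 + 0 * 0)%C with (1 : C)%C by ring. rewrite Csqrt_1. ring.
- apply (analytic_inv (fun z => Csqrt (1 + z * z))).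
  + eapply cder_analytic. exact D.
  + exact N.
- intros z Hz. split.
  + unfold crescent. intros E.
    (* The crescent function has the reciprocal [Csqrt (1 + z * z) - z] and therefore omits 0. *)
    assert (F : ((z + Csqrt (1 + z * z)) * (Csqrt (1 + z * z) - z))%C = 1%C).
    { transitivity (Csqrt (1 + z * z) * Csqrt (1 + z * z) - z * z)%C. ring.
      rewrite Csqrt_sq. ring. }
    rewrite E, Cmult_0_l in F. symmetry in F. exact (C1_nz F).
  + unfold crescent.
    replace ((z + Csqrt (1 + z * z)) * / Csqrt (1 + z * z))%C
      with (1 + / (2 * Csqrt (1 + z * z)) * (0 + (1 * z + z * 1)))%C
      by (field; now apply N).
    apply (cder_plus (fun z => z)). apply cder_id. now apply D.
Qed.

(** * Starlikeness in terms of values of z f' / f *)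

(** [C_lim] looks only at punctured neighbourhoods of 0, where q agrees with h; continuity of h
    makes the filled value h 0. *)
Lemma fill0_eq (q h : C -> C) :
  (forall z, inD z -> z <> 0%C -> q z = h z) -> continuous h (RtoC 0) ->
  forall z, inD z -> fill0 q z = h z.
Proof.
intros E Hh z Hz. unfold fill0. destruct (Ceq_dec z 0%C) as [-> | n]; [ | now apply E].
apply is_C_lim_unique. intros P HP.
assert (Hh' : locally (RtoC 0) (fun z => P (h z))) by exact (Hh P HP).
assert (G := filter_and _ _ Hh' (inD_locally 0%C Hz)).
change (locally (RtoC 0) (fun z : C => z <> 0%C -> P (q z))).
revert G. apply filter_imp. intros x [Px Dx] nx. rewrite E by assumption. exact Px.
Qed.

(** Here q stands for z f'/f with the singularity at 0 already removed, so that later arguments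
    handle an analytic function instead of a [fill0] expression. *)
Definition star_quotient (f q : C -> C) : Prop :=
  classA f /\ analytic q /\ q 0%C = 1%C /\
  forall z, inD z -> z <> 0%C -> f z <> 0%C /\ (z * C_derive f z / f z)%C = q z.

Lemma inD_dilate (r : R) (z : C) : 0 < r <= 1 -> inD z -> Cmod (RtoC r * z) < r.
Proof.
unfold inD. intros Hr Hz. rewrite Cmod_mult, Cmod_R, Rabs_pos_eq by lra. nra.
Qed.

(** Dilating f to f(rz)/r replaces q by q(rz), and [subordinate_nephroid] reduces the subordination
    to a condition on values. *)
Lemma S_Ne_dilate (f q : C -> C) (r : R) :
  star_quotient f q -> 0 < r <= 1 ->
  S_Ne (fun z => f (RtoC r * z) / RtoC r)%C <->
  forall z, Cmod z < r -> exists w, inD w /\ q z = nephroid w.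
Proof.
intros [[Hf [Hf0 Hf1]] [Hq [Hq0 HE]]] Hr.
assert (Hrn : RtoC r <> 0%C) by (intros E; apply RtoC_inj in E; lra).
assert (HD : forall z, inD z -> inD (RtoC r * z)%C).
{ intros z Hz. assert (X := inD_dilate r z Hr Hz). unfold inD. lra. }
assert (Hd : forall z, inD z ->
  cder (fun z => f (RtoC r * z) / RtoC r)%C z (C_derive f (RtoC r * z))).
{ intros z Hz.
  replace (C_derive f (RtoC r * z)) with
    (((C_derive f (RtoC r * z) * (RtoC r * 1)) * RtoC r - f (RtoC r * z) * 0)
       / (RtoC r * RtoC r))%C by now field.
  apply (cder_div (fun z => f (RtoC r * z)%C) (fun _ => RtoC r)).
  - apply (cder_comp f (fun z => RtoC r * z)%C).
    apply analytic_cder; auto. apply cder_scal. apply cder_id.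
  - apply cder_const.
  - exact Hrn. }
assert (HA : classA (fun z => f (RtoC r * z) / RtoC r)%C).
{ split; [ | split].
  - eapply cder_analytic. exact Hd.
  - rewrite Cmult_0_r, Hf0. now field.
  - apply cder_is_derive.
    rewrite <- (is_C_derive_unique _ _ _ Hf1).
    assert (X := Hd 0%C inD_0). rewrite Cmult_0_r in X. exact X. }
assert (Aq : analytic (fun z => q (RtoC r * z)%C)).
{ apply (analytic_comp q (fun z => RtoC r * z)%C); auto.
  apply (analytic_mult (fun _ => RtoC r)). apply analytic_const. apply analytic_id. }
assert (Fe : forall z, inD z ->
  fill0 (fun z => z * C_derive (fun z => f (RtoC r * z) / RtoC r) z /
    (f (RtoC r * z) / RtoC r))%C z = q (RtoC r * z)%C).
{ apply fill0_eq.
  - intros z Hz nz. rewrite (cder_C_derive _ _ _ (Hd z Hz)).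
    destruct (HE (RtoC r * z)%C (HD z Hz)) as [Hn E].
    now apply Cmult_neq_0. rewrite <- E. field. now split.
  - apply (analytic_cont (fun z => q (RtoC r * z)%C)). exact Aq. exact inD_0. }
split.
- intros [_ [w [_ [HwD [_ Hw]]]]] z Hz.
  assert (Dz : inD (z / RtoC r)%C).
  { unfold inD. rewrite Cmod_div, Cmod_R, Rabs_pos_eq by (lra || exact Hrn).
    apply Rlt_div_l; lra. }
  exists (w (z / RtoC r)%C). split. now apply HwD.
  rewrite <- Hw, Fe by exact Dz. f_equal. now field.
- intros H. split; [exact HA | ].
  destruct (subordinate_nephroid (fun z => q (RtoC r * z)%C)) as [w [W1 [W2 [W3 W4]]]].
  + exact Aq.
  + now rewrite Cmult_0_r.
  + intros z Hz. apply H. now apply inD_dilate.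
  + exists w. split; [exact W1 | split; [exact W2 | split; [exact W3 | ]]].
    intros z Hz. rewrite Fe by exact Hz. now apply W4.
Qed.

Lemma holds_up_to_S_Ne (f q : C -> C) (rho : R) :
  star_quotient f q ->
  holds_up_to S_Ne f rho <->
  0 < rho <= 1 /\ forall z, Cmod z < rho -> exists w, inD w /\ q z = nephroid w.
Proof.
intros H. split.
- intros [Hr K]. split; [exact Hr | ].
  apply (S_Ne_dilate f q rho H Hr). apply K. lra.
- intros [Hr K]. split; [exact Hr | ]. intros r Hr'.
  apply (S_Ne_dilate f q r H). lra. intros z Hz. apply K. lra.
Qed.

(** For each f the supremum m of the admissible radii is itself admissible, because the condition
    concerns open disks: every z with |z| < m lies in the disk of some admissible s. For f0 no
    radius beyond rad is admissible, since the point -rad would lie inside the disk. *)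
Lemma class_radius_S_Ne (M : (C -> C) -> Prop) (rad : R) :
  0 < rad < 1 ->
  (forall f, M f -> exists q, star_quotient f q /\
    forall z, Cmod z < rad -> exists w, inD w /\ q z = nephroid w) ->
  (exists f q, M f /\ star_quotient f q /\ q (- RtoC rad)%C = RtoC (1 / 3)) ->
  is_class_radius S_Ne M rad.
Proof.
intros Hrad Hlow [f0 [q0 [Hf0 [Hq0 Hsharp]]]].
assert (Hold : forall f, M f -> holds_up_to S_Ne f rad).
{ intros f Hf. destruct (Hlow f Hf) as [q [Hq H]].
  apply (holds_up_to_S_Ne f q rad Hq). split; [lra | exact H]. }
split.
- intros f Hf. destruct (Hlow f Hf) as [q [Hq H]].
  destruct (completeness (holds_up_to S_Ne f)) as [m [Hm1 Hm2]].
  + exists 1. intros x [Hx _]. lra.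
  + exists rad. now apply Hold.
  + exists m. split; [ | exact Hm1].
    apply (holds_up_to_S_Ne f q m Hq). split.
    * split.
      -- apply Rlt_le_trans with rad. lra. now apply Hm1, Hold.
      -- apply Hm2. intros x [Hx _]. lra.
    * intros z Hz.
      destruct (classic (exists s, holds_up_to S_Ne f s /\ Cmod z < s))
        as [[s [Hs Hzs]] | N].
      -- apply (holds_up_to_S_Ne f q s Hq) in Hs. now apply Hs.
      -- exfalso. apply (Rlt_not_le _ _ Hz). apply Hm2. intros s Hs.
         apply Rnot_lt_le. intros L. apply N. now exists s.
- split.
  + intros s [f [Hf [_ Hs]]]. simpl. now apply Hs, Hold.
  + intros b Hb. apply Hb. exists f0. split; [exact Hf0 | split].
    * now apply Hold.
    * intros s Hs. apply Rnot_lt_le. intros L.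
      apply (holds_up_to_S_Ne f0 q0 s Hq0) in Hs. destruct Hs as [_ Hs].
      destruct (Hs (- RtoC rad)%C) as [w [Hw E]].
      -- rewrite Cmod_opp, Cmod_R, Rabs_pos_eq; lra.
      -- rewrite Hsharp in E. now apply (third_not_nephroid w Hw).
Qed.

Definition schwarz (w : C -> C) : Prop :=
  analytic w /\ (forall z, inD z -> inD (w z)) /\ w 0%C = 0%C.

Definition product_quotient (L M w1 w2 w3 : C -> C) (z : C) : C :=
  (1 + (z * C_derive w1 z * L (w1 z) + z * C_derive w2 z * L (w2 z)
        + z * C_derive w3 z * M (w3 z)))%C.

Lemma log_deriv_comp (Phi L w : C -> C) (z : C) :
  log_deriv Phi L -> schwarz w -> inD z ->
  Phi (w z) <> 0%C /\
  cder (fun z => Phi (w z)) z (Phi (w z) * (C_derive w z * L (w z)))%C.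
Proof.
intros [_ [_ H]] [Hw [HD _]] Hz. destruct (H (w z) (HD z Hz)) as [Hn Hc].
split; [exact Hn | ].
replace (Phi (w z) * (C_derive w z * L (w z)))%C
  with (Phi (w z) * L (w z) * C_derive w z)%C by ring.
apply cder_comp. exact Hc. now apply analytic_cder.
Qed.

Lemma star_quotient_product (Phi Psi L M f w1 w2 w3 : C -> C) :
  log_deriv Phi L -> log_deriv Psi M ->
  schwarz w1 -> schwarz w2 -> schwarz w3 ->
  (forall z, inD z -> f z = (z * (Phi (w1 z) * Phi (w2 z) * Psi (w3 z)))%C) ->
  star_quotient f (product_quotient L M w1 w2 w3).
Proof.
intros HPhi HPsi H1 H2 H3 E.
set (P := fun z => (Phi (w1 z) * Phi (w2 z) * Psi (w3 z))%C).
set (Q := fun z => (C_derive w1 z * L (w1 z) + C_derive w2 z * L (w2 z)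
  + C_derive w3 z * M (w3 z))%C).
assert (HP : forall z, inD z -> P z <> 0%C /\ cder P z (P z * Q z)%C).
{ intros z Hz.
  destruct (log_deriv_comp Phi L w1 z HPhi H1 Hz) as [N1 D1].
  destruct (log_deriv_comp Phi L w2 z HPhi H2 Hz) as [N2 D2].
  destruct (log_deriv_comp Psi M w3 z HPsi H3 Hz) as [N3 D3].
  split. now repeat apply Cmult_neq_0.
  assert (D := cder_mult _ _ _ _ _ (cder_mult _ _ _ _ _ D1 D2) D3).
  match type of D with cder _ _ ?l => replace (P z * Q z)%C with l end.
  exact D. unfold P, Q. ring. }
assert (Hd : forall z, inD z -> cder f z (P z * (1 + z * Q z))%C).
{ intros z Hz. apply cder_ext_loc with (fun z => z * P z)%C.
  - generalize (inD_locally z Hz). apply filter_imp. intros x Hx. now rewrite E.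
  - replace (P z * (1 + z * Q z))%C with (1 * P z + z * (P z * Q z))%C by ring.
    apply (cder_mult (fun z => z) P). apply cder_id. now apply HP. }
assert (P0 : P 0%C = 1%C).
{ unfold P. destruct H1 as [_ [_ ->]]. destruct H2 as [_ [_ ->]].
  destruct H3 as [_ [_ ->]]. destruct HPhi as [-> _]. destruct HPsi as [-> _]. ring. }
assert (Aterm : forall K w, analytic K -> schwarz w ->
  analytic (fun z => z * C_derive w z * K (w z))%C).
{ intros K w HK [Hw [HD _]].
  apply (analytic_mult (fun z => z * C_derive w z)%C (fun z => K (w z))).
  - apply (analytic_mult (fun z => z)). apply analytic_id. now apply analytic_C_derive.
  - now apply analytic_comp. }
split; [split; [ | split] | split; [ | split]].
- eapply cder_analytic. exact Hd.
- rewrite E by exact inD_0. ring.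
- apply cder_is_derive. assert (D := Hd 0%C inD_0). rewrite P0 in D.
  replace (1 * (1 + 0 * Q 0))%C with (1 : C)%C in D by ring. exact D.
- unfold product_quotient.
  apply (analytic_plus (fun _ => 1%C)). apply analytic_const.
  destruct HPhi as [_ [HL _]]. destruct HPsi as [_ [HM _]].
  apply (analytic_plus (fun z => z * C_derive w1 z * L (w1 z)
    + z * C_derive w2 z * L (w2 z))%C); [apply analytic_plus | ]; now apply Aterm.
- unfold product_quotient. ring.
- intros z Hz nz. destruct (HP z Hz) as [NP _]. rewrite E by exact Hz. fold (P z). split.
  + now apply Cmult_neq_0.
  + rewrite (cder_C_derive _ _ _ (Hd z Hz)). unfold product_quotient, Q. field. now split.
Qed.

(** With the total inverse a quotient by 0 takes the value 0. *)
Lemma Cdiv_neq_0_r (a b : C) : (a / b)%C <> 0%C -> b <> 0%C.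
Proof.
intros H E. apply H. subst b. unfold Cdiv, Cinv, Cmult, RtoC; simpl.
unfold Rdiv. f_equal; ring.
Qed.

Lemma ratio_class_product (Phi Psi L M f : C -> C) :
  log_deriv Phi L -> log_deriv Psi M -> ratio_class Phi Psi f ->
  exists w1 w2 w3, schwarz w1 /\ schwarz w2 /\ schwarz w3 /\
    forall z, inD z -> f z = (z * (Phi (w1 z) * Phi (w2 z) * Psi (w3 z)))%C.
Proof.
intros HPhi HPsi [[_ [Hf0 _]] [g [p [_ [[w3 [A3 [B3 [C3' E3]]]]
  [[w1 [A1 [B1 [C1 E1]]]] [w2 [A2 [B2 [C2 E2]]]]]]]]]].
exists w1, w2, w3. repeat split; auto.
intros z Hz. destruct (Ceq_dec z 0%C) as [-> | nz].
- rewrite Hf0. ring.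
- assert (F1 := E1 z Hz). assert (F2 := E2 z Hz). unfold fill0 in F1, F2.
  destruct (Ceq_dec z 0%C) as [? | _]; [contradiction | ].
  rewrite <- E3 by exact Hz.
  (* Since Phi omits 0, neither quotient vanishes, hence neither do the denominators g z and z * p
     z, and the quotients can be multiplied out. *)
  assert (N1 : Phi (w1 z) <> 0%C) by now apply HPhi, B1.
  assert (N2 : Phi (w2 z) <> 0%C) by now apply HPhi, B2.
  rewrite <- F1 in N1 |- *. rewrite <- F2 in N2 |- *.
  apply Cdiv_neq_0_r in N1. apply Cdiv_neq_0_r in N2.
  field. repeat split; auto. intros E. apply N2. rewrite E. ring.
Qed.

Lemma schwarz_id : schwarz (fun z => z).
Proof. split. apply analytic_id. split; auto. Qed.

Lemma ratio_class_extremal (Phi Psi L M : C -> C) :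
  log_deriv Phi L -> log_deriv Psi M ->
  ratio_class Phi Psi (fun z => z * (Phi z * Phi z * Psi z))%C.
Proof.
intros HPhi HPsi.
assert (Hone : log_deriv (fun _ => 1%C) (fun _ => 0%C)).
{ split; [reflexivity | split; [apply analytic_const | ]]. intros z _. split.
  apply C1_nz. rewrite Cmult_0_r. apply cder_const. }
assert (CPhi : continuous Phi (RtoC 0)).
{ destruct HPhi as [_ [_ H]]. destruct (H 0%C inD_0) as [_ D].
  exact (cder_cont _ _ _ D). }
assert (NPhi : forall z, inD z -> Phi z <> 0%C) by (intros; now apply HPhi).
assert (NPsi : forall z, inD z -> Psi z <> 0%C) by (intros; now apply HPsi).
assert (S := schwarz_id).
assert (Sub : forall q h : C -> C, (forall z, inD z -> q z = h z) -> subordinate q h).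
{ intros q h E. exists (fun z => z). split. apply analytic_id.
  split; [auto | split; [reflexivity | exact E]]. }
split; [ | exists (fun z => z * (Phi z * Psi z))%C, Psi; split; [ | split; [ | split]]].
- apply (star_quotient_product Phi Psi L M _ (fun z => z) (fun z => z) (fun z => z)); auto.
- destruct HPhi as [HPhi0 [HL HPhi]]. destruct HPsi as [HPsi0 [HM HPsi]].
  assert (Hd : forall z, inD z -> cder (fun z => z * (Phi z * Psi z))%C z
    (1 * (Phi z * Psi z) + z * (Phi z * L z * Psi z + Phi z * (Psi z * M z)))%C).
  { intros z Hz. apply (cder_mult (fun z => z) (fun z => Phi z * Psi z)%C).
    apply cder_id. apply cder_mult. now apply HPhi. now apply HPsi. }
  split; [eapply cder_analytic; exact Hd | split; [ring | ]].
  apply cder_is_derive. assert (D := Hd 0%C inD_0).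
  rewrite HPhi0, HPsi0, Cmult_0_l, Cplus_0_r, !Cmult_1_l in D. exact D.
- now apply Sub.
- apply Sub. apply fill0_eq; [ | exact CPhi]. intros z Hz nz. field.
  repeat split; auto.
- apply Sub. apply fill0_eq; [ | exact CPhi]. intros z Hz nz. field.
  repeat split; auto.
Qed.

Lemma C_derive_id (z : C) : C_derive (fun x => x) z = 1%C.
Proof. apply cder_C_derive, cder_id. Qed.

(** The last hypothesis is the equation that determines rad: with all Schwarz functions equal to the
    identity it says q(-rad) = 1 - 2/3. The strict bound 2/3 on the real part is the matching
    estimate for arbitrary Schwarz functions. *)
Lemma class_radius_ratio_class (Phi Psi L M : C -> C) (rad : R) :
  log_deriv Phi L -> log_deriv Psi M -> 0 < rad < 1 ->
  (forall w1 w2 w3 z, schwarz w1 -> schwarz w2 -> schwarz w3 -> Cmod z < rad ->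
    Rabs (Re (z * C_derive w1 z * L (w1 z) + z * C_derive w2 z * L (w2 z)
        + z * C_derive w3 z * M (w3 z))) < 2 / 3 /\
    Rabs (Im (z * C_derive w1 z * L (w1 z) + z * C_derive w2 z * L (w2 z)
        + z * C_derive w3 z * M (w3 z))) <= 1) ->
  (RtoC rad * (2 * L (- RtoC rad) + M (- RtoC rad)))%C = RtoC (2 / 3) ->
  is_class_radius S_Ne (ratio_class Phi Psi) rad.
Proof.
intros HPhi HPsi Hrad HB Hs. apply class_radius_S_Ne; [exact Hrad | | ].
- intros f Hf.
  destruct (ratio_class_product Phi Psi L M f HPhi HPsi Hf) as [w1 [w2 [w3 [S1 [S2 [S3 E]]]]]].
  exists (product_quotient L M w1 w2 w3). split.
  + now apply star_quotient_product with Phi Psi.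
  + intros z Hz. destruct (HB w1 w2 w3 z S1 S2 S3 Hz) as [A B].
    destruct (nephroid_covers _ _ A B) as [w [Hw Ew]]. exists w. split; [exact Hw | ].
    rewrite Ew. unfold product_quotient, Re, Im. now rewrite <- surjective_pairing.
- exists (fun z => z * (Phi z * Phi z * Psi z))%C,
    (product_quotient L M (fun z => z) (fun z => z) (fun z => z)).
  split; [ | split].
  + now apply ratio_class_extremal with L M.
  + assert (S := schwarz_id). now apply star_quotient_product with Phi Psi.
  + unfold product_quotient. rewrite !C_derive_id.
    transitivity (1 - RtoC rad * (2 * L (- RtoC rad) + M (- RtoC rad)))%C. ring.
    rewrite Hs, <- RtoC_minus. f_equal. lra.
Qed.

(** * Bounds for the logarithmic derivatives *)

Lemma inD_le_1 (z : C) : inD z -> Cmod z <= 1.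
Proof. unfold inD. lra. Qed.

Lemma schwarz_le (w : C -> C) (z : C) : schwarz w -> inD z -> Cmod (w z) <= Cmod z.
Proof.
intros [Hw [HD H0]] Hz. apply schwarz_mod; auto. intros x Hx. now apply inD_le_1, HD.
Qed.

(* Schwarz-Pick for w(z)/z, following Dieudonné. *)
Lemma schwarz_derivative (w : C -> C) (z : C) :
  schwarz w -> inD z ->
  exists v, (z * C_derive w z)%C = (w z + v)%C /\
    Cmod v * (1 - Cmod z * Cmod z) <= Cmod z * Cmod z - Cmod (w z) * Cmod (w z).
Proof.
intros [Hw [HD H0]] Hz.
assert (H1 : forall x, inD x -> Cmod (w x) <= 1) by (intros x Hx; now apply inD_le_1, HD).
set (phi := dslope w 0).
assert (Hphi : analytic phi) by (apply analytic_dslope; [exact Hw | exact inD_0]).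
assert (E : forall x, w x = (x * phi x)%C).
{ intros x. rewrite (dslope_eq w 0 x), H0. unfold phi. ring. }
assert (Ed : C_derive w z = (1 * phi z + z * C_derive phi z)%C).
{ apply cder_C_derive. apply cder_ext with (fun x => x * phi x)%C.
  intros x. now rewrite E.
  apply (cder_mult (fun x => x) phi). apply cder_id. now apply analytic_cder. }
assert (SP := schwarz_pick phi z Hphi
  (fun x Hx => schwarz_lemma w x Hw H1 H0 Hx) Hz).
exists (z * z * C_derive phi z)%C. split.
- rewrite Ed, E. ring.
- rewrite E, !Cmod_mult. assert (X := Cmod_ge_0 z). 
  apply Rmult_le_compat_l with (r := Cmod z * Cmod z) in SP; [lra | nra].
Qed.

(** With r = |z| and t = |w z| one has |v| <= (r - t)(r + t) / (1 - r^2), and r + t <= 2r <= 1 - r^2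
    turns this into |v| <= r - t. The hypothesis on r says r <= sqrt 2 - 1. *)
Lemma schwarz_derivative_le (w : C -> C) (z : C) :
  schwarz w -> inD z -> 2 * Cmod z <= 1 - Cmod z * Cmod z ->
  Cmod (z * C_derive w z) <= Cmod z.
Proof.
intros Hw Hz Hr. destruct (schwarz_derivative w z Hw Hz) as [v [-> Hv]].
assert (Hle := schwarz_le w z Hw Hz).
assert (T := Cmod_triangle (w z) v).
assert (P0 := Cmod_ge_0 (w z)). assert (P1 := Cmod_ge_0 z).
set (r := Cmod z) in *. set (t := Cmod (w z)) in *.
assert (HP : 0 < 1 - r * r) by nra.
assert (Cmod v <= r - t); [ | lra].
apply Rmult_le_reg_r with (1 := HP). apply Rle_trans with (1 := Hv).
replace (r * r - t * t) with ((r - t) * (r + t)) by ring.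
apply Rmult_le_compat_l; lra.
Qed.

(** With r = |z| and t = |w z|, Schwarz-Pick bounds |w'| by (1 - t^2)/(1 - r^2); the factor 1 - t
    cancels against |1 + w z| >= 1 - t, and 1 + t <= 1 + r leaves 1/(1 - r). *)
Lemma sqrt_log_deriv_le (w : C -> C) (z : C) :
  schwarz w -> inD z ->
  Cmod (z * C_derive w z * / (2 * (1 + w z))) <= Cmod z / (2 * (1 - Cmod z)).
Proof.
intros Hw Hz. assert (Hle := schwarz_le w z Hw Hz).
destruct Hw as [Aw [HD H0]].
assert (SP := schwarz_pick w z Aw (fun x Hx => inD_le_1 _ (HD x Hx)) Hz).
assert (HDz := HD z Hz).
assert (N : (1 + w z)%C <> 0%C) by now apply Re_pos_neq_0, Re_one_plus_pos.
assert (L : 1 - Cmod (w z) <= Cmod (1 + w z)).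
{ assert (X := Cmod_le_add 1 (1 + w z)). rewrite Cmod_1 in X.
  replace (1 - (1 + w z))%C with (- w z)%C in X by ring. rewrite Cmod_opp in X. lra. }
rewrite !Cmod_mult, Cmod_inv, Cmod_mult, Cmod_R, (Rabs_pos_eq 2)
  by (lra || (apply Cmult_neq_0; [apply two_neq_0 | exact N])).
unfold inD in *.
assert (P0 := Cmod_ge_0 (w z)). assert (P1 := Cmod_ge_0 z).
assert (P2 := Cmod_ge_0 (C_derive w z)).
set (r := Cmod z) in *. set (t := Cmod (w z)) in *. set (d := Cmod (C_derive w z)) in *.
set (m := Cmod (1 + w z)) in *.
assert (D : d * (1 - r) <= m).
{ assert (U : d * (1 - r) * (1 + r) <= m * (1 + r)); [ | ].
  - apply Rle_trans with ((1 - t) * (1 + t)). lra.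
    apply Rmult_le_compat; lra.
  - apply Rmult_le_reg_r with (2 := U). lra. }
apply (proj1 (Rle_div_r (r * d * / (2 * m)) _ (2 * (1 - r)) ltac:(lra))).
replace (r * d * / (2 * m) * (2 * (1 - r))) with (r * ((d * (1 - r)) / m))
  by (field; lra).
assert (d * (1 - r) / m <= 1) by (apply Rle_div_l; lra). nra.
Qed.

(* Equality holds for real u; |u / S| itself can exceed this bound. *)
Lemma Re_div_sqrt_le (u S : C) :
  (S * S)%C = (1 + u * u)%C -> 3 * (Cmod u * Cmod u) <= 1 ->
  Re (u / S) * Re (u / S) * (1 + Cmod u * Cmod u) <= Cmod u * Cmod u.
Proof.
intros HS Hu. set (T := Cmod u * Cmod u) in *.
assert (HT : 0 <= T) by (unfold T; assert (X := Cmod_ge_0 u); nra).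
set (s := (u * u)%C) in *.
assert (Hs : Cmod s = T) by (unfold s, T; apply Cmod_mult).
assert (Hs2 := Cmod_sq s). rewrite Hs in Hs2.
set (N := Cmod (S * S)). assert (HN : N = Cmod (1 + s)) by (unfold N; now rewrite HS).
assert (HN2 : N * N = 1 + 2 * Re s + T * T).
{ rewrite HN, Cmod_sq, Hs2. destruct s as [x y]; simpl. ring. }
assert (HNl : 1 - T <= N).
{ assert (X := Cmod_le_add 1 (1 + s)). rewrite Cmod_1 in X.
  replace (1 - (1 + s))%C with (- s)%C in X by ring. rewrite Cmod_opp in X. lra. }
assert (HNu : N <= 1 + T).
{ rewrite HN. assert (X := Cmod_triangle 1 s). rewrite Cmod_1 in X. lra. }
assert (NS : S <> 0%C).
{ intros E. unfold N in HNl. rewrite E, Cmod_mult, Cmod_0 in HNl. lra. }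
assert (NS2 : (1 + s)%C <> 0%C) by (rewrite <- HS; now apply Cmult_neq_0).
set (q := (u / S)%C).
(* The square of Re q is half the sum of |q|^2 and Re (q^2). The former is T / N, the latter follows
   from q^2 = s / (1 + s), and Re s can be expressed through N and T. *)
assert (Q1 : Re q * Re q + Im q * Im q = T / N).
{ rewrite <- Cmod_sq. unfold q. rewrite Cmod_div by exact NS.
  unfold T, N. rewrite Cmod_mult. field. intros E. apply NS. now apply Cmod_eq_0. }
assert (Q2 : (Re q * Re q - Im q * Im q) * (N * N) = Re s + T * T).
{ rewrite <- re_mult.
  assert (E : (q * q * RtoC (N * N))%C = (s * Cconj (1 + s))%C).
  { replace (RtoC (N * N)) with ((1 + s) * Cconj (1 + s))%C.
    - unfold q. replace (u / S * (u / S))%C with (s / (1 + s))%C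
        by (rewrite <- HS; unfold s; now field). now field.
    - rewrite HN, <- Cmod2_conj. f_equal. ring. }
  apply (f_equal Re) in E. rewrite re_scal_r in E. rewrite E, Hs2.
  destruct s as [x y]; simpl. ring. }
assert (Q3 : (Re q * Re q + Im q * Im q) * (N * N) = T * N)
  by (rewrite Q1; field; lra).
assert (HNN : 0 < N * N) by nra.
apply Rmult_le_reg_r with (1 := HNN).
(* This product is four times the difference of the two sides after multiplication by N^2. Its first
   factor vanishes for real u, and 3 T <= 1 makes the second one nonnegative. *)
assert (F : 0 <= (1 + T - N) * ((1 - 3 * T) * N + (1 - T * T))).
{ apply Rmult_le_pos. lra. nra. }
replace (Re q * Re q * (1 + T) * (N * N))
  with ((1 + T) * (Re q * Re q * (N * N))) by ring.
replace (Re q * Re q * (N * N)) with ((T * N + (Re s + T * T)) / 2) by lra.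
replace (Re s) with ((N * N - 1 - T * T) / 2) by lra.
nra.
Qed.

(** In z w' = u + v with T = |u|^2, the real part of u / S is at most sqrt (T / (1 + T)), which is
    2/9 at T = 4/77, and v / S is bounded by a multiple of r^2 - T. As T decreases from 4/77, the
    bound on the first term falls at rate 2, faster than the rate 12/10 at which the second can
    grow, so a Schwarz function with v <> 0 gains nothing. *)
Lemma crescent_log_deriv_le (w : C -> C) (z : C) :
  schwarz w -> 77 * (Cmod z * Cmod z) < 4 ->
  Rabs (Re (z * C_derive w z * / Csqrt (1 + w z * w z))) < 2 / 9 /\
  Rabs (Im (z * C_derive w z * / Csqrt (1 + w z * w z))) <= 1 / 3.
Proof.
intros Hw Hr. assert (P1 := Cmod_ge_0 z).
assert (Hz : inD z) by (unfold inD; nra).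
assert (Hle := schwarz_le w z Hw Hz).
assert (Hd := schwarz_derivative_le w z Hw Hz ltac:(nra)).
destruct (schwarz_derivative w z Hw Hz) as [v [Ev Hv]].
set (u := w z) in *. assert (P0 := Cmod_ge_0 u). assert (Pv := Cmod_ge_0 v).
set (S := Csqrt (1 + u * u)). assert (HS : (S * S)%C = (1 + u * u)%C) by apply Csqrt_sq.
set (r := Cmod z) in *. set (T := Cmod u * Cmod u) in *.
assert (HT : 0 <= T <= r * r) by (unfold T; nra).
set (sg := Cmod S). assert (Hsg0 : 0 <= sg) by apply Cmod_ge_0.
assert (Hsg : 1 - T <= sg * sg).
{ unfold sg. rewrite <- Cmod_mult, HS.
  assert (X := Cmod_le_add 1 (1 + u * u)). rewrite Cmod_1 in X.
  replace (1 - (1 + u * u))%C with (- (u * u))%C in X by ring.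
  rewrite Cmod_opp, Cmod_mult in X. fold T in X. lra. }
assert (Hsg1 : 97 / 100 <= sg) by nra.
assert (NS : S <> 0%C) by (apply Cmod_lt_neq_0; fold sg; lra).
split.
- assert (B := Re_div_sqrt_le u S HS ltac:(fold T; lra)). fold T in B.
  set (X := Rabs (Re (u / S))).
  assert (HX0 : 0 <= X) by apply Rabs_pos.
  assert (HX : X * X * (1 + T) <= T).
  { unfold X. rewrite <- Rabs_mult, Rabs_pos_eq by apply Rle_0_sqr. exact B. }
  (* tangent at X = 2/9 of the bound X^2 <= T / (1 + T) *)
  assert (HX1 : X <= 2 / 9 - 2 * (4 / 77 - T)).
  { apply Rnot_lt_le. intros L.
    assert (Y : (2 / 9 - 2 * (4 / 77 - T)) * (2 / 9 - 2 * (4 / 77 - T)) < X * X) by nra.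
    assert ((2 / 9 - 2 * (4 / 77 - T)) * (2 / 9 - 2 * (4 / 77 - T)) * (1 + T) < T) by nra.
    set (D := 4 / 77 - T) in *. replace T with (4 / 77 - D) in * by (unfold D; ring).
    assert (0 <= D * D * (5 - 4 * D)) by (apply Rmult_le_pos; [apply Rle_0_sqr | lra]).
    nra. }
  (* Here 1 / (1 - r^2) < 77/73 < 11/10, and division by |S| >= 97/100 keeps the constant below
     12/10. *)
  assert (Hvs : Cmod (v / S) <= 12 / 10 * (r * r - T)).
  { rewrite Cmod_div by exact NS. fold sg. apply Rle_div_l. lra.
    assert (Cmod v <= 11 / 10 * (r * r - T)) by nra. nra. }
  rewrite Ev.
  replace ((u + v) * / S)%C with (u / S + v / S)%C by (field; exact NS).
  rewrite re_plus. apply Rle_lt_trans with (1 := Rabs_triang _ _). fold X.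
  assert (R1 := re_le_Cmod (v / S)). lra.
- apply Rle_trans with (1 := im_le_Cmod _).
  rewrite Cmod_mult, Cmod_inv by exact NS. fold sg.
  change (Cmod (z * C_derive w z) / sg <= 1 / 3).
  apply Rle_div_l. lra. nra.
Qed.

(** * The three radii *)

Lemma Re_Im_bounds_of_Cmod (c : C) (B : R) :
  Cmod c <= B -> B < 2 / 3 -> Rabs (Re c) < 2 / 3 /\ Rabs (Im c) <= 1.
Proof.
intros H HB. assert (X := re_le_Cmod c). assert (Y := im_le_Cmod c). split; lra.
Qed.

Theorem radius_T1 : is_class_radius S_Ne T1 (1 / 4).
Proof.
apply (class_radius_ratio_class _ _ _ _ _ log_deriv_Cexp log_deriv_sqrt1p). lra.
- intros w1 w2 w3 z H1 H2 H3 Hz. assert (P := Cmod_ge_0 z).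
  assert (Dz : inD z) by (unfold inD; lra).
  assert (B1 := schwarz_derivative_le w1 z H1 Dz ltac:(nra)).
  assert (B2 := schwarz_derivative_le w2 z H2 Dz ltac:(nra)).
  assert (B3 := sqrt_log_deriv_le w3 z H3 Dz).
  rewrite !Cmult_1_r.
  apply (Re_Im_bounds_of_Cmod _ (Cmod z + Cmod z + Cmod z / (2 * (1 - Cmod z)))).
  + apply Rle_trans with (1 := Cmod_triangle _ _).
    assert (X := Cmod_triangle (z * C_derive w1 z) (z * C_derive w2 z)). lra.
  (* At |z| = 1/4 the two exponential terms contribute 1/2 and the square root term 1/6, together
     2/3. *)
  + assert (Cmod z / (2 * (1 - Cmod z)) < 1 / 6); [ | lra].
    apply Rlt_div_l; lra.
- rewrite !RtoC_div by lra. field.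
Qed.

Theorem radius_T2 : is_class_radius S_Ne T2 ((4 - sqrt 10) / 3).
Proof.
assert (S10 : sqrt 10 * sqrt 10 = 10) by (apply sqrt_sqrt; lra).
assert (S0 := sqrt_pos 10).
assert (L1 : 316 / 100 < sqrt 10) by nra.
assert (L2 : sqrt 10 < 317 / 100) by nra.
apply (class_radius_ratio_class _ _ _ _ _ log_deriv_sqrt1p log_deriv_Cexp). lra.
- intros w1 w2 w3 z H1 H2 H3 Hz. assert (P := Cmod_ge_0 z).
  assert (Dz : inD z) by (unfold inD; lra).
  assert (B1 := sqrt_log_deriv_le w1 z H1 Dz).
  assert (B2 := sqrt_log_deriv_le w2 z H2 Dz).
  assert (B3 := schwarz_derivative_le w3 z H3 Dz ltac:(nra)).
  rewrite Cmult_1_r.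
  apply (Re_Im_bounds_of_Cmod _ (Cmod z / (2 * (1 - Cmod z)) + Cmod z / (2 * (1 - Cmod z))
    + Cmod z)).
  + apply Rle_trans with (1 := Cmod_triangle _ _).
    assert (X := Cmod_triangle (z * C_derive w1 z * / (2 * (1 + w1 z)))
      (z * C_derive w2 z * / (2 * (1 + w2 z)))). lra.
  + replace (Cmod z / (2 * (1 - Cmod z)) + Cmod z / (2 * (1 - Cmod z)) + Cmod z)
      with (Cmod z / (1 - Cmod z) + Cmod z) by (field; unfold inD in Dz; lra).
    assert (Cmod z / (1 - Cmod z) < 2 / 3 - Cmod z); [ | lra].
    apply Rlt_div_l. unfold inD in Dz; lra. nra.
- set (rho := (4 - sqrt 10) / 3).
  (* The equation r/(1-r) + r = 2/3 with denominators cleared; rho is its smaller root. *)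
  assert (E : 3 * (rho * rho) = 8 * rho - 2) by (unfold rho; nra).
  assert (Hrho : rho < 1) by (unfold rho; lra).
  assert (N : RtoC (1 - rho) <> 0%C) by (intros Z; apply RtoC_inj in Z; lra).
  transitivity (RtoC (rho * (/ (1 - rho) + 1))).
  + rewrite RtoC_mult, RtoC_plus, RtoC_inv by lra. rewrite RtoC_minus in N |- *.
    field. exact N.
  + f_equal. apply Rmult_eq_reg_r with (1 - rho); [ | lra].
    replace (rho * (/ (1 - rho) + 1) * (1 - rho)) with (rho * (2 - rho)) by (field; lra).
    lra.
Qed.

Theorem radius_T3 : is_class_radius S_Ne T3 (2 / sqrt 77).
Proof.
assert (S77 : sqrt 77 * sqrt 77 = 77) by (apply sqrt_sqrt; lra).
assert (S0 : 8 < sqrt 77) by (assert (X := sqrt_pos 77); nra).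
assert (E : 77 * (2 / sqrt 77 * (2 / sqrt 77)) = 4).
{ rewrite <- S77 at 1. field. lra. }
assert (Hr0 : 0 < 2 / sqrt 77) by (apply Rdiv_lt_0_compat; lra).
apply (class_radius_ratio_class _ _ _ _ _ log_deriv_crescent log_deriv_crescent).
- split; [exact Hr0 | nra].
- intros w1 w2 w3 z H1 H2 H3 Hz. assert (P := Cmod_ge_0 z).
  assert (Hr : 77 * (Cmod z * Cmod z) < 4) by nra.
  destruct (crescent_log_deriv_le w1 z H1 Hr) as [A1 B1].
  destruct (crescent_log_deriv_le w2 z H2 Hr) as [A2 B2].
  destruct (crescent_log_deriv_le w3 z H3 Hr) as [A3 B3].
  rewrite !re_plus, !im_plus.
  apply Rabs_lt_between in A1. apply Rabs_lt_between in A2. apply Rabs_lt_between in A3.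
  apply Rabs_le_between in B1. apply Rabs_le_between in B2. apply Rabs_le_between in B3.
  split; [apply Rabs_lt_between | apply Rabs_le_between]; lra.
- set (rho := 2 / sqrt 77) in *. clearbody rho.
  replace (1 + - RtoC rho * - RtoC rho)%C with (RtoC (81 / 77)).
  2: { transitivity (RtoC (1 + rho * rho)).
       - f_equal. lra.
       - rewrite RtoC_plus, RtoC_mult. ring. }
  set (s := Csqrt (RtoC (81 / 77))).
  (* Since rho^2 = 4/77, the square of 9 rho / 2 is 81/77, and positivity of the real part selects
     this root. Each of the three terms then has absolute value rho / (9 rho / 2) = 2/9. *)
  assert (Es : s = RtoC (9 / 2 * rho)).
  { assert (Q := Csqrt_sq (RtoC (81 / 77))).
    assert (Pos := Csqrt_Re_pos (RtoC (81 / 77)) ltac:(simpl; lra)). fold s in Q, Pos.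
    assert (F : ((s - RtoC (9 / 2 * rho)) * (s + RtoC (9 / 2 * rho)))%C = 0%C).
    { transitivity (s * s - RtoC (9 / 2 * rho * (9 / 2 * rho)))%C.
      rewrite (RtoC_mult (9 / 2 * rho)). ring.
      rewrite Q, <- RtoC_minus. f_equal. lra. }
    assert (N : (s + RtoC (9 / 2 * rho))%C <> 0%C).
    { apply Re_pos_neq_0. rewrite re_plus, re_RtoC. lra. }
    apply Ceq_minus.
    replace (s - RtoC (9 / 2 * rho))%C with
      ((s - RtoC (9 / 2 * rho)) * (s + RtoC (9 / 2 * rho)) / (s + RtoC (9 / 2 * rho)))%C
      by now field.
    rewrite F. now field. }
  rewrite Es, <- RtoC_inv by lra.
  transitivity (RtoC (rho * (2 * / (9 / 2 * rho) + / (9 / 2 * rho)))).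
  + now rewrite RtoC_mult, RtoC_plus, RtoC_mult.
  + f_equal. field. lra.
Qed.

Theorem corollary3p7 :
  is_class_radius S_Ne T1 (1 / 4) /\
  is_class_radius S_Ne T2 ((4 - sqrt 10) / 3) /\
  is_class_radius S_Ne T3 (2 / sqrt 77).
Proof. exact (conj radius_T1 (conj radius_T2 radius_T3)). Qed.
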